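(* Let $\beta>0$ and let either $0<\alpha<1/2$, or $\alpha=1/2$ and $\beta\ge 1/2$. Let $\Omega=[0,\alpha)\cup[\beta+\alpha,\beta+1)\subset\mathbb{R}$, let $g=\chi_\Omega$, and let $\Lambda\subset\mathbb{R}^2$ be a discrete countable set. Define $D\subset\mathbb{R}^2$ as follows. - If $\alpha<1/2$: $D=\Omega\times[0,1)$. - If $\alpha=1/2$ and $\beta\in\frac12\mathbb{N}$: $D=\Omega\times\bigcup_{k=0}^{2\beta}\left[\frac{2k}{2\beta+1},\frac{2k+1}{2\beta+1}\right)$. - If $\alpha=1/2$ and $\beta\notin\frac12\mathbb{N}$: $D=\Omega\times\left(\bigcup_{k=0}^{\lfloor 2\beta\rfloor}\left[\frac{2k}{2\beta+1},\frac{2k+1}{2\beta+1}\right)\cup\left[\frac{2(\lfloor 2\beta\rfloor+1)}{2\beta+1},\frac{2(\lfloor 2\beta\rfloor+1)+\{2\beta\}}{2\beta+1}\right)\right)$. Then $\{g_\lambda\}_{\lambda\in\Lambda}$ is an orthonormal basis of $L^2(\mathbb{R})$ if and only if both of the following hold: (i) $\Lambda-\Lambda\subset\mathcal{Z}(V_gg)\cup\{0\}$; (ii) $\Lambda+D=\mathbb{R}^2$ (i.e. $D$ tiles $\mathbb{R}^2$ with translation set $\Lambda$).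
   Context: $\mathbb{N}$ denotes the positive integers; $\lfloor x\rfloor$ is the floor of $x$ and $\{x\}=x-\lfloor x\rfloor$. For $\lambda=(t,\nu)\in\mathbb{R}^2$, $g_\lambda(x)=g(x-t)e^{2\pi i x\nu}$. The short time Fourier transform of $g$ with window $g$ is $V_gg(t,\nu)=\int_{\mathbb{R}}g(x)\overline{g(x-t)}e^{-2\pi i x\nu}\,dx$, and $\mathcal{Z}(V_gg)=\{(t,\nu)\in\mathbb{R}^2: V_gg(t,\nu)=0\}$. $\Lambda-\Lambda=\{\lambda-\mu:\lambda,\mu\in\Lambda\}$. The notation $\Lambda+D=\mathbb{R}^2$ (tiling) means $\sum_{\lambda\in\Lambda}\chi_D(x-\lambda)=1$ for almost every $x\in\mathbb{R}^2$. *)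

(* Defs.v *)
From HB Require Import structures.
From mathcomp Require Import all_boot all_order all_algebra.
From mathcomp Require Import all_classical all_reals all_analysis.
From mathcomp.real_closed Require Export complex.
Set Implicit Arguments.
Unset Strict Implicit.
Unset Printing Implicit Defensive.
Import Order.TTheory GRing.Theory Num.Theory.
Import numFieldNormedType.Exports.

Local Open Scope classical_set_scope.
Local Open Scope ring_scope.
Local Open Scope complex_scope.

Section L2.
Context {R : realType}.
Implicit Types f h : R -> R[i].

(* e^{i theta} for a real angle theta *)
Definition cis (theta : R) : R[i] := cos theta +i* sin theta.

(* Lebesgue integral over the line of a complex-valued function; as for the
   library's [Rintegral], the value is meaningful for integrable f only *)
Definition cintegral f : R[i] :=
  Rintegral lebesgue_measure setT (fun x => complex.Re (f x))
  +i* Rintegral lebesgue_measure setT (fun x => complex.Im (f x)).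

(* In R[i] the modulus is itself complex (with zero imaginary part), hence the
   outer Re *)
Definition L2norm f : \bar R :=
  Lnorm lebesgue_measure 2%:E (fun x => (complex.Re `|f x|)%:E).

Definition L2 : set (R -> R[i]) :=
  [set f | [/\ measurable_fun setT (fun x => complex.Re (f x)),
               measurable_fun setT (fun x => complex.Im (f x)) &
               (L2norm f < +oo)%E]].

Definition L2dot f h : R[i] := cintegral (fun x => f x * (h x)^*).

(* The family (e i)_{i in I} is orthonormal in L^2 (as an indexed family: e is
   in particular injective on I) and its linear span is dense. *)
Definition orthonormal_basis (T : eqType) (I : set T) (e : T -> R -> R[i]) :=
  [/\ forall i, I i -> L2 (e i),
      forall i j, I i -> I j -> L2dot (e i) (e j) = (i == j)%:R &
      forall f, L2 f -> forall eps : R, 0 < eps ->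
        exists (n : nat) (s : 'I_n -> T) (c : 'I_n -> R[i]),
          (forall k, I (s k)) /\
          (L2norm (fun x => f x - \sum_(k < n) c k * e (s k) x)%R < eps%:E)%E].

End L2.

Section Gabor.
Context {R : realType}.
Implicit Types (g h : R -> R[i]) (l : R * R) (Lambda D : set (R * R)).

Definition tfshift g l : R -> R[i] :=
  fun x => g (x - l.1) * cis (2 * pi * x * l.2).

(* V_g h, with window g *)
Definition stft g h l : R[i] :=
  cintegral (fun x => h x * (g (x - l.1))^* * cis (- (2 * pi * x * l.2))).

Definition zero_set (F : R * R -> R[i]) : set (R * R) := [set l | F l = 0].

Definition plane_measure := (@lebesgue_measure R \x @lebesgue_measure R)%E.

Definition tiles Lambda D :=
  {ae plane_measure, forall x : R * R,
    \esum_(l in Lambda) (\1_D (x - l) : R)%:E = 1%E}.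

End Gabor.

Section TilingSet.
Context {R : realType}.
Implicit Types alpha beta : R.

Definition Omega alpha beta : set R :=
  `[0, alpha[ `|` `[beta + alpha, beta + 1[.

Definition window alpha beta : R -> R[i] :=
  fun x => (\1_(Omega alpha beta) x)%:C.

Definition half_integer beta := exists n : nat, (0 < n)%N /\ beta = n%:R / 2.

Definition frac_part (x : R) : R := x - (Num.floor x)%:~R.

(* the k-th interval [2k/(2 beta + 1), (2k+1)/(2 beta + 1)) *)
Definition cell beta (k : nat) : set R :=
  `[2 * k%:R / (2 * beta + 1), (2 * k%:R + 1) / (2 * beta + 1)[.

Definition last_cell beta : set R :=
  let m : R := (Num.floor (2 * beta))%:~R + 1 in
  `[2 * m / (2 * beta + 1),
    (2 * m + frac_part (2 * beta)) / (2 * beta + 1)[.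

(* meant for alpha <= 1/2: when alpha < 1/2 fails, alpha = 1/2 *)
Definition fibre alpha beta : set R :=
  if alpha < 2^-1 then `[0, 1[%classic
  else if `[< half_integer beta >] then
    \bigcup_(k in [set k : nat | k%:R <= 2 * beta]) cell beta k
  else
    (\bigcup_(k in [set k : nat | k%:Z <= Num.floor (2 * beta)]) cell beta k)
    `|` last_cell beta.

Definition tiling_set alpha beta : set (R * R) :=
  Omega alpha beta `*` fibre alpha beta.

End TilingSet.

(* Main.v *)
(** Both directions rest on one fact about a countable set Lambda and nonnegative
    functions u, v on the plane: if the translates of u by Lambda sum to 1 almost
    everywhere, those of v sum to at most c everywhere, int u <= 1 and
    int v >= c, then the translates of v sum to c almost everywhere.  If the
    system is a basis, take for u the spectrogram |V_g g|^2, whose translates sum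
    to 1 by Parseval, and for v the indicator of D: by orthogonality its
    translates are disjoint once V_g g has no zero on D - D.  (This fails when
    alpha < 1/2 and beta < 1 - alpha; then a set of area larger than 1 is packed
    instead, which is absurd.)  Conversely, if D tiles, take for u the indicator
    of D and for v the spectrogram of 1_H, where H is open of finite measure:
    Bessel's inequality becomes an equality for almost every time-frequency
    shift of 1_H, so 1_H lies in the closed span, and such functions are total.
    The integrals of spectrograms come from Plancherel's identity for indicator
    functions, obtained by Abel summation with a Poisson kernel; the inequality
    <= for measurable sets and >= for open sets suffices. *)
Require Import Defs.
From HB Require Import structures.
From mathcomp Require Import all_boot all_order all_algebra.
From mathcomp Require Import all_classical all_reals all_analysis.
From mathcomp Require Import measurable_realfun.
From mathcomp Require Import ring lra.
Set Implicit Arguments.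
Unset Strict Implicit.
Unset Printing Implicit Defensive.
Import Order.TTheory GRing.Theory Num.Theory.
Import numFieldNormedType.Exports.

Local Open Scope classical_set_scope.
Local Open Scope ring_scope.

(** * Translation invariance and countable sums *)

Section Line.
Context {R : realType}.
Local Notation mu := (@lebesgue_measure R).

(** The zeros of V_g g dictate the shape of D. At time shift t, |V_g g(t, .)| is the modulus of the
    Fourier transform of Omega intersected with Omega + t, a union of at most three intervals. Two
    short intervals cancel at a frequency nu only if their lengths agree and their centres are in
    phase opposition. For alpha < 1/2 and t <= beta in Omega - Omega the lengths alpha - t and 1 -
    alpha - t differ, so nothing vanishes for |nu| < 1 and the fibre [0, 1) is safe. For alpha = 1/2
    they agree, and zeros with |nu| < 2 sit where (2 beta + 1) nu is odd. The cells therefore keep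
    those x in [0, 2) for which the integer part of (2 beta + 1) x is even, cut off at total length
    1: differences, once rescaled, stay at distance less than 1 from an even integer. The two halves
    of Plancherel have separate uses: the upper bound serves the window against itself, the lower
    bound an open H against the interior of Omega, which has full measure. At interior points the
    Poisson means converge by an explicit computation, without Lebesgue points. *)

Lemma measurable_addr (a : R) : measurable_fun setT (fun x : R => x + a).
Proof. exact: measurable_funD. Qed.

Lemma measurable_subl (a : R) : measurable_fun setT (fun x : R => a - x).
Proof. exact: measurable_funB. Qed.

(** The pushforward of Lebesgue measure along the translation has the right value on half-open
    intervals, and these values determine the measure. *)
Lemma lebesgue_measure_addr (a : R) (A : set R) : measurable A ->
  mu ((fun x => x + a) @^-1` A) = mu A.
Proof.
move=> mA; have mf : @measurable_fun _ _ (measurableTypeR R) (measurableTypeR R) setT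
  (fun x => x + a) by exact: measurable_addr.
pose f : {mfun measurableTypeR R >-> measurableTypeR R} :=
  HB.pack (fun x : R => x + a) (isMeasurableFun.Build _ _ _ _ _ mf).
apply/esym/(@lebesgue_measure_unique R (pushforward mu f)) => //.
move=> X [[x1 x2] _ <-] /=.
rewrite lebesgue_measure_itv /=.
rewrite /pushforward /=.
have -> : (fun x => x + a) @^-1` `]x1, x2] = `]x1 - a, x2 - a]%classic.
  by apply/seteqP; split=> x /=; rewrite !in_itv/= ltrBlDr lerBrDr.
rewrite lebesgue_measure_itv /= !lte_fin ltrD2r; case: ifP => // _.
by rewrite -!EFinB; congr EFin; ring.
Qed.

Lemma lebesgue_measure_subl (a : R) (A : set R) : measurable A ->
  mu ((fun x => a - x) @^-1` A) = mu A.
Proof.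
move=> mA; have mf : @measurable_fun _ _ (measurableTypeR R) (measurableTypeR R) setT
  (fun x => a - x) by exact: measurable_subl.
pose f : {mfun measurableTypeR R >-> measurableTypeR R} :=
  HB.pack (fun x : R => a - x) (isMeasurableFun.Build _ _ _ _ _ mf).
apply/esym/(@lebesgue_measure_unique R (pushforward mu f)) => //.
move=> X [[x1 x2] _ <-] /=.
rewrite lebesgue_measure_itv /=.
rewrite /pushforward /=.
have -> : (fun x => a - x) @^-1` `]x1, x2] = `[a - x2, a - x1[%classic.
  by apply/seteqP; split=> x /=; rewrite !in_itv/= => /andP[? ?]; apply/andP; split; lra.
rewrite lebesgue_measure_itv /= !lte_fin ltrD2l ltrN2; case: ifP => // _.
by rewrite -!EFinB; congr EFin; ring.
Qed.

Local Open Scope ereal_scope.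

Lemma ge0_integral_addr (a : R) (f : R -> \bar R) : measurable_fun setT f ->
  (forall x, 0 <= f x) -> \int[mu]_x f (x + a)%R = \int[mu]_x f x.
Proof.
move=> mf f0.
have /= := @ge0_integral_pushforward _ _ (measurableTypeR R) (measurableTypeR R) R _ (measurable_addr a) mu setT f measurableT mf (fun x _ => f0 x).
rewrite preimage_setT => <-.
apply: eq_measure_integral => [mT A mA|mf' A mA _].
  by apply: (measurable_addr a) => //.
exact: lebesgue_measure_addr.
Qed.

Lemma ge0_integral_subl (a : R) (f : R -> \bar R) : measurable_fun setT f ->
  (forall x, 0 <= f x) -> \int[mu]_x f (a - x)%R = \int[mu]_x f x.
Proof.
move=> mf f0.
have /= := @ge0_integral_pushforward _ _ (measurableTypeR R) (measurableTypeR R) R _ (measurable_subl a) mu setT f measurableT mf (fun x _ => f0 x).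
rewrite preimage_setT => <-.
apply: eq_measure_integral => [mT A mA|mf' A mA _].
  by apply: (measurable_subl a) => //.
exact: lebesgue_measure_subl.
Qed.

Lemma integral_addr (a : R) (f : R -> \bar R) : measurable_fun setT f ->
  \int[mu]_x f (x + a)%R = \int[mu]_x f x.
Proof.
move=> mf; rewrite [LHS]integralE [RHS]integralE.
congr (_ - _).
  rewrite -[RHS](@ge0_integral_addr a f^\+)//; last exact: measurable_funepos.
  by apply: eq_integral => x _; rewrite !funeposE.
rewrite -[RHS](@ge0_integral_addr a f^\-)//; last exact: measurable_funeneg.
by apply: eq_integral => x _; rewrite !funenegE.
Qed.

End Line.

Section CountableSum.
Context {R : realType}.
Local Open Scope ereal_scope.

Lemma countable_set_bij (T : pointedType) (A : set T) : countable A ->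
  exists (e : nat -> T) (B : set nat), set_bij B A e.
Proof.
move=> /countable_bijP[B /card_esym/card_set_bijP[e eB]].
by exists e, B.
Qed.

(** The enumeration [e], [B] is chosen before the summand [a], so a sum depending on a parameter
    becomes one series with a fixed enumeration, to which measurability and termwise integration of
    series apply. *)
Lemma esum_nneseries (T : pointedType) (A : set T) : countable A ->
  exists (e : nat -> T) (B : set nat), forall a : T -> \bar R,
    (forall t, 0 <= a t) ->
    \esum_(t in A) a t = \sum_(n <oo) (if n \in B then a (e n) else 0).
Proof.
move=> /countable_set_bij[e [B eB]]; exists e, B => a a0.
rewrite (@reindex_esum _ _ _ B A e a eB) esum_mkcond nneseries_esumT// => n.
by case: ifP.
Qed.

Lemma measurable_esum d (X : measurableType d) (T : pointedType) (A : set T)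
    (f : T -> X -> \bar R) : countable A ->
  (forall t, measurable_fun setT (f t)) -> (forall t x, 0 <= f t x) ->
  measurable_fun setT (fun x => \esum_(t in A) f t x).
Proof.
move=> /esum_nneseries[e [B eB]] mf f0.
have -> := funext (fun x => eB (f^~ x) (f0^~ x)).
apply: ge0_emeasurable_sum.
  by move=> n x _; case: ifP.
by move=> n; case: (n \in B) => //; exact: measurable_cst.
Qed.

Lemma integral_esum d (X : measurableType d) (m : {measure set X -> \bar R})
    (T : pointedType) (A : set T) (f : T -> X -> \bar R) : countable A ->
  (forall t, measurable_fun setT (f t)) -> (forall t x, 0 <= f t x) ->
  \int[m]_x (\esum_(t in A) f t x) = \esum_(t in A) \int[m]_x f t x.
Proof.
move=> /esum_nneseries[e [B eB]] mf f0.
have -> := funext (fun x => eB (f^~ x) (f0^~ x)).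
rewrite eB; last by move=> t; exact: integral_ge0.
rewrite integral_nneseries//; last by move=> n x _; case: ifP.
  by apply: eq_eseriesr => n _; case: (n \in B); rewrite ?integral0.
by move=> n; case: (n \in B) => //; exact: measurable_cst.
Qed.

Lemma esumZl (T : pointedType) (A : set T) (c : R) (a : T -> \bar R) :
  countable A -> (forall t, 0 <= a t) -> (0 <= c)%R ->
  \esum_(t in A) (c%:E * a t) = c%:E * \esum_(t in A) a t.
Proof.
move=> /esum_nneseries[e [B eB]] a0 c0.
rewrite !eB//; last by move=> t; rewrite mule_ge0.
rewrite -nneseriesZl; last by move=> i _; case: ifP.
by apply: eq_eseriesr => n _; case: ifP => //; rewrite mule0.
Qed.

End CountableSum.

Section Plane.
Context {R : realType}.
Local Notation mu := (@lebesgue_measure R).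
Local Notation mu2 := (@plane_measure R).
Local Open Scope ereal_scope.

Lemma measurable_plane_sub (l : R * R) :
  measurable_fun setT (fun x : R * R => (x - l)%R).
Proof.
apply/measurable_fun_pairP; split => /=.
  by apply: measurable_funB => //; exact: measurable_fst.
by apply: measurable_funB => //; exact: measurable_snd.
Qed.

Lemma measurable_plane_rsub (l : R * R) :
  measurable_fun setT (fun x : R * R => (l - x)%R).
Proof.
apply/measurable_fun_pairP; split => /=.
  by apply: measurable_funB => //; exact: measurable_fst.
by apply: measurable_funB => //; exact: measurable_snd.
Qed.

Lemma ge0_integral_plane_sub (l : R * R) (f : R * R -> \bar R) :
  measurable_fun setT f -> (forall x, 0 <= f x) ->
  \int[mu2]_x f (x - l)%R = \int[mu2]_x f x.
Proof.
move=> mf f0; rewrite /plane_measure.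
rewrite fubini_tonelli1//=; last first.
  by apply: measurableT_comp => //; exact: measurable_plane_sub.
rewrite [RHS](@fubini_tonelli1 _ _ _ _ _ mu mu f mf f0) /fubini_F.
transitivity (\int[mu]_x \int[mu]_y f (x - l.1, y)%R).
  apply: eq_integral => x _.
  apply: (@ge0_integral_addr R (- l.2) (fun y => f (x - l.1, y)%R)) => //.
  by apply: measurableT_comp => //; exact: measurable_pair1.
apply: (@ge0_integral_addr R (- l.1) (fun x => \int[mu]_y f (x, y))) => //.
  exact: measurable_fun_fubini_tonelli_F.
by move=> x; exact: integral_ge0.
Qed.

Lemma ge0_integral_plane_rsub (l : R * R) (f : R * R -> \bar R) :
  measurable_fun setT f -> (forall x, 0 <= f x) ->
  \int[mu2]_x f (l - x)%R = \int[mu2]_x f x.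
Proof.
move=> mf f0; rewrite /plane_measure.
rewrite fubini_tonelli1//=; last first.
  by apply: measurableT_comp => //; exact: measurable_plane_rsub.
rewrite [RHS](@fubini_tonelli1 _ _ _ _ _ mu mu f mf f0) /fubini_F.
transitivity (\int[mu]_x \int[mu]_y f (l.1 - x, y)%R).
  apply: eq_integral => x _.
  apply: (@ge0_integral_subl R l.2 (fun y => f (l.1 - x, y)%R)) => //.
  by apply: measurableT_comp => //; exact: measurable_pair1.
apply: (@ge0_integral_subl R l.1 (fun x => \int[mu]_y f (x, y))) => //.
  exact: measurable_fun_fubini_tonelli_F.
by move=> x; exact: integral_ge0.
Qed.

End Plane.

Lemma ae_plane_imp (R : realType) (P Q : R * R -> Prop) :
  {ae @plane_measure R, forall y, P y} -> (forall y, P y -> Q y) ->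
  {ae @plane_measure R, forall y, Q y}.
Proof.
by move=> [N [mN N0 PN]] PQ; exists N; split => // y /= nQ; apply: PN => /= /PQ.
Qed.

Section SigmaFiniteProduct.
Local Open Scope ereal_scope.
Context (R : realType).
Context d1 d2 (T1 : measurableType d1) (T2 : measurableType d2) (m1 : {sigma_finite_measure set T1 -> \bar R}) (m2 : {sigma_finite_measure set T2 -> \bar R}).
Lemma sigma_finite_prod : sigma_finite setT (m1 \x m2).
Proof.
have /sigma_finiteP[F [TF ndF Foo]] := sigma_finiteT m1.
have /sigma_finiteP[G [TG ndG Goo]] := sigma_finiteT m2.
exists (fun n => F n `*` G n) => [|n].
  apply/seteqP; split=> // -[x y] _.
  have [n _ Fn] : (\bigcup_n F n) x by rewrite -TF.
  have [k _ Gk] : (\bigcup_n G n) y by rewrite -TG.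
  exists (n + k)%N => //=; split.
    exact: (subsetPset _ _ (ndF _ _ (leq_addr _ _))).
  exact: (subsetPset _ _ (ndG _ _ (leq_addl _ _))).
have [[mF Fy] [mG Gy]] := (Foo n, Goo n).
split; first exact: measurableX.
by rewrite product_measure1E// lte_mul_pinfty// ge0_fin_numE.
Qed.

(** Exchange of two integrals over the plane, needed for the convolution in [packing_tile]; the
    product measure is packed as a sigma-finite measure for this purpose. *)
Lemma fubini_tonelli_prod (f : (T1 * T2) * (T1 * T2) -> \bar R) : measurable_fun [set: (T1 * T2) * (T1 * T2)] f ->
  (forall x, 0 <= f x) ->
  \int[m1 \x m2]_x \int[m1 \x m2]_y f (x, y) = \int[m1 \x m2]_y \int[m1 \x m2]_x f (x, y).
Proof. move=> mf f0.
pose m : {sigma_finite_measure set (T1 * T2)%type -> \bar R} := HB.pack (m1 \x m2) (Measure_isSigmaFinite.Build _ _ _ (m1 \x m2) sigma_finite_prod).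
exact: (@fubini_tonelli _ _ _ _ R m m f mf f0).
Qed.
End SigmaFiniteProduct.

(** * Packings and tilings *)

Section Tiling.
Context {R : realType}.
Local Notation mu2 := (@plane_measure R).
Variables (Lambda : set (R * R)) (cL : countable Lambda).
Variables (u v : R * R -> R).
Hypotheses (mu_ : measurable_fun setT u) (mv : measurable_fun setT v).
Hypotheses (u0 : forall x, 0 <= u x) (v0 : forall x, 0 <= v x).
Local Open Scope ereal_scope.

Let mrs (x : R * R) : measurable_fun setT (fun y : R * R => u (x - y)%R).
Proof. by apply: measurableT_comp => //; exact: measurable_plane_rsub. Qed.

Let ms (x : R * R) : measurable_fun setT (fun y : R * R => v (y - x)%R).
Proof. by apply: measurableT_comp => //; exact: measurable_plane_sub. Qed.

Let emu : measurable_fun setT (fun y => (u y)%:E).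
Proof. exact/measurable_EFinP. Qed.

Let emv : measurable_fun setT (fun y => (v y)%:E).
Proof. exact/measurable_EFinP. Qed.

Let emrs (x : R * R) : measurable_fun setT (fun y : R * R => (u (x - y))%:E).
Proof. by apply/measurable_EFinP; exact: mrs. Qed.

Hypothesis tile_u : {ae mu2, forall x, \esum_(l in Lambda) (u (x - l)%R)%:E = 1}.

(** Reflections and translations preserve null sets, as is seen by integrating the indicator of the
    exceptional set. *)
Lemma ae_plane_rsub (P : R * R -> Prop) (x : R * R) :
  {ae mu2, forall y, P y} -> {ae mu2, forall y, P (x - y)%R}.
Proof.
move=> [N [mN N0 PN]]; exists ((fun y : R * R => x - y)%R @^-1` N); split.
- by rewrite -[X in measurable X]setTI; exact: (measurable_plane_rsub x).
- have mI : measurable_fun setT (fun y : R * R => (\1_N y)%:E : \bar R).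
    by apply/measurable_EFinP; exact: measurable_indic.
  have mpre : measurable ((fun y => x - y)%R @^-1` N).
    by rewrite -[X in measurable X]setTI; exact: (measurable_plane_rsub x).
  have : \int[mu2]_y (\1_((fun y => x - y)%R @^-1` N) y)%:E = \int[mu2]_y (\1_N y)%:E.
    by apply: (ge0_integral_plane_rsub x mI) => y; rewrite lee_fin.
  by rewrite !integral_indic// !setIT => h; exact: (etrans h N0).
- by move=> y /= /PN.
Qed.

(* Translate y by l in the l-th term and sum the translates of u first. *)
Lemma integral_tile_mul (x : R * R) :
  \int[mu2]_y ((u (x - y)%R)%:E * \esum_(l in Lambda) (v (y - l)%R)%:E)
  = \int[mu2]_y (v y)%:E.
Proof.
transitivity (\int[mu2]_y
    \esum_(l in Lambda) (u (x - y) * v (y - l))%:E).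
  apply: eq_integral => y _; rewrite -esumZl//.
  by move=> l; rewrite lee_fin.
rewrite integral_esum//; last 2 first.
  by move=> l; apply/measurable_EFinP; apply: measurable_funM; [exact: mrs|exact: ms].
  by move=> l y; rewrite lee_fin mulr_ge0.
transitivity (\esum_(l in Lambda) \int[mu2]_y (u (x - y - l) * v y)%:E).
  apply: eq_esum => l _.
  rewrite -[RHS](ge0_integral_plane_sub l); last 2 first.
    apply/measurable_EFinP; apply: measurable_funM => //.
    have : measurable_fun setT (fun y : R * R => u (x - l - y)%R) by [].
    by congr measurable_fun; apply/funext => y; rewrite addrAC.
    by move=> y; rewrite lee_fin mulr_ge0.
  by apply: eq_integral => y _; rewrite opprB addrA addrAC addrK.
rewrite -integral_esum//; last 2 first.
  move=> l; apply/measurable_EFinP; apply: measurable_funM => //.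
  have : measurable_fun setT (fun y : R * R => u (x - l - y)%R) by [].
  by congr measurable_fun; apply/funext => y; rewrite addrAC.
  by move=> l y; rewrite lee_fin mulr_ge0.
transitivity (\int[mu2]_y ((v y)%:E * \esum_(l in Lambda) (u (x - y - l)%R)%:E)).
  apply: eq_integral => y _; rewrite -esumZl//; last first.
    by move=> l; rewrite lee_fin.
  by apply: eq_esum => l _; rewrite mulrC.
apply: ge0_ae_eq_integral => //.
- apply: emeasurable_funM; [exact: emv|].
  apply: measurable_esum => //.
    move=> l; apply/measurable_EFinP.
    have : measurable_fun setT (fun y : R * R => u (x - l - y)%R) by [].
    by congr measurable_fun; apply/funext => y; rewrite addrAC.
  by move=> l y; rewrite lee_fin.
- move=> y _; rewrite mule_ge0 ?lee_fin//.
  by apply: esum_ge0 => l _; rewrite lee_fin.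
- by move=> y _; rewrite lee_fin.
- by apply: (ae_plane_imp (ae_plane_rsub x tile_u)) => y -> _; rewrite mule1.
Qed.

Variable c : R.
Hypothesis c0 : (0 <= c)%R.
Hypothesis le_c : forall y, \esum_(l in Lambda) (v (y - l)%R)%:E <= c%:E.

Let mG : measurable_fun setT (fun y : R * R => \esum_(l in Lambda) (v (y - l)%R)%:E).
Proof.
apply: measurable_esum => //.
  by move=> l; exact/measurable_EFinP.
by move=> l y; rewrite lee_fin.
Qed.

Let G0 y : 0 <= \esum_(l in Lambda) (v (y - l)%R)%:E.
Proof. by apply: esum_ge0 => l _; rewrite lee_fin. Qed.

(** [integral_tile_mul] at the origin, with the sum of the translates of [v] bounded by [c] under
    the integral. *)
Lemma integral_packing_le :
  \int[mu2]_y (v y)%:E <= c%:E * \int[mu2]_y (u y)%:E.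
Proof.
rewrite -(integral_tile_mul 0%R).
rewrite -[X in _ <= _ * X](ge0_integral_plane_rsub 0%R); last 2 first.
  exact/measurable_EFinP.
  by move=> y; rewrite lee_fin.
rewrite -ge0_integralZl//; last 2 first.
  exact: emrs.
  by move=> y _; rewrite lee_fin.
apply: ge0_le_integral => //.
- by move=> y _; rewrite mule_ge0// lee_fin.
- by apply: emeasurable_funM => //; exact: emrs.
- by apply: emeasurable_funM => //; exact: emrs.
- by move=> y _; rewrite muleC lee_wpmul2r// lee_fin.
Qed.

Hypothesis int_u : \int[mu2]_y (u y)%:E <= 1.
Hypothesis int_v : c%:E <= \int[mu2]_y (v y)%:E.

(* The defect d(y) = c - sum_l v(y - l) is nonnegative and, by integral_tile_mul
   and the bounds on the two integrals, its convolution with u is 0; integrating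
   this convolution gives (int u) (int d) = 0. *)
Lemma packing_tile :
  {ae mu2, forall y, \esum_(l in Lambda) (v (y - l)%R)%:E = c%:E}.
Proof.
pose G y := \esum_(l in Lambda) (v (y - l)%R)%:E.
pose d y := (c - fine (G y))%R.
have finG y : G y \is a fin_num.
  by rewrite ge0_fin_numE; [rewrite (le_lt_trans (le_c y))// ltry|exact: G0].
have d0 y : (0 <= d y)%R.
  by rewrite subr_ge0 -lee_fin fineK//; exact: le_c.
have md : measurable_fun setT d.
  apply: measurable_funB => //; apply/measurable_EFinP.
  have <- : G = EFin \o (fine \o G) by apply/funext => y; rewrite /= fineK.
  exact: mG.
have Ic : \int[mu2]_y (v y)%:E <= c%:E.
  apply: (le_trans integral_packing_le).
  by rewrite -[leRHS]mule1 lee_wpmul2l// lee_fin.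
have zero x : \int[mu2]_y (u (x - y) * d y)%:E = 0.
  apply/eqP; rewrite eq_le; apply/andP; split; last first.
    by apply: integral_ge0 => y _; rewrite lee_fin mulr_ge0.
  (* Once int v, which is finite, is added to both sides, the left side becomes the integral of c
     u(x - y), because d + G = c. That integral is at most c, hence at most int v. *)
  rewrite -(@leeD2rE _ (\int[mu2]_y (v y)%:E)); last first.
    rewrite ge0_fin_numE; last by apply: integral_ge0 => y _; rewrite lee_fin.
    by rewrite (le_lt_trans Ic)// ltry.
  rewrite add0e.
  rewrite -{1}(integral_tile_mul x) -ge0_integralD//; last 4 first.
    by move=> y _; rewrite lee_fin mulr_ge0.
    by apply/measurable_EFinP; apply: measurable_funM; [exact: mrs|exact: md].
    by move=> y _; rewrite mule_ge0 ?lee_fin ?G0.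
    apply: emeasurable_funM; [exact: emrs|exact: mG].
  apply: le_trans int_v.
  rewrite -[leRHS]mule1; apply: (@le_trans _ _ (c%:E * \int[mu2]_y (u y)%:E)).
    rewrite -(ge0_integral_plane_rsub x); last 2 first.
      exact/measurable_EFinP.
      by move=> y; rewrite lee_fin.
    rewrite -ge0_integralZl//; last 2 first.
      exact: emrs.
      by move=> y _; rewrite lee_fin.
    rewrite le_eqVlt; apply/orP; left; apply/eqP; apply: eq_integral => y _.
    rewrite -/(G y) -(fineK (finG y)) -!EFinM -EFinD; congr EFin.
    by rewrite /d; ring.
  by rewrite lee_wpmul2l// lee_fin.
have : \int[mu2]_x \int[mu2]_y (u (x - y) * d y)%:E = 0.
  by rewrite integral0_eq.
have mud : measurable_fun setT (fun z : (R * R) * (R * R) => (u (z.1 - z.2) * d z.2)%:E).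
  apply/measurable_EFinP; apply: measurable_funM; last first.
    by apply: (measurableT_comp md); exact: measurable_snd.
  apply: (measurableT_comp mu_); apply/measurable_fun_pairP; split.
    by apply: measurable_funB; apply: (measurableT_comp measurable_fst);
      [exact: measurable_fst|exact: measurable_snd].
  by apply: measurable_funB; apply: (measurableT_comp measurable_snd);
      [exact: measurable_fst|exact: measurable_snd].
have mud0 z : 0 <= (u (z.1 - z.2) * d z.2)%:E by rewrite lee_fin mulr_ge0.
have -> : \int[mu2]_x \int[mu2]_y (u (x - y) * d y)%:E =
    \int[mu2]_y \int[mu2]_x (u (x - y) * d y)%:E.
  exact: (@fubini_tonelli_prod R _ _ (measurableTypeR R) (measurableTypeR R)
    (@lebesgue_measure R) (@lebesgue_measure R) _ mud mud0).
have -> : \int[mu2]_y \int[mu2]_x (u (x - y) * d y)%:E =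
    \int[mu2]_y ((\int[mu2]_x (u x)%:E) * (d y)%:E).
  apply: eq_integral => y _; rewrite -(ge0_integral_plane_sub y emu); last first.
    by move=> z; rewrite lee_fin.
  rewrite -ge0_integralZr//.
  - by apply/measurable_EFinP; apply: (measurableT_comp mu_); exact: measurable_plane_sub.
  - by move=> z _; rewrite lee_fin.
  - by rewrite lee_fin.
rewrite ge0_integralZl//; last 3 first.
- exact/measurable_EFinP.
- by move=> y _; rewrite lee_fin.
- by apply: integral_ge0 => y _; rewrite lee_fin.
(* If int u = 0, then c <= int v <= 0 and the sums equal c at every point. Otherwise the nonnegative
   [d] has integral 0 and vanishes almost everywhere. *)
move=> /eqP; rewrite mule_eq0 => /orP[/eqP u00|/eqP dint].
  exists set0; split; [exact: measurable0|exact: measure0|move=> y /=].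
  apply: contra_notP => _; apply/eqP; rewrite eq_le le_c /=.
  have := integral_packing_le; rewrite u00 mule0 => /(le_trans int_v) c00.
  exact: (le_trans c00).
have : ae_eq mu2 setT (EFin \o d) (cst 0).
  apply/ae_eq_integral_abs => //; first exact/measurable_EFinP.
  by rewrite -[RHS]dint; apply: eq_integral => y _ /=; rewrite ger0_norm.
move=> /ae_plane_imp; apply=> y /(_ I) /= [] /eqP; rewrite subr_eq0 => /eqP ->.
by rewrite fineK.
Qed.

End Tiling.

(** * The power spectrum of a set of finite measure *)

Section Fourier.
Context {R : realType}.
Local Notation mu := (@lebesgue_measure R).

Lemma measurable_cosM (a : R) : measurable_fun setT (fun x : R => cos (2 * pi * x * a)).
Proof.
apply: (measurableT_comp (f := @cos R)).
  by apply: continuous_measurable_fun => x; exact: continuous_cos.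
by apply: measurable_funM => //; apply: measurable_funM.
Qed.

Lemma measurable_sinM (a : R) : measurable_fun setT (fun x : R => sin (2 * pi * x * a)).
Proof.
apply: (measurableT_comp (f := @sin R)).
  by apply: continuous_measurable_fun => x; exact: continuous_sin.
by apply: measurable_funM => //; apply: measurable_funM.
Qed.

Lemma measurable_Rint d (T : measurableType d) (f : T * R -> R) :
  measurable_fun setT f -> measurable_fun setT (fun x : T => \int[mu]_y f (x, y)).
Proof.
move=> mf; apply: (measurableT_comp (f := fine)) => //.
have mef : measurable_fun setT (EFin \o f) by exact/measurable_EFinP.
have -> : (fun x : T => \int[mu]_y (f (x, y))%:E)%E =
  ((fun x => \int[mu]_y (EFin \o f)^\+ (x, y)) \- (fun x => \int[mu]_y (EFin \o f)^\- (x, y)))%E.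
  apply/funext => x; rewrite integralE; congr (_ - _)%E.
    by apply: eq_integral => y _; rewrite !funeposE.
  by apply: eq_integral => y _; rewrite !funenegE.
apply: emeasurable_funB.
  apply: (@measurable_fun_fubini_tonelli_F _ _ _ _ R mu (EFin \o f)^\+%E) => //.
  exact: measurable_funepos.
apply: (@measurable_fun_fubini_tonelli_F _ _ _ _ R mu (EFin \o f)^\-%E) => //.
exact: measurable_funeneg.
Qed.

Lemma integrable_indicM (S : set R) (f : R -> R) (M : R) :
  measurable S -> (mu S < +oo)%E -> measurable_fun setT f ->
  (forall x, `|f x| <= M) ->
  mu.-integrable setT (EFin \o (fun x => \1_S x * f x)).
Proof.
move=> mS Sfin mf fM.
have iS : mu.-integrable setT (fun x => (\1_S x)%:E : \bar R).
  apply/integrableP; split; first by apply/measurable_EFinP; exact: measurable_indic.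
  under eq_integral do rewrite gee0_abs ?lee_fin//.
  by rewrite integral_indic// setIT.
have := @integrableZl _ _ _ mu setT measurableT M _ iS.
apply: le_integrable => //.
  apply/measurable_EFinP; apply: measurable_funM => //; exact: measurable_indic.
move=> x _ /=; rewrite lee_fin !normrM mulrC ler_wpM2r//.
exact: (le_trans (fM x) (ler_norm M)).
Qed.

(** Together with [sinint], the real components of the conjugate Fourier transform of 1_S. Keeping
    them apart leaves the whole analysis real, with [pwr] as squared modulus. *)
Definition cosint (S : set R) (nu : R) : R :=
  \int[mu]_x (\1_S x * cos (2 * pi * x * nu)).
Definition sinint (S : set R) (nu : R) : R :=
  \int[mu]_x (\1_S x * sin (2 * pi * x * nu)).
Definition pwr (S : set R) (nu : R) : R := cosint S nu ^+ 2 + sinint S nu ^+ 2.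

Lemma pwr_ge0 S nu : 0 <= pwr S nu.
Proof. by rewrite addr_ge0 ?sqr_ge0. Qed.

Lemma measurable_cosint S : measurable S -> measurable_fun setT (cosint S).
Proof.
move=> mS; apply: (@measurable_Rint _ R (fun z => \1_S z.2 * cos (2 * pi * z.2 * z.1))).
apply: measurable_funM.
  by apply: (measurableT_comp (f := \1_S : R -> R)) => //; exact: measurable_indic.
apply: (measurableT_comp (f := @cos R)).
  by apply: continuous_measurable_fun => x; exact: continuous_cos.
by apply: measurable_funM => //; apply: measurable_funM.
Qed.

Lemma measurable_sinint S : measurable S -> measurable_fun setT (sinint S).
Proof.
move=> mS; apply: (@measurable_Rint _ R (fun z => \1_S z.2 * sin (2 * pi * z.2 * z.1))).
apply: measurable_funM.
  by apply: (measurableT_comp (f := \1_S : R -> R)) => //; exact: measurable_indic.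
apply: (measurableT_comp (f := @sin R)).
  by apply: continuous_measurable_fun => x; exact: continuous_sin.
by apply: measurable_funM => //; apply: measurable_funM.
Qed.

Section FiniteSet.
Variables (S : set R) (mS : measurable S) (Sfin : (mu S < +oo)%E).

Lemma integrable_cosint nu :
  mu.-integrable setT (EFin \o (fun x => \1_S x * cos (2 * pi * x * nu))).
Proof.
apply: (integrable_indicM (M := 1)) => //; first exact: measurable_cosM.
by move=> x; rewrite ler_norml cos_geN1 cos_le1.
Qed.

Lemma integrable_sinint nu :
  mu.-integrable setT (EFin \o (fun x => \1_S x * sin (2 * pi * x * nu))).
Proof.
apply: (integrable_indicM (M := 1)) => //; first exact: measurable_sinM.
by move=> x; rewrite ler_norml sin_geN1 sin_le1.
Qed.

Lemma Rintegral_indic : \int[mu]_x (\1_S x : R) = fine (mu S).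
Proof. by rewrite /Rintegral integral_indic// setIT. Qed.

Lemma integrable_cosB x nu :
  mu.-integrable setT (EFin \o (fun y => \1_S y * cos (2 * pi * (x - y) * nu))).
Proof.
apply: (integrable_indicM (M := 1)) => //.
  apply: (measurableT_comp (f := @cos R)).
    by apply: continuous_measurable_fun => z; exact: continuous_cos.
  by apply: measurable_funM => //; apply: measurable_funM => //; exact: measurable_funB.
by move=> y; rewrite ler_norml cos_geN1 cos_le1.
Qed.

Lemma Rintegral_cosB x nu :
  \int[mu]_y (\1_S y * cos (2 * pi * (x - y) * nu)) =
  cos (2 * pi * x * nu) * cosint S nu + sin (2 * pi * x * nu) * sinint S nu.
Proof.
rewrite -RintegralZl//; last exact: integrable_cosint.
rewrite -[X in _ + X]RintegralZl//; last exact: integrable_sinint.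
rewrite -RintegralD//; last 2 first.
  exact: (@integrableZl _ _ _ mu setT measurableT (cos (2 * pi * x * nu)) _ (integrable_cosint nu)).
  exact: (@integrableZl _ _ _ mu setT measurableT (sin (2 * pi * x * nu)) _ (integrable_sinint nu)).
apply: eq_Rintegral => y _.
rewrite (_ : 2 * pi * (x - y) * nu = 2 * pi * x * nu - 2 * pi * y * nu); last by ring.
by rewrite cosB; ring.
Qed.

(** Writes the squared modulus as a double integral over S x S whose integrand depends on x - y
    only, so that a weight in nu turns it into a convolution kernel. *)
Lemma Rintegral_cosBB nu :
  \int[mu]_x (\1_S x * \int[mu]_y (\1_S y * cos (2 * pi * (x - y) * nu))) = pwr S nu.
Proof.
under eq_Rintegral do rewrite Rintegral_cosB.
rewrite /pwr !expr2 -RintegralZl//; last exact: integrable_cosint.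
rewrite -[X in _ + X]RintegralZl//; last exact: integrable_sinint.
rewrite -RintegralD//; last 2 first.
  exact: (@integrableZl _ _ _ mu setT measurableT (cosint S nu) _ (integrable_cosint nu)).
  exact: (@integrableZl _ _ _ mu setT measurableT (sinint S nu) _ (integrable_sinint nu)).
by apply: eq_Rintegral => y _; ring.
Qed.

End FiniteSet.
End Fourier.

(** * The exponential weight and its cosine transform *)

Section Kernel.
Context {R : realType}.
Local Notation mu := (@lebesgue_measure R).
Variables (e : R) (e0 : 0 < e).

(** The Abel weight: even, at most 1, tending to 1 pointwise as e tends to 0, with the Poisson
    kernel as cosine transform. *)
Definition wexp (nu : R) : R := expR (- e * `|nu|).

Lemma wexp_gt0 nu : 0 < wexp nu. Proof. exact: expR_gt0. Qed.

Lemma wexp_le1 nu : wexp nu <= 1.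
Proof. by rewrite /wexp -expR0 ler_expR mulNr oppr_le0 mulr_ge0// ltW. Qed.

Lemma continuous_wexp : continuous wexp.
Proof.
move=> x; apply: (continuous_comp (f := fun x => - e * `|x|) (g := expR)); last exact: continuous_expR.
by apply: continuousM; [exact: cst_continuous|exact: norm_continuous].
Qed.

Lemma continuous_cosl (b : R) : continuous (fun x : R => cos (b * x)).
Proof.
move=> x; apply: (continuous_comp (f := fun x => b * x) (g := cos)); last exact: continuous_cos.
by apply: continuousM; [exact: cst_continuous|exact: id].
Qed.

(** An antiderivative of exp(- e x) (1 + cos(b x)) that vanishes at infinity. The second term is the
    real part of exp((- e + i b) x) / (- e + i b). *)
Let prim b (x : R) : R := - e^-1 * expR (- e * x) +
  (e ^+ 2 + b ^+ 2)^-1 * (expR (- e * x) * (b * sin (b * x) - e * cos (b * x))).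

Lemma is_derive_prim b (x : R) :
  is_derive x 1 (prim b) (expR (- e * x) * (1 + cos (b * x))).
Proof.
have dl (a : R) : is_derive x 1 (fun t : R => a * t) a.
  have -> : (fun t : R => a * t) = a \*: id by [].
  by apply: is_derive_eq; rewrite -[RHS]mulr1.
have dE : is_derive x 1 (fun t : R => expR (- e * t)) (expR (- e * x) * - e).
  exact: (@is_derive1_comp _ expR (fun t => - e * t)).
have dS : is_derive x 1 (fun t : R => sin (b * t)) (cos (b * x) * b).
  exact: (@is_derive1_comp _ sin (fun t => b * t)).
have dC : is_derive x 1 (fun t : R => cos (b * t)) (- sin (b * x) * b).
  exact: (@is_derive1_comp _ cos (fun t => b * t)).
pose E := (fun t : R => expR (- e * t)).
pose Sn := (fun t : R => sin (b * t)).
pose Cn := (fun t : R => cos (b * t)).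
have -> : prim b = (- e^-1) \*: E + (e ^+ 2 + b ^+ 2)^-1 \*: (E * (b \*: Sn - e \*: Cn)).
  by apply/funext.
apply: is_derive_eq.
rewrite /GRing.scale /= /E /Sn /Cn.
have nz : e ^+ 2 + b ^+ 2 != 0.
  by rewrite gt_eqF// ltr_wpDr ?sqr_ge0// exprn_gt0.
have nz2 : e != 0 by rewrite gt_eqF.
change ((b \*: (fun t : R => sin (b * t)) - e \*: (fun t : R => cos (b * t))) x)
  with (b * sin (b * x) - e * cos (b * x)).
by field; rewrite nz2 nz.
Qed.

Lemma cvg_prim b : prim b x @[x --> +oo] --> 0.
Proof.
have hE : expR (- e * x) @[x --> +oo] --> (0 : R).
  have -> : (fun x : R => expR (- e * x)) = (fun y => expR (- y)) \o (fun x => e * x).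
    by apply/funext => x /=; rewrite mulNr.
  apply: (cvg_comp _ _ _ (@cvgr_expR R)).
  by apply: gt0_cvgMry => //; exact: cvg_id.
(* [K] bounds the trigonometric factor that remains once exp(- e x) is taken out of [prim b x]. *)
pose K := e^-1 + (e ^+ 2 + b ^+ 2)^-1 * (`|b| + e).
have d0 : 0 < e ^+ 2 + b ^+ 2 by rewrite ltr_wpDr ?sqr_ge0// exprn_gt0.
apply: (@squeeze_cvgr _ _ _ _ (fun x => - K * expR (- e * x))
  (fun x => K * expR (- e * x))).
- near=> x; rewrite mulNr -ler_norml.
  have -> : prim b x = expR (- e * x) * (- e^-1 +
      (e ^+ 2 + b ^+ 2)^-1 * (b * sin (b * x) - e * cos (b * x))).
    by rewrite /prim; ring.
  rewrite normrM (ger0_norm (expR_ge0 _)) mulrC ler_wpM2r ?expR_ge0//.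
  apply: (le_trans (ler_normD _ _)); rewrite normrN gtr0_norm ?invr_gt0// lerD2l.
  rewrite normrM gtr0_norm ?invr_gt0// ler_wpM2l//; first by rewrite invr_ge0 ltW.
  apply: (le_trans (ler_normB _ _)); rewrite !normrM (gtr0_norm e0).
  apply: lerD; [rewrite -[leRHS]mulr1 ler_wpM2l//|rewrite -[leRHS]mulr1 (ler_wpM2l (ltW e0))//].
    by rewrite ler_norml sin_geN1 sin_le1.
  by rewrite ler_norml cos_geN1 cos_le1.
- by rewrite -(mulr0 (- K)); apply: cvgMl_tmp.
- by rewrite -(mulr0 K); apply: cvgMl_tmp.
Unshelve. all: by end_near. Qed.

Lemma continuous_exp_cos b : continuous (fun x : R => expR (- e * x) * (1 + cos (b * x))).
Proof.
move=> x; apply: (@continuousM _ _ (fun x : R => expR (- e * x)) (fun x => 1 + cos (b * x))).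
  apply: (continuous_comp (f := fun x => - e * x) (g := expR)); last exact: continuous_expR.
  by apply: continuousM; [exact: cst_continuous|exact: id].
by apply: continuousD; [exact: cst_continuous|exact: continuous_cosl].
Qed.

(* 1 + cos rather than cos keeps every integrand nonnegative, so that Tonelli
   replaces all integrability arguments; the constant term is subtracted at the
   very end. *)
Lemma integral_wexp_cos b :
  (\int[mu]_nu (wexp nu * (1 + cos (b * nu)))%:E =
   (2 / e + 2 * e / (e ^+ 2 + b ^+ 2))%:E)%E.
Proof.
have c0 (x : R) : 0 <= 1 + cos (b * x) by rewrite -lerBlDl sub0r cos_geN1.
(* By evenness the integral is twice that over [0, +oo), where the absolute value in [wexp]
   disappears and the value is - prim b 0 = 1 / e + e / (e^2 + b^2). *)
rewrite (@ge0_symfun_integralT R (fun nu => wexp nu * (1 + cos (b * nu)))); last 3 first.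
- by move=> x; rewrite mulr_ge0// ltW// wexp_gt0.
- move=> x; apply: continuousM; first exact: continuous_wexp.
  by apply: continuousD; [exact: cst_continuous|exact: continuous_cosl].
- by move=> x /=; rewrite /wexp normrN mulrN cosN.
rewrite -set_itvcy.
have -> : (\int[mu]_(x in `[0%R, +oo[) (wexp x * (1 + cos (b * x)))%:E =
  \int[mu]_(x in `[0%R, +oo[) (expR (- e * x) * (1 + cos (b * x)))%:E)%E.
  apply: eq_integral.
  by move=> x; rewrite inE/= in_itv/= andbT /wexp => x0; rewrite ger0_norm.
rewrite (@ge0_continuous_FTC2y R (fun x => expR (- e * x) * (1 + cos (b * x))) (prim b) 0 0).
- rewrite /prim !mulr0 expR0 sin0 cos0 -EFinB -EFinM; congr EFin.
  have nz : e ^+ 2 + b ^+ 2 != 0.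
    by rewrite gt_eqF// ltr_wpDr ?sqr_ge0// exprn_gt0.
  have nz2 : e != 0 by rewrite gt_eqF.
  by field; rewrite nz nz2.
- by move=> x _; rewrite mulr_ge0// expR_ge0.
- by apply: continuous_subspaceT; exact: continuous_exp_cos.
- exact: cvg_prim.
- by move=> x _; have [] := is_derive_prim b x.
- apply: cvg_at_right_filter; apply: differentiable_continuous.
  by apply/derivable1_diffP; have [] := is_derive_prim b 0.
- by move=> x _; rewrite derive1E; apply: derive_val; exact: is_derive_prim.
Qed.

End Kernel.

(** * The Poisson kernel: total mass and concentration *)

Section Poisson.
Context {R : realType}.
Local Notation mu := (@lebesgue_measure R).
Variables (e : R) (e0 : 0 < e).

(** The part of [integral_wexp_cos] beyond the constant 2 / e, at b = 2 pi a. *)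
Definition poisson (a : R) : R := 2 * e / (e ^+ 2 + (2 * pi * a) ^+ 2).

Lemma poisson_den_gt0 a : 0 < e ^+ 2 + (2 * pi * a) ^+ 2.
Proof. by rewrite ltr_wpDr ?sqr_ge0// exprn_gt0. Qed.

Lemma poisson_ge0 a : 0 <= poisson a.
Proof. by rewrite divr_ge0 ?(ltW (poisson_den_gt0 _))// mulr_ge0// ltW. Qed.

Lemma continuous_poisson : continuous poisson.
Proof.
move=> x; apply: (@continuousM _ _ (fun=> 2 * e) (fun a => (e ^+ 2 + (2 * pi * a) ^+ 2)^-1)).
  exact: cst_continuous.
apply: continuousV; first by rewrite gt_eqF// poisson_den_gt0.
apply: continuousD; first exact: cst_continuous.
apply: (continuous_comp (f := fun a : R => 2 * pi * a) (g := fun t => t ^+ 2)); last exact: exprn_continuous.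
by apply: continuousM; [exact: cst_continuous|exact: id].
Qed.

Lemma measurable_poisson : measurable_fun setT poisson.
Proof. by apply: continuous_measurable_fun; exact: continuous_poisson. Qed.

Definition poisson_prim (x y : R) : R := pi^-1 * atan (2 * pi / e * (y - x)).

Lemma is_derive_poisson_prim (x y : R) :
  is_derive y 1 (poisson_prim x) (poisson (x - y)).
Proof.
have dl : is_derive y 1 (fun t : R => 2 * pi / e * (t - x)) (2 * pi / e).
  have -> : (fun t : R => 2 * pi / e * (t - x)) = (2 * pi / e) \*: (id - cst x) by [].
  apply: is_derive_eq; rewrite subr0; exact: mulr1.
have dA := @is_derive1_comp _ atan _ _ _ _ (is_derive1_atan _) dl.
have -> : poisson_prim x = pi^-1 \*: (atan \o (fun t : R => 2 * pi / e * (t - x))) by [].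
apply: is_derive_eq.
rewrite /GRing.scale /= /poisson.
have nz := poisson_den_gt0 (x - y).
have pi0 : (pi : R) != 0 by rewrite gt_eqF// pi_gt0.
have nz2 : e != 0 by rewrite gt_eqF.
have nz3 : 1 + (2 * pi / e * (y - x)) ^+ 2 != 0 by rewrite gt_eqF// ltr_wpDr ?sqr_ge0.
move: (pi : R) nz nz3 pi0 => p nz nz3 p0.
by field; rewrite nz2 p0 andbT gt_eqF.
Qed.

Lemma integral_poisson (x : R) : (\int[mu]_y (poisson (x - y))%:E = 1)%E.
Proof.
have mp : measurable_fun setT (EFin \o poisson) by apply/measurable_EFinP; exact: measurable_poisson.
rewrite (ge0_integral_subl x mp); last by move=> y; rewrite lee_fin poisson_ge0.
rewrite (@ge0_symfun_integralT R poisson); last 3 first.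
- exact: poisson_ge0.
- exact: continuous_poisson.
- by move=> a /=; rewrite /poisson mulrN sqrrN.
rewrite -set_itvcy.
have pi0 : (0 : R) < pi by exact: pi_gt0.
rewrite (@ge0_continuous_FTC2y R poisson (poisson_prim 0) 0 (pi^-1 * (pi / 2))).
- rewrite /poisson_prim subr0 mulr0 atan0 mulr0 -EFinB -EFinM; congr EFin.
  move: (pi : R) pi0 => p p0; field; by rewrite gt_eqF.
- by move=> a _; exact: poisson_ge0.
- by apply: continuous_subspaceT; exact: continuous_poisson.
- apply: cvgMl_tmp; apply: (cvg_comp _ _ _ (@cvgy_atan R)).
  apply: gt0_cvgMry; first by rewrite divr_gt0// mulr_gt0.
  by under eq_fun do rewrite subr0; exact: cvg_id.
- by move=> a _; have [] := is_derive_poisson_prim 0 a.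
- apply: cvg_at_right_filter; apply: differentiable_continuous.
  by apply/derivable1_diffP; have [] := is_derive_poisson_prim 0 0.
- move=> a _; rewrite derive1E; have -> : poisson a = poisson (0 - a) by rewrite /poisson sub0r mulrN sqrrN.
  by apply: derive_val; exact: is_derive_poisson_prim.
Qed.

(** The explicit mass near the centre tends to 1 as e tends to 0; this concentration is what the
    lower Plancherel bound uses at points of an open set. *)
Lemma integral_poisson_ball (x d : R) : 0 < d ->
  (\int[mu]_(y in `[(x - d)%R, (x + d)%R]) (poisson (x - y))%:E =
   (2 / pi * atan (2 * pi / e * d))%:E)%E.
Proof.
move=> d0.
have cP : continuous (poisson_prim x).
  move=> y; apply: differentiable_continuous.
  by apply/derivable1_diffP; have [] := is_derive_poisson_prim x y.
rewrite (@continuous_FTC2 R (fun y => poisson (x - y)) (poisson_prim x)).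
- rewrite -EFinB /poisson_prim; congr EFin.
  rewrite (_ : x + d - x = d) 1?(_ : x - d - x = - d); [|by ring|by ring].
  by rewrite mulrN atanN; ring.
- lra.
- apply: continuous_subspaceT => y.
  apply: (continuous_comp (f := fun y => x - y) (g := poisson)).
    by apply: continuousB; [exact: cst_continuous|exact: id].
  exact: continuous_poisson.
- split.
  + by move=> y _; have [] := is_derive_poisson_prim x y.
  + by apply: cvg_at_right_filter; exact: cP.
  + by apply: cvg_at_left_filter; exact: cP.
- by move=> y _; rewrite derive1E; apply: derive_val; exact: is_derive_poisson_prim.
Qed.

End Poisson.

(** * Abel means of the power spectrum, and the two Plancherel bounds *)

Section Plancherel.
Context {R : realType}.
Local Notation mu := (@lebesgue_measure R).
Variables (S : set R) (mS : measurable S) (Sfin : (mu S < +oo)%E).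
Let s := fine (mu S).

Let muSE : mu S = s%:E.
Proof. by rewrite /s fineK// ge0_fin_numE. Qed.

Lemma EFin_Rintegral (f : R -> R) : mu.-integrable setT (EFin \o f) ->
  ((\int[mu]_x f x)%R%:E = \int[mu]_x (f x)%:E)%E.
Proof. by move=> h; rewrite /Rintegral fineK//; exact: integrable_fin_num. Qed.

Lemma integrableZlR (c : R) (f : R -> R) : mu.-integrable setT (EFin \o f) ->
  mu.-integrable setT (EFin \o (fun x => c * f x)).
Proof. exact: integrableZl. Qed.

Lemma EFin_addIe (r : R) (a b : \bar R) : (r%:E + a = r%:E + b)%E -> a = b.
Proof.
move=> ab; rewrite -[LHS](@addeK _ r%:E)// -[RHS](@addeK _ r%:E)//.
by rewrite (addeC a) (addeC b) ab.
Qed.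

Lemma measurable_wexp (e : R) : measurable_fun setT (wexp e).
Proof. by apply: continuous_measurable_fun; exact: continuous_wexp. Qed.

Lemma measurable_indicR (A : set R) : measurable A -> measurable_fun setT (\1_A : R -> R).
Proof. exact: measurable_indic. Qed.

Let sE : s = \int[mu]_y (\1_S y : R).
Proof. by rewrite Rintegral_indic. Qed.

Lemma integrable_indicS : mu.-integrable setT (EFin \o (\1_S : R -> R)).
Proof.
have -> : (\1_S : R -> R) = (fun x => \1_S x * 1) by apply/funext => x; rewrite mulr1.
by apply: (integrable_indicM (M := 1)) => // x; rewrite normr1.
Qed.

Let intS : (\int[mu]_x (\1_S x)%:E = s%:E)%E.
Proof. by rewrite -muSE integral_indic// setIT. Qed.

(** Splits off the contribution of the 1 in 1 + cos. All integrands are nonnegative, so additivity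
    only asks for measurability. *)
Lemma kernel_split (P : R -> R) (c : R) : measurable_fun setT P -> (forall a, 0 <= P a) -> 0 <= c ->
  (\int[mu]_x \int[mu]_y ((\1_S x * (\1_S y * c))%:E + (\1_S x * (\1_S y * P (x - y)))%:E) =
    (s ^+ 2 * c)%:E + \int[mu]_x \int[mu]_y (\1_S x * (\1_S y * P (x - y)))%:E)%E.
Proof.
move=> mP P0 c0.
have mS1 : measurable_fun setT (fun z : R * R => \1_S z.1 : R).
  by apply: (measurableT_comp (f := \1_S : R -> R)) => //; exact: measurable_indicR.
have mS2 : measurable_fun setT (fun z : R * R => \1_S z.2 : R).
  by apply: (measurableT_comp (f := \1_S : R -> R)) => //; exact: measurable_indicR.
have mPx x : measurable_fun setT (fun y : R => (\1_S x * (\1_S y * P (x - y)))%:E).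
  apply/measurable_EFinP; apply: measurable_funM => //.
  apply: measurable_funM; first exact: measurable_indicR.
  by apply: (measurableT_comp mP); exact: measurable_funB.
  transitivity (\int[mu]_x (\int[mu]_y (\1_S x * (\1_S y * c))%:E +
     \int[mu]_y (\1_S x * (\1_S y * P (x - y)))%:E))%E.
    apply: eq_integral => x _; rewrite ge0_integralD//.
    - by move=> y _; rewrite lee_fin !mulr_ge0.
    - apply/measurable_EFinP; apply: measurable_funM => //.
      by apply: measurable_funM => //; exact: measurable_indicR.
    - by move=> y _; rewrite lee_fin !mulr_ge0// poisson_ge0.
    - exact: mPx.
  rewrite ge0_integralD//.
  - congr (_ + _)%E.
    transitivity (\int[mu]_x ((c * s)%:E * (\1_S x)%:E))%E.
      apply: eq_integral => x _.
      rewrite [LHS](_ : _ = \int[mu]_y ((\1_S x * c)%:E * (\1_S y)%:E))%E; last first.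
        by apply: eq_integral => y _; rewrite -EFinM; congr EFin; ring.
      rewrite ge0_integralZl//.
      + by rewrite intS -!EFinM; congr EFin; ring.
      + by apply/measurable_EFinP; exact: measurable_indicR.
      + by rewrite lee_fin mulr_ge0.
    rewrite ge0_integralZl//.
    + by rewrite intS -!EFinM; congr EFin; ring.
    + by apply/measurable_EFinP; exact: measurable_indicR.
    + by rewrite lee_fin !mulr_ge0 ?fine_ge0//.
  - by move=> x _; apply: integral_ge0 => y _; rewrite lee_fin !mulr_ge0.
  - apply: (@measurable_fun_fubini_tonelli_F _ _ _ _ R mu
      (fun z => (\1_S z.1 * (\1_S z.2 * c))%:E)).
      apply/measurable_EFinP; apply: measurable_funM; first exact: mS1.
      by apply: measurable_funM => //; exact: mS2.
    by move=> z; rewrite lee_fin !mulr_ge0.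
  - by move=> x _; apply: integral_ge0 => y _; rewrite lee_fin !mulr_ge0// poisson_ge0.
  - apply: (@measurable_fun_fubini_tonelli_F _ _ _ _ R mu
      (fun z => (\1_S z.1 * (\1_S z.2 * P (z.1 - z.2)))%:E)).
      apply/measurable_EFinP; apply: measurable_funM; first exact: mS1.
      apply: measurable_funM; first exact: mS2.
      apply: (measurableT_comp mP).
      by apply: measurable_funB; [exact: measurable_fst|exact: measurable_snd].
    by move=> z; rewrite lee_fin !mulr_ge0// poisson_ge0.
Qed.

Section weight.
Variables (e : R) (e0 : 0 < e).

(** The case b = 0 of [integral_wexp_cos]: there 1 + cos is 2 and the value is 4 / e. *)
Lemma integral_wexp : (\int[mu]_nu (wexp e nu)%:E = (2 / e)%:E)%E.
Proof.
have h := integral_wexp_cos e0 0.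
have : (\int[mu]_nu (wexp e nu * (1 + cos (0 * nu)))%:E =
    2%:E * \int[mu]_nu (wexp e nu)%:E)%E.
  rewrite -ge0_integralZl//.
  - by apply: eq_integral => x _; rewrite mul0r cos0 -EFinM mulrC.
  - by apply/measurable_EFinP; exact: measurable_wexp.
  - by move=> x _; rewrite lee_fin ltW// wexp_gt0.
rewrite h => /esym h2.
rewrite -[LHS]mul1e (_ : 1%E = (2^-1 * 2)%:E); last by rewrite mulVf.
rewrite EFinM -muleA h2 -EFinM; congr EFin.
by field; rewrite gt_eqF.
Qed.

Let q (nu x y : R) := wexp e nu * (\1_S x * (\1_S y * (1 + cos (2 * pi * (x - y) * nu)))).

Let q0 nu x y : 0 <= q nu x y.
Proof.
rewrite mulr_ge0 ?(ltW (wexp_gt0 _ _))// mulr_ge0// mulr_ge0//.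
Qed.

Let int_q_y nu x :
  (\int[mu]_y (q nu x y)%:E = (wexp e nu * (\1_S x *
     (s + \int[mu]_y (\1_S y * cos (2 * pi * (x - y) * nu))))%R)%:E)%E.
Proof.
have i1 := integrable_indicS.
have i2 := integrable_cosB mS Sfin x nu.
have i3 : mu.-integrable setT (EFin \o (fun y => \1_S y + \1_S y * cos (2 * pi * (x - y) * nu))).
  exact: (integrableD measurableT i1 i2).
rewrite sE -RintegralD//.
rewrite -RintegralZl// -RintegralZl//; last first.
  exact: integrableZlR.
rewrite EFin_Rintegral; last first.
  by do 2! apply: integrableZlR.
by apply: eq_integral => y _; rewrite /q; congr EFin; ring.
Qed.

Let int_q_yx nu :
  (\int[mu]_x \int[mu]_y (q nu x y)%:E = (wexp e nu * (s ^+ 2 + pwr S nu))%:E)%E.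
Proof.
pose c x := \int[mu]_y (\1_S y * cos (2 * pi * (x - y) * nu)).
have i1 := integrable_indicS.
have i2 : mu.-integrable setT (EFin \o (fun x => \1_S x * c x)).
  apply: (integrable_indicM (M := `|cosint S nu| + `|sinint S nu|)) => //.
    rewrite /c; under eq_fun do rewrite Rintegral_cosB//.
    apply: measurable_funD; apply: measurable_funM => //.
      exact: measurable_cosM.
    exact: measurable_sinM.
  move=> x; rewrite /c Rintegral_cosB//.
  apply: (le_trans (ler_normD _ _)); rewrite !normrM; apply: lerD.
    by rewrite -[leRHS]mul1r ler_wpM2r// ler_norml cos_geN1 cos_le1.
  by rewrite -[leRHS]mul1r ler_wpM2r// ler_norml sin_geN1 sin_le1.
have i1s : mu.-integrable setT (EFin \o (fun x => s * \1_S x)).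
  exact: integrableZlR.
have i3 : mu.-integrable setT (EFin \o (fun x => s * \1_S x + \1_S x * c x)).
  exact: (integrableD measurableT i1s i2).
under eq_integral do rewrite int_q_y.
rewrite -(Rintegral_cosBB mS Sfin) expr2 {3}sE -RintegralZl//.
rewrite -RintegralD// -RintegralZl// EFin_Rintegral.
  by apply: eq_integral => x _; congr EFin; rewrite /c; ring.
exact: integrableZlR.
Qed.

(** The triple integral of [q] is computed in two orders: x and y first give the Abel mean of [pwr],
    nu first gives the Poisson kernel. Both results carry the finite constant s^2 (2 / e), which
    cancels. *)
Lemma integral_wexp_pwr :
  (\int[mu]_nu (wexp e nu * pwr S nu)%:E =
   \int[mu]_x \int[mu]_y (\1_S x * (\1_S y * poisson e (x - y)))%:E)%E.
Proof.
have c0 : 0 <= 2 / e by rewrite divr_ge0// ltW.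
have mpw : measurable_fun setT (pwr S).
  apply: measurable_funD; apply: measurable_funX.
    exact: measurable_cosint.
  exact: measurable_sinint.
have mS1 : measurable_fun setT (fun z : R * R => \1_S z.1 : R).
  by apply: (measurableT_comp (f := \1_S : R -> R)) => //; exact: measurable_indicR.
have mS2 : measurable_fun setT (fun z : R * R => \1_S z.2 : R).
  by apply: (measurableT_comp (f := \1_S : R -> R)) => //; exact: measurable_indicR.
have mw1 : measurable_fun setT (fun z : R * R => wexp e z.1).
  by apply: (measurableT_comp (f := wexp e)) => //; exact: measurable_wexp.
have mcos2 : measurable_fun setT (fun z : R * R => cos (2 * pi * z.2 * z.1)).
  apply: (measurableT_comp (f := @cos R)).
    by apply: continuous_measurable_fun => z; exact: continuous_cos.
  by apply: measurable_funM => //; apply: measurable_funM.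
have msin2 : measurable_fun setT (fun z : R * R => sin (2 * pi * z.2 * z.1)).
  apply: (measurableT_comp (f := @sin R)).
    by apply: continuous_measurable_fun => z; exact: continuous_sin.
  by apply: measurable_funM => //; apply: measurable_funM.
have LHSE : (\int[mu]_nu \int[mu]_x \int[mu]_y (q nu x y)%:E =
    (s ^+ 2 * (2 / e))%:E + \int[mu]_nu (wexp e nu * pwr S nu)%:E)%E.
  under eq_integral do rewrite int_q_yx.
  rewrite EFinM -integral_wexp -ge0_integralZl//; last 3 first.
  - by apply/measurable_EFinP; exact: measurable_wexp.
  - by move=> nu _; rewrite lee_fin ltW// wexp_gt0.
  - by rewrite lee_fin sqr_ge0.
  rewrite -ge0_integralD//.
  - by apply: eq_integral => nu _; rewrite -EFinM -EFinD; congr EFin; ring.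
  - by move=> nu _; rewrite -EFinM lee_fin mulr_ge0 ?sqr_ge0// ltW// wexp_gt0.
  - apply: emeasurable_funM => //; apply/measurable_EFinP; exact: measurable_wexp.
  - by move=> nu _; rewrite lee_fin mulr_ge0 ?pwr_ge0// ltW// wexp_gt0.
  - by apply/measurable_EFinP; apply: measurable_funM => //; exact: measurable_wexp.
(* Two exchanges of neighbouring integrals carry nu from the outermost to the innermost position. *)
have swap1 : (\int[mu]_nu \int[mu]_x \int[mu]_y (q nu x y)%:E =
    \int[mu]_x \int[mu]_nu \int[mu]_y (q nu x y)%:E)%E.
  apply: (@fubini_tonelli _ _ _ _ R mu mu (fun z => \int[mu]_y (q z.1 z.2 y)%:E)%E).
    under eq_fun do rewrite int_q_y.
    apply/measurable_EFinP; apply: measurable_funM; first exact: mw1.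
    apply: measurable_funM; first exact: mS2.
    apply: measurable_funD => //.
    under eq_fun do rewrite Rintegral_cosB//.
    apply: measurable_funD; apply: measurable_funM.
    + exact: mcos2.
    + by apply: (measurableT_comp (f := cosint S)) => //; exact: measurable_cosint.
    + exact: msin2.
    + by apply: (measurableT_comp (f := sinint S)) => //; exact: measurable_sinint.
  by move=> z; apply: integral_ge0 => y _; rewrite lee_fin.
have swap2 x : (\int[mu]_nu \int[mu]_y (q nu x y)%:E =
    \int[mu]_y \int[mu]_nu (q nu x y)%:E)%E.
  apply: (@fubini_tonelli _ _ _ _ R mu mu (fun z => (q z.1 x z.2)%:E)).
    apply/measurable_EFinP; apply: measurable_funM; first exact: mw1.
    have mc : measurable_fun setT (fun z : R * R => cos (2 * pi * (x - z.2) * z.1)).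
      apply: (measurableT_comp (f := @cos R)).
        by apply: continuous_measurable_fun => z; exact: continuous_cos.
      have mb := @measurable_funB _ _ R setT (fun=> x) _ (measurable_cst _) (@measurable_snd _ _ R R).
      have m2 := @measurable_funM _ _ R setT (fun=> 2 * pi) _ (measurable_cst _) mb.
      exact: (measurable_funM m2 (@measurable_fst _ _ R R)).
    have m1 := @measurable_funD _ _ R setT (fun=> 1) _ (measurable_cst _) mc.
    exact: (@measurable_funM _ _ R setT (fun=> \1_S x) _ (measurable_cst _) (measurable_funM mS2 m1)).
  by move=> z; rewrite lee_fin.
have int_q_nu x y : (\int[mu]_nu (q nu x y)%:E =
    (\1_S x * (\1_S y * (2 / e)))%:E + (\1_S x * (\1_S y * poisson e (x - y)))%:E)%E.
  rewrite -EFinD (_ : \1_S x * (\1_S y * (2 / e)) + \1_S x * (\1_S y * poisson e (x - y)) =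
    \1_S x * \1_S y * (2 / e + poisson e (x - y))); last by ring.
  rewrite EFinM.
  pose f (nu : R) := (wexp e nu * (1 + cos (2 * pi * (x - y) * nu)))%:E.
  have -> : (2 / e + poisson e (x - y))%:E = (\int[mu]_nu f nu)%E.
    by rewrite integral_wexp_cos.
  have mf : measurable_fun setT f.
    apply/measurable_EFinP; apply: measurable_funM; first exact: measurable_wexp.
    apply: measurable_funD; first exact: measurable_cst.
    by apply: continuous_measurable_fun; exact: continuous_cosl.
  have f0 nu : setT nu -> (0 <= f nu)%E.
    by move=> _; rewrite lee_fin mulr_ge0 ?(ltW (wexp_gt0 _ _)).
  have k0 : (0 <= (\1_S x * \1_S y : R)%:E)%E by rewrite lee_fin mulr_ge0.
  rewrite -(@ge0_integralZl _ _ R mu setT measurableT f mf _ f0 k0).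
  by apply: eq_integral => nu _; rewrite -EFinM /q; congr EFin; ring.
have measurable_poisson_e := measurable_poisson e0.
have RHSE : (\int[mu]_x \int[mu]_nu \int[mu]_y (q nu x y)%:E =
    (s ^+ 2 * (2 / e))%:E + \int[mu]_x \int[mu]_y (\1_S x * (\1_S y * poisson e (x - y)))%:E)%E.
  rewrite -(kernel_split measurable_poisson_e (poisson_ge0 e0) c0).
  apply: eq_integral => x _; rewrite swap2.
  by apply: eq_integral => y _; rewrite int_q_nu.
exact: (EFin_addIe (etrans (esym LHSE) (etrans swap1 RHSE))).
Qed.

End weight.
End Plancherel.

Section FatouBound.
Context d (T : measurableType d) (R : realType) (m : {measure set T -> \bar R}).
Local Open Scope ereal_scope.

(** Fatou's lemma, where the lower limit is an actual limit at each point. *)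
Lemma integral_lim_le (D : set T) (f_ : nat -> T -> \bar R) (f : T -> \bar R) (c : \bar R) :
  measurable D -> (forall n, measurable_fun D (f_ n)) ->
  (forall n x, D x -> 0 <= f_ n x) ->
  (forall x, D x -> f_ ^~ x @ \oo --> f x) ->
  (forall n, \int[m]_(x in D) f_ n x <= c) -> \int[m]_(x in D) f x <= c.
Proof.
move=> mD mf f0 ff fc.
have -> : \int[m]_(x in D) f x = \int[m]_(x in D) limn_einf (f_ ^~ x).
  by apply: eq_integral => x; rewrite inE => Dx; rewrite (cvg_limn_einf_sup (ff x Dx)).
apply: (le_trans (fatou m mD mf f0)).
rewrite limn_einf_lim; apply: lime_le; first exact: is_cvg_einfs.
apply: nearW => n; apply: (le_trans _ (fc n)).
by apply: ereal_inf_lbound; exists n => //=.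
Qed.

End FatouBound.

Section Plancherel2.
Context {R : realType}.
Local Notation mu := (@lebesgue_measure R).
Variables (S : set R) (mS : measurable S) (Sfin : (mu S < +oo)%E).

Lemma measurable_pwr : measurable_fun setT (pwr S).
Proof.
by apply: measurable_funD; apply: measurable_funX;
  [exact: measurable_cosint|exact: measurable_sinint].
Qed.

Let e (n : nat) : R := harmonic n.
Let e0 n : 0 < e n. Proof. exact: harmonic_gt0. Qed.

(** The Poisson mean of 1_S, cut down to S. It stays below 1_S because the kernel has mass 1, it
    tends to 1 at interior points of S, and [integral_wexp_pwr] gives its integral. *)
Let w n x := (\int[mu]_y (\1_S x * (\1_S y * poisson (e n) (x - y)))%:E)%E.

Let k_ge0 n x y : 0 <= \1_S x * (\1_S y * poisson (e n) (x - y)).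
Proof. by apply: mulr_ge0 => //; apply: mulr_ge0 => //; exact: poisson_ge0. Qed.

Let w_ge0 n x : (0 <= w n x)%E.
Proof.
by apply: integral_ge0 => y _; rewrite lee_fin; exact: k_ge0.
Qed.

Let mPB n x : measurable_fun setT (fun y : R => poisson (e n) (x - y)).
Proof.
apply: (measurableT_comp (f := poisson (e n))); first exact: measurable_poisson.
exact: measurable_subl.
Qed.

Let mwx n x : measurable_fun setT (fun y : R => (\1_S x * (\1_S y * poisson (e n) (x - y)))%:E).
Proof.
apply/measurable_EFinP; apply: measurable_funM; first exact: measurable_cst.
by apply: measurable_funM; [exact: measurable_indicR|exact: mPB].
Qed.

Let mw n : measurable_fun setT (w n).
Proof.
apply: (@measurable_fun_fubini_tonelli_F _ _ _ _ R mu
    (fun z => (\1_S z.1 * (\1_S z.2 * poisson (e n) (z.1 - z.2)))%:E)).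
  apply/measurable_EFinP; apply: measurable_funM.
    by apply: (measurableT_comp (f := \1_S : R -> R)) => //; exact: measurable_indicR.
  apply: measurable_funM.
    by apply: (measurableT_comp (f := \1_S : R -> R)) => //; exact: measurable_indicR.
  apply: (measurableT_comp (f := poisson (e n))); first exact: measurable_poisson.
  by apply: measurable_funB; [exact: measurable_fst|exact: measurable_snd].
by move=> z; rewrite lee_fin; exact: k_ge0.
Qed.

Let w_le n x : (w n x <= (\1_S x)%:E)%E.
Proof.
rewrite -[leRHS]mule1 -(integral_poisson (e0 n) x) -ge0_integralZl//.
- apply: ge0_le_integral => //.
  + by move=> y _; rewrite lee_fin; exact: k_ge0.
  + exact: mwx.
  + by apply/measurable_EFinP; apply: measurable_funM; [exact: measurable_cst|exact: mPB].
  + move=> y _; rewrite -EFinM lee_fin ler_wpM2l//.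
    by rewrite -[leRHS]mul1r ler_wpM2r ?poisson_ge0// indicE lern1 leq_b1.
- by apply/measurable_EFinP; exact: mPB.
- by move=> y _; rewrite lee_fin poisson_ge0.
Qed.

Let e_cvg : e n @[n --> \oo] --> (0 : R).
Proof. exact: cvg_harmonic. Qed.

(** The Abel means are integrals of [w n], which lies below 1_S; the weights tend to 1 pointwise and
    Fatou's lemma passes to the limit. *)
Lemma plancherel_le : (\int[mu]_nu (pwr S nu)%:E <= mu S)%E.
Proof.
apply: (@integral_lim_le _ _ R mu setT
  (fun n (nu : R) => (wexp (e n) nu * pwr S nu)%:E)) => //.
- move=> n; apply/measurable_EFinP; apply: measurable_funM; last exact: measurable_pwr.
  exact: measurable_wexp.
- by move=> n x _; rewrite lee_fin mulr_ge0 ?pwr_ge0// ltW// wexp_gt0.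
- move=> nu _; apply: cvg_EFin; first by apply: nearW.
  rewrite -[X in _ --> X]mul1r; apply: cvgMr_tmp.
  rewrite /wexp -expR0 -(mul0r `|nu|) -{1}oppr0.
  have h : - e n * `|nu| @[n --> \oo] --> - 0 * `|nu| by apply: cvgMr_tmp; exact: cvgN.
  exact: (cvg_comp _ _ h (@continuous_expR R _)).
- move=> n; rewrite (integral_wexp_pwr mS Sfin (e0 n)).
  have -> : mu S = (\int[mu]_x (\1_S x)%:E)%E by rewrite integral_indic// setIT.
  apply: ge0_le_integral => //.
  + by move=> x _; exact: w_ge0.
  + exact: mw.
  + by apply/measurable_EFinP; exact: measurable_indicR.
  + by move=> x _; exact: w_le.
Qed.

(** Fatou's lemma on U, where [w n] tends to 1. The integral of [w n] over U is at most its full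
    integral, an Abel mean, and this is at most the integral of [pwr S] because the weight is at
    most 1. *)
Lemma plancherel_ge (U : set R) : open U -> U `<=` S ->
  (mu U <= \int[mu]_nu (pwr S nu)%:E)%E.
Proof.
move=> oU US; have mU : measurable U by exact: open_measurable.
rewrite -[leLHS]mul1e -integral_cst//.
apply: (@integral_lim_le _ _ R mu U w) => //.
- by move=> n; apply: measurable_funTS; exact: mw.
- move=> x Ux.
  have [d /= d0 dU] : nbhs x U by rewrite nbhsE/=; exists U.
  (* The radius is halved so that the closed interval lies in the open ball of radius d, hence in
     U. *)
  have P1 n : ((2 / pi * atan (2 * pi / e n * (d / 2)))%:E <= w n x)%E.
    have S1 y : U y -> \1_S y = 1 :> R by move=> Uy; rewrite indicE mem_set//; exact: US.
    have d2 : 0 < d / 2 by rewrite divr_gt0.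
    rewrite -(integral_poisson_ball (e0 n) x d2).
    rewrite (_ : \int[mu]_(y in _) _ = \int[mu]_(y in `[(x - d / 2)%R, (x + d / 2)%R])
        (\1_S x * (\1_S y * poisson (e n) (x - y)))%:E)%E.
      apply: ge0_subset_integral => //; first exact: mwx.
      by move=> y _; rewrite lee_fin; exact: k_ge0.
    apply: eq_integral => y; rewrite inE/= in_itv/= => /andP[y1 y2].
    rewrite !S1 ?mul1r//; apply: dU; rewrite /ball/= ltr_norml; apply/andP; split; lra.
  have S1 : \1_S x = 1 :> R by rewrite indicE mem_set//; exact: US.
  apply: (@squeeze_cvge _ _ _ _ (fun n => (2 / pi * atan (2 * pi / e n * (d / 2)))%:E) _ (fun=> 1%E)).
  + by apply: nearW => n; rewrite P1 (le_trans (w_le n x))// S1.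
  + apply: cvg_EFin; first by apply: nearW.
    have pi0 : (0 : R) < pi by exact: pi_gt0.
    have atan1 : atan (2 * pi / e n * (d / 2)) @[n --> \oo] --> (pi / 2 : R).
      apply: (cvg_comp _ _ _ (@cvgy_atan R)).
      have -> : (fun n => 2 * pi / e n * (d / 2)) = (fun n => (2 * pi * (d / 2)) * n.+1%:R).
        by apply/funext => n; rewrite /e /harmonic /= invrK; ring.
      have M0 : 0 < 2 * pi * (d / 2) by rewrite mulr_gt0// mulr_gt0.
      have hn : (n.+1%:R : R) @[n --> \oo] --> +oo.
        by rewrite (cvg_shiftS (fun n => n%:R : R)); exact: cvgr_idn.
      exact: (cvg_comp _ _ hn (gt0_cvgMry M0 (@cvg_id _ _))).
    have := @cvgMl_tmp _ _ _ _ _ (2 / pi) _ atan1.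
    have -> : 2 / pi * (pi / 2) = 1 :> R; last by apply.
    by move: (pi : R) pi0 => p p0; field; rewrite gt_eqF.
  + exact: cvg_cst.
- move=> n.
  apply: (@le_trans _ _ (\int[mu]_x w n x)%E).
    by apply: ge0_subset_integral => //; exact: mw.
  rewrite /w -(integral_wexp_pwr mS Sfin (e0 n)).
  apply: ge0_le_integral => //.
  + by move=> nu _; rewrite lee_fin mulr_ge0 ?pwr_ge0// ltW// wexp_gt0.
  + apply/measurable_EFinP; apply: measurable_funM; last exact: measurable_pwr.
    exact: measurable_wexp.
  + by apply/measurable_EFinP; exact: measurable_pwr.
  + by move=> nu _; rewrite lee_fin -[leRHS]mul1r ler_wpM2r ?pwr_ge0// wexp_le1.
Qed.

End Plancherel2.

(** * Orthonormal families in L^2 *)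

Section ComplexParts.
Local Open Scope complex_scope.
Context {R : realType}.
Implicit Types z w : R[i].

(** Squared modulus with values in R: the norm of [R[i]] is itself complex, and its square root
    would hide the polynomial identities below. *)
Definition sqn z : R := complex.Re z ^+ 2 + complex.Im z ^+ 2.

Lemma sqn_ge0 z : 0 <= sqn z. Proof. by rewrite addr_ge0// sqr_ge0. Qed.

Lemma cReD z w : complex.Re (z + w) = complex.Re z + complex.Re w.
Proof. by case: z; case: w. Qed.
Lemma cImD z w : complex.Im (z + w) = complex.Im z + complex.Im w.
Proof. by case: z; case: w. Qed.
Lemma cReN z : complex.Re (- z) = - complex.Re z.
Proof. by case: z. Qed.
Lemma cImN z : complex.Im (- z) = - complex.Im z.
Proof. by case: z. Qed.
Lemma cReM z w : complex.Re (z * w) =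
  complex.Re z * complex.Re w - complex.Im z * complex.Im w.
Proof. by case: z; case: w. Qed.
Lemma cImM z w : complex.Im (z * w) =
  complex.Re z * complex.Im w + complex.Im z * complex.Re w.
Proof. by case: z; case: w. Qed.
Lemma cReJ z : complex.Re (z^*) = complex.Re z.
Proof. by case: z. Qed.
Lemma cImJ z : complex.Im (z^*) = - complex.Im z.
Proof. by case: z. Qed.

Lemma complex_ext z w : complex.Re z = complex.Re w -> complex.Im z = complex.Im w -> z = w.
Proof. by case: z w => a b [c d] /= -> ->. Qed.

Lemma sqn0 : sqn 0 = 0.
Proof. by rewrite /sqn /= expr0n addr0. Qed.

Lemma sqn_eq0 z : sqn z = 0 -> z = 0.
Proof.
rewrite /sqn => /eqP; rewrite paddr_eq0 ?sqr_ge0// !sqrf_eq0 => /andP[/eqP zr /eqP zi].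
exact: complex_ext.
Qed.

Lemma sqnM z w : sqn (z * w) = sqn z * sqn w.
Proof. by rewrite /sqn cReM cImM; ring. Qed.

Lemma mulcJ_sqn z : z * z^* = (sqn z)%:C.
Proof. by apply: complex_ext; rewrite ?cReM ?cImM cReJ cImJ /sqn /=; ring. Qed.

Lemma sqnD_le z w : sqn (z + w) <= 2 * sqn z + 2 * sqn w.
Proof.
rewrite -subr_ge0 (_ : _ - _ = sqn (z - w)) ?sqn_ge0//.
by rewrite /sqn !cReD !cImD cReN cImN; ring.
Qed.

Lemma normc_sqn z : complex.Re `|z| = Num.sqrt (sqn z).
Proof. by rewrite normc_def. Qed.

End ComplexParts.

Section L2space.
Local Open Scope complex_scope.
Context {R : realType}.
Local Notation mu := (@lebesgue_measure R).
Implicit Types f g h : R -> R[i].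

Definition N2 f : \bar R := (\int[mu]_x (sqn (f x))%:E)%E.

Definition cmeas f := measurable_fun setT (fun x => complex.Re (f x)) /\
  measurable_fun setT (fun x => complex.Im (f x)).

Lemma N2_ge0 f : (0 <= N2 f)%E.
Proof. by apply: integral_ge0 => x _; rewrite lee_fin sqn_ge0. Qed.

Lemma N2E f : N2 f = (L2norm f `^ 2)%E.
Proof.
rewrite /L2norm poweR_Lnorm//; apply: eq_integral => x _.
rewrite normc_sqn /= ger0_norm ?sqrtr_ge0// powR_mulrn ?sqrtr_ge0//.
by rewrite sqr_sqrtr// sqn_ge0.
Qed.

Lemma L2norm_lt f (eps : R) : 0 < eps ->
  (L2norm f < eps%:E)%E = (N2 f < (eps ^+ 2)%:E)%E.
Proof.
move=> e0; rewrite N2E.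
have := Lnorm_ge0 mu 2%:E (fun x => (complex.Re `|f x|)%:E); rewrite -/(L2norm f).
case: (L2norm f) => [r|_|//]; last by rewrite poweRyr.
by rewrite lee_fin => r0; rewrite poweR_EFin !lte_fin powR_mulrn// ltr_sqr// nnegrE ltW.
Qed.

Lemma L2norm_lty f : (L2norm f < +oo)%E = (N2 f < +oo)%E.
Proof.
rewrite N2E.
have := Lnorm_ge0 mu 2%:E (fun x => (complex.Re `|f x|)%:E); rewrite -/(L2norm f).
case: (L2norm f) => [r|_|//]; last by rewrite poweRyr.
by rewrite lee_fin => r0; rewrite poweR_EFin !ltry.
Qed.

Lemma L2P f : L2 f <-> cmeas f /\ (N2 f < +oo)%E.
Proof.
split => [[mr mi]|[[mr mi] fin]]; rewrite ?L2norm_lty; first by move=> fin; split.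
by split => //; rewrite L2norm_lty.
Qed.

Lemma cmeas_sqn f : cmeas f -> measurable_fun setT (fun x => (sqn (f x))%:E).
Proof.
move=> [mr mi]; apply/measurable_EFinP; apply: measurable_funD.
  exact: (measurable_funX 2 mr).
exact: (measurable_funX 2 mi).
Qed.

Lemma cmeasD f g : cmeas f -> cmeas g -> cmeas (fun x => f x + g x).
Proof.
move=> [fr fi] [gr gi]; split.
  by under eq_fun do rewrite cReD; exact: measurable_funD.
by under eq_fun do rewrite cImD; exact: measurable_funD.
Qed.

Lemma cmeasN f : cmeas f -> cmeas (fun x => - f x).
Proof.
move=> [fr fi]; split.
  by under eq_fun do rewrite cReN; exact: measurable_funN.
by under eq_fun do rewrite cImN; exact: measurable_funN.
Qed.

Lemma cmeasM f g : cmeas f -> cmeas g -> cmeas (fun x => f x * g x).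
Proof.
move=> [fr fi] [gr gi]; split.
  by under eq_fun do rewrite cReM; apply: measurable_funB; exact: measurable_funM.
by under eq_fun do rewrite cImM; apply: measurable_funD; exact: measurable_funM.
Qed.

Lemma cmeas_cst c : cmeas (fun=> c).
Proof. by split; exact: measurable_cst. Qed.

Lemma cmeas_sum (I : Type) (r : seq I) (F : I -> R -> R[i]) :
  (forall i, cmeas (F i)) -> cmeas (fun x => \sum_(i <- r) F i x).
Proof.
move=> mF; elim: r => [|i r ih].
  by have -> : (fun x => \sum_(i <- [::]) F i x) = (fun=> 0);
    [apply/funext => x; rewrite big_nil|exact: cmeas_cst].
have -> : (fun x => \sum_(j <- i :: r) F j x) = (fun x => F i x + \sum_(j <- r) F j x).
  by apply/funext => x; rewrite big_cons.
exact: cmeasD.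
Qed.

(** Pointwise, the parallelogram law. This inequality takes the place of Minkowski's, so that norms
    stay squared; the density arguments pay only with constants. *)
Lemma N2D_le f g : cmeas f -> cmeas g ->
  (N2 (fun x => f x + g x)%R <= 2%:E * N2 f + 2%:E * N2 g)%E.
Proof.
move=> mf mg; rewrite /N2.
have sf0 x : setT x -> (0 <= (sqn (f x))%:E)%E by rewrite lee_fin sqn_ge0.
have sg0 x : setT x -> (0 <= (sqn (g x))%:E)%E by rewrite lee_fin sqn_ge0.
have msf := cmeas_sqn mf.
have msg := cmeas_sqn mg.
rewrite -(@ge0_integralZl _ _ R mu setT measurableT _ msf 2%:E sf0)//.
rewrite -(@ge0_integralZl _ _ R mu setT measurableT _ msg 2%:E sg0)// -ge0_integralD//.
- apply: ge0_le_integral => //.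
  + by move=> x _; rewrite lee_fin sqn_ge0.
  + exact: (cmeas_sqn (cmeasD mf mg)).
  + apply: emeasurable_funD; exact: measurable_funeM.
  + by move=> x _; rewrite -!EFinM -EFinD lee_fin sqnD_le.
- by move=> x _; rewrite -EFinM lee_fin mulr_ge0 ?sqn_ge0.
- exact: measurable_funeM.
- by move=> x _; rewrite -EFinM lee_fin mulr_ge0 ?sqn_ge0.
- exact: measurable_funeM.
Qed.

Lemma N2Z c f : cmeas f -> N2 (fun x => c * f x) = ((sqn c)%:E * N2 f)%E.
Proof.
move=> mf; rewrite /N2.
have sf0 x : setT x -> (0 <= (sqn (f x))%:E)%E by rewrite lee_fin sqn_ge0.
rewrite -(@ge0_integralZl _ _ R mu setT measurableT _ (cmeas_sqn mf) _ sf0).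
  by apply: eq_integral => x _; rewrite sqnM EFinM.
by rewrite lee_fin sqn_ge0.
Qed.

End L2space.

Section InnerProduct.
Local Open Scope complex_scope.
Context {R : realType}.
Local Notation mu := (@lebesgue_measure R).
Implicit Types f g h e : R -> R[i].

Definition fin2 f := cmeas f /\ (N2 f < +oo)%E.

Lemma fin2D f g : fin2 f -> fin2 g -> fin2 (fun x => f x + g x).
Proof.
move=> [mf nf] [mg ng]; split; first exact: cmeasD.
by apply: (le_lt_trans (N2D_le mf mg)); rewrite lte_add_pinfty// lte_mul_pinfty.
Qed.

Lemma fin2Z c f : fin2 f -> fin2 (fun x => c * f x).
Proof.
move=> [mf nf]; split; first by apply: cmeasM => //; exact: cmeas_cst.
by rewrite N2Z// lte_mul_pinfty// lee_fin sqn_ge0.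
Qed.

Lemma fin2_0 : fin2 (fun=> 0).
Proof.
split; first exact: cmeas_cst.
by rewrite /N2; under eq_integral do rewrite sqn0; rewrite integral0 ltry.
Qed.

Lemma fin2_sum (I : Type) (r : seq I) (F : I -> R -> R[i]) :
  (forall i, fin2 (F i)) -> fin2 (fun x => \sum_(i <- r) F i x).
Proof.
move=> mF; elim: r => [|i r ih].
  by have -> : (fun x => \sum_(i <- [::]) F i x) = (fun=> 0);
    [apply/funext => x; rewrite big_nil|exact: fin2_0].
have -> : (fun x => \sum_(j <- i :: r) F j x) = (fun x => F i x + \sum_(j <- r) F j x).
  by apply/funext => x; rewrite big_cons.
exact: fin2D.
Qed.

Lemma integrable_sqn f : fin2 f -> mu.-integrable setT (fun x => (sqn (f x))%:E).
Proof.
move=> [mf nf]; apply/integrableP; split; first exact: cmeas_sqn.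
by under eq_integral do rewrite gee0_abs ?lee_fin ?sqn_ge0//.
Qed.

Lemma cmeasJ f : cmeas f -> cmeas (fun x => (f x)^*).
Proof.
move=> [mr mi]; split; first by under eq_fun do rewrite cReJ.
by under eq_fun do rewrite cImJ; exact: measurable_funN.
Qed.

Lemma integrable_prod f g (p : R -> R) : fin2 f -> fin2 g -> measurable_fun setT p ->
  (forall x, `|p x| <= sqn (f x) + sqn (g x)) -> mu.-integrable setT (EFin \o p).
Proof.
move=> ff fg mp pfg.
have := @integrableD _ _ _ mu setT measurableT _ _ (integrable_sqn ff) (integrable_sqn fg).
apply: le_integrable => //; first exact/measurable_EFinP.
move=> x _ /=; rewrite lee_fin; apply: (le_trans (pfg x)).
exact: ler_norm.
Qed.

Lemma ReMJ_le (z w : R[i]) : `|complex.Re (z * w^*)| <= sqn z + sqn w.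
Proof.
case: z w => a b [c d]; rewrite cReM cReJ cImJ /sqn /= ler_norml; apply/andP; split.
  rewrite -subr_ge0 (_ : _ - _ = ((a + c) ^+ 2 + (b + d) ^+ 2 + a ^+ 2 + b ^+ 2 + c ^+ 2 + d ^+ 2) / 2); last by field.
  by rewrite divr_ge0// !addr_ge0// sqr_ge0.
rewrite -subr_ge0 (_ : _ - _ = ((a - c) ^+ 2 + (b - d) ^+ 2 + a ^+ 2 + b ^+ 2 + c ^+ 2 + d ^+ 2) / 2); last by field.
by rewrite divr_ge0// !addr_ge0// sqr_ge0.
Qed.

Lemma ImMJ_le (z w : R[i]) : `|complex.Im (z * w^*)| <= sqn z + sqn w.
Proof.
case: z w => a b [c d]; rewrite cImM cReJ cImJ /sqn /= ler_norml; apply/andP; split.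
  rewrite -subr_ge0 (_ : _ - _ = ((a - d) ^+ 2 + (b + c) ^+ 2 + a ^+ 2 + b ^+ 2 + c ^+ 2 + d ^+ 2) / 2); last by field.
  by rewrite divr_ge0// !addr_ge0// sqr_ge0.
rewrite -subr_ge0 (_ : _ - _ = ((a + d) ^+ 2 + (b - c) ^+ 2 + a ^+ 2 + b ^+ 2 + c ^+ 2 + d ^+ 2) / 2); last by field.
by rewrite divr_ge0// !addr_ge0// sqr_ge0.
Qed.

Lemma integrable_ReMJ f g : fin2 f -> fin2 g ->
  mu.-integrable setT (EFin \o (fun x => complex.Re (f x * (g x)^*))).
Proof.
move=> ff fg; apply: (integrable_prod ff fg); last by move=> x; exact: ReMJ_le.
by have [] := cmeasM ff.1 (cmeasJ fg.1).
Qed.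

Lemma integrable_ImMJ f g : fin2 f -> fin2 g ->
  mu.-integrable setT (EFin \o (fun x => complex.Im (f x * (g x)^*))).
Proof.
move=> ff fg; apply: (integrable_prod ff fg); last by move=> x; exact: ImMJ_le.
by have [] := cmeasM ff.1 (cmeasJ fg.1).
Qed.

Lemma L2dotDZ f e h c : fin2 f -> fin2 e -> fin2 h ->
  L2dot (fun x => f x + c * e x) h = L2dot f h + c * L2dot e h.
Proof.
move=> ff fe fh.
have i1 := integrable_ReMJ ff fh.
have i2 := integrable_ImMJ ff fh.
have i3 := integrable_ReMJ fe fh.
have i4 := integrable_ImMJ fe fh.
apply: complex_ext; rewrite ?cReD ?cImD ?cReM ?cImM /L2dot /cintegral /=.
  rewrite -RintegralZl// -[X in _ - X]RintegralZl// -RintegralB//; try exact: integrableZlR.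
  rewrite -RintegralD//; last first.
    have i5 := integrableZlR (complex.Re c) i3.
    have i6 := integrableZlR (complex.Im c) i4.
    exact: (integrableB _ i5 i6).
  apply: eq_Rintegral => x _.
  by rewrite mulrDl cReD; congr (_ + _); rewrite -mulrA cReM.
rewrite -RintegralZl// -[X in _ + (_ + X)]RintegralZl// -RintegralD//; try exact: integrableZlR.
rewrite -RintegralD//; last first.
  have i5 := integrableZlR (complex.Re c) i4.
  have i6 := integrableZlR (complex.Im c) i3.
  exact: (integrableD _ i5 i6).
apply: eq_Rintegral => x _.
by rewrite mulrDl cImD; congr (_ + _); rewrite -mulrA cImM.
Qed.

Lemma L2dotJ f h : fin2 f -> fin2 h -> L2dot h f = (L2dot f h)^*.
Proof.
move=> ff fh; apply: complex_ext; rewrite ?cReJ ?cImJ /L2dot /cintegral /=.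
  by apply: eq_Rintegral => x _; rewrite !cReM !cReJ !cImJ; ring.
rewrite -mulN1r -RintegralZl//; last exact: integrable_ImMJ.
by apply: eq_Rintegral => x _; rewrite !cImM !cReJ !cImJ; ring.
Qed.

Lemma L2dot_self f : L2dot f f = (fine (N2 f))%:C.
Proof.
apply: complex_ext; rewrite /L2dot /cintegral /=.
  by congr fine; apply: eq_integral => x _; rewrite mulcJ_sqn.
rewrite -[RHS](@Rintegral_set0 _ _ R mu (fun=> 0)) /Rintegral integral_set0.
by congr fine; apply: integral0_eq => x _; rewrite mulcJ_sqn.
Qed.

End InnerProduct.

Section Orthonormal.
Local Open Scope complex_scope.
Context {R : realType} (T : eqType) (I : set T) (e : T -> R -> R[i]).
Hypothesis fe : forall i, fin2 (e i).
Hypothesis on : forall i j, I i -> I j -> L2dot (e i) (e j) = (i == j)%:R.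

(** Coefficients are a function of the index, so that over a duplicate-free list [c i] can be
    compared with [L2dot f (e i)]. The lists of [lcomb] may repeat an index, as the definition of a
    basis allows. *)
Definition comb (s : seq T) (c : T -> R[i]) : R -> R[i] :=
  fun x => \sum_(i <- s) c i * e i x.

Lemma fin2_comb s c : fin2 (comb s c).
Proof. by apply: fin2_sum => i; exact: fin2Z. Qed.

Lemma fin2_sub_comb f s c : fin2 f -> fin2 (fun x => f x - comb s c x).
Proof.
move=> ff; have := fin2D ff (fin2Z (-1) (fin2_comb s c)).
by under eq_fun do rewrite mulN1r.
Qed.

Lemma sub_comb_cons f i s c :
  (fun x => f x - comb (i :: s) c x) = (fun x => (f x - comb s c x) + (- c i) * e i x).
Proof. by apply/funext => x; rewrite /comb big_cons; ring. Qed.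

Lemma dot_sub_comb f s c i : fin2 f -> (forall j, j \in s -> I j) -> I i -> i \notin s ->
  L2dot (fun x => f x - comb s c x) (e i) = L2dot f (e i).
Proof.
move=> ff; elim: s => [|j s ih] sI Ii.
  by move=> _; congr L2dot; apply/funext => x; rewrite /comb big_nil subr0.
rewrite inE negb_or => /andP[ij is_]; rewrite sub_comb_cons L2dotDZ//; last exact: fin2_sub_comb.
rewrite ih//; last by move=> k ks; apply: sI; rewrite inE ks orbT.
by rewrite on//; [rewrite eq_sym (negbTE ij) mulr0 addr0|apply: sI; rewrite inE eqxx].
Qed.

(** Pythagoras with completed squares, one vector at a time: by [dot_sub_comb] the residue has the
    same inner product with the next [e i] as [f] itself. Bessel, Parseval and its converse are all
    read off from this identity. *)
Lemma N2_sub_comb f s c : fin2 f -> uniq s -> (forall j, j \in s -> I j) ->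
  fine (N2 (fun x => f x - comb s c x)) =
  fine (N2 f) - \sum_(i <- s) sqn (L2dot f (e i)) + \sum_(i <- s) sqn (c i - L2dot f (e i)).
Proof.
move=> ff; elim: s => [|i s ih] us sI.
  rewrite !big_nil subr0 addr0; congr (fine (N2 _)).
  by apply/funext => x; rewrite /comb big_nil subr0.
move: us => /= /andP[is_ us].
have Ii : I i by apply: sI; rewrite inE eqxx.
have sI' j : j \in s -> I j by move=> js; apply: sI; rewrite inE js orbT.
have fr := fin2_sub_comb s c ff.
set r := (fun x => f x - comb s c x) in ih fr *.
have ih' := ih us sI'.
have fri := fin2D fr (fin2Z (- c i) (fe i)).
have re := dot_sub_comb c ff sI' Ii is_; rewrite -/r in re.
have ei1 : L2dot (e i) (e i) = 1 by rewrite on// eqxx.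
have h1 : L2dot r (fun x => r x + - c i * e i x) =
    (fine (N2 r))%:C + (- c i * L2dot (e i) r)^*.
  rewrite (L2dotJ fri fr) L2dotDZ// L2dot_self rmorphD; congr (_ + _).
  exact: conjc_real.
have h2 : L2dot (e i) (fun x => r x + - c i * e i x) =
    (L2dot r (e i) + - c i)^*.
  by rewrite (L2dotJ fri (fe i)) L2dotDZ// ei1 mulr1.
have h : (fine (N2 (fun x => r x + - c i * e i x)))%:C =
    (fine (N2 r))%:C + (- c i * (L2dot r (e i))^*)^* + - c i * (L2dot r (e i) + - c i)^*.
  by rewrite -L2dot_self [in LHS]L2dotDZ// h1 h2 (L2dotJ fr (fe i)).
have := congr1 (@complex.Re R) h.
rewrite re /= => E; rewrite sub_comb_cons -/r E ih' !big_cons.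
case: (L2dot f (e i)) => a b; case: (c i) => u v.
by rewrite /sqn /=; ring.
Qed.

End Orthonormal.

Section Span.
Local Open Scope complex_scope.
Context {R : realType} (T : choiceType) (I : set T) (e : T -> R -> R[i]).
Hypothesis fe : forall i, fin2 (e i).

(** Membership in the closed span: the density clause of [orthonormal_basis] for a single function,
    with the squared norm. *)
Definition inspan (f : R -> R[i]) := forall eps : R, 0 < eps ->
  exists (n : nat) (s : 'I_n -> T) (c : 'I_n -> R[i]),
    (forall k, I (s k)) /\
    (N2 (fun x => f x - \sum_(k < n) c k * e (s k) x)%R < eps%:E)%E.

Definition lcomb (l : seq (T * R[i])) : R -> R[i] :=
  fun x => \sum_(p <- l) p.2 * e p.1 x.

Lemma inspanP f : inspan f <-> forall eps : R, 0 < eps ->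
  exists l : seq (T * R[i]), (forall i, i \in unzip1 l -> I i) /\
    (N2 (fun x => f x - lcomb l x)%R < eps%:E)%E.
Proof.
split=> h eps eps0.
  have [n [s [c [sI N]]]] := h _ eps0.
  exists [seq (s k, c k) | k <- enum 'I_n]; split.
    by move=> i; rewrite /unzip1 -map_comp => /mapP[k _ ->]; exact: sI.
  congr (_ < _)%E: N; congr N2; apply/funext => x.
  by rewrite /lcomb big_map big_enum.
have [l [lI N]] := h _ eps0.
exists (size l), (fun k => (tnth (in_tuple l) k).1), (fun k => (tnth (in_tuple l) k).2).
split.
  by move=> k; apply: lI; apply: map_f; exact: mem_tnth.
congr (_ < _)%E: N; congr N2; apply/funext => x.
by rewrite /lcomb big_tnth.
Qed.

Lemma cmeas_lcomb l : cmeas (lcomb l).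
Proof. by apply: cmeas_sum => p; apply: cmeasM; [exact: cmeas_cst|exact: (fe p.1).1]. Qed.

(** A repeated index is merged into its earlier occurrence by adding the coefficients. *)
Lemma lcomb_comb l : (forall i, i \in unzip1 l -> I i) ->
  exists (s : seq T) (c : T -> R[i]), [/\ uniq s, (forall i, i \in s -> I i) & lcomb l = comb e s c].
Proof.
elim: l => [|[i a] l ih] lI.
  by exists [::], (fun=> 0); split => //; apply/funext => x; rewrite /lcomb /comb !big_nil.
have [j jl|s [c [us sI E]]] := ih; first by apply: lI; rewrite inE jl orbT.
have Ec x : lcomb ((i, a) :: l) x = a * e i x + comb e s c x by rewrite /lcomb big_cons -/(lcomb l x) E.
have [is_|is_] := boolP (i \in s).
  exists s, (fun j => c j + (if j == i then a else 0)); split => //.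
  apply/funext => x; rewrite Ec /comb.
  under [RHS]eq_bigr do rewrite mulrDl.
  rewrite big_split/= addrC; congr (_ + _).
  rewrite (bigD1_seq i)//= eqxx big1 ?addr0// => j /negbTE ->.
  by rewrite mul0r.
exists (i :: s), (fun j => if j == i then a else c j); split => /=.
- by rewrite is_.
- by move=> j; rewrite inE => /predU1P[->|/sI//]; apply: lI; rewrite inE eqxx.
apply/funext => x; rewrite Ec /comb big_cons eqxx; congr (_ + _).
apply: eq_big_seq => j js; case: eqP => // ji; by rewrite -ji js in is_.
Qed.

Lemma inspanD f g : cmeas f -> cmeas g -> inspan f -> inspan g -> inspan (fun x => f x + g x).
Proof.
move=> mf mg /inspanP sf /inspanP sg; apply/inspanP => eps eps0.
(* The bound 2 N2 f + 2 N2 g turns two errors below eps / 4 into one below eps. *)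
have e4 : 0 < eps / 4 by rewrite divr_gt0.
have [l [lI lf]] := sf _ e4; have [k [kI kg]] := sg _ e4.
exists (l ++ k); split.
  by move=> i; rewrite /unzip1 map_cat mem_cat => /orP[/lI|/kI].
have -> : (fun x => f x + g x - lcomb (l ++ k) x) =
    (fun x => (f x - lcomb l x) + (g x - lcomb k x)).
  by apply/funext => x; rewrite /lcomb big_cat/=; ring.
have mD h j : cmeas h -> cmeas (fun x => h x - lcomb j x).
  by move=> mh; apply: cmeasD => //; apply: cmeasN; exact: cmeas_lcomb.
apply: (le_lt_trans (N2D_le (mD _ _ mf) (mD _ _ mg))).
have -> : eps%:E = (2%:E * (eps / 4)%:E + 2%:E * (eps / 4)%:E)%E.
  by rewrite -!EFinM -EFinD; congr EFin; lra.
by rewrite lteD// lte_pmul2l// lte_fin.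
Qed.

Lemma inspanZ f c : cmeas f -> inspan f -> inspan (fun x => c * f x).
Proof.
move=> mf /inspanP sf; apply/inspanP => eps eps0.
(* The added 1 keeps the quotient meaningful for c = 0. *)
pose d := eps / (sqn c + 1).
have c1 : 0 < sqn c + 1 by rewrite ltr_wpDl// sqn_ge0.
have d0 : 0 < d by rewrite divr_gt0.
have [l [lI lf]] := sf _ d0.
exists [seq (p.1, c * p.2) | p <- l]; split.
  by move=> i; rewrite /unzip1 -map_comp => /lI.
have -> : (fun x => c * f x - lcomb [seq (p.1, c * p.2) | p <- l] x) =
    (fun x => c * (f x - lcomb l x)).
  apply/funext => x; rewrite /lcomb big_map mulrBr mulr_sumr; congr (_ - _).
  by apply: eq_bigr => p _; rewrite mulrA.
rewrite N2Z; last by apply: cmeasD => //; apply: cmeasN; exact: cmeas_lcomb.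
apply: (@le_lt_trans _ _ ((sqn c)%:E * d%:E)%E).
  by rewrite lee_wpmul2l ?lee_fin ?sqn_ge0// ltW.
rewrite -EFinM lte_fin /d mulrA ltr_pdivrMr// mulrC ltr_pM2l//.
by rewrite ltrDl.
Qed.

Lemma inspan_lim f : cmeas f -> (forall eps : R, 0 < eps -> exists g,
    [/\ cmeas g, inspan g & (N2 (fun x => f x - g x)%R < eps%:E)%E]) -> inspan f.
Proof.
move=> mf h; apply/inspanP => eps eps0.
have e4 : 0 < eps / 4 by rewrite divr_gt0.
have [g [mg /inspanP sg fg]] := h _ e4.
have [l [lI lg]] := sg _ e4.
exists l; split => //.
have -> : (fun x => f x - lcomb l x) = (fun x => (f x - g x) + (g x - lcomb l x)).
  by apply/funext => x; ring.
have mD h' j : cmeas h' -> cmeas (fun x => h' x - lcomb j x).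
  by move=> mh; apply: cmeasD => //; apply: cmeasN; exact: cmeas_lcomb.
have mfg : cmeas (fun x => f x - g x) by apply: cmeasD => //; apply: cmeasN.
apply: (le_lt_trans (N2D_le mfg (mD _ _ mg))).
have -> : eps%:E = (2%:E * (eps / 4)%:E + 2%:E * (eps / 4)%:E)%E.
  by rewrite -!EFinM -EFinD; congr EFin; lra.
by rewrite lteD// lte_pmul2l// lte_fin.
Qed.

Hypothesis on : forall i j, I i -> I j -> L2dot (e i) (e j) = (i == j)%:R.

Lemma bessel_seq f s : fin2 f -> uniq s -> (forall j, j \in s -> I j) ->
  \sum_(i <- s) sqn (L2dot f (e i)) <= fine (N2 f).
Proof.
move=> ff us sI; have := N2_sub_comb fe on (fun i => L2dot f (e i)) ff us sI.
rewrite [X in _ + X]big1 ?addr0; last by move=> i _; rewrite subrr sqn0.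
by move=> h; rewrite -subr_ge0 -h fine_ge0// N2_ge0.
Qed.

Lemma bessel f : fin2 f -> (\esum_(i in I) (sqn (L2dot f (e i)))%:E <= N2 f)%E.
Proof.
move=> ff; apply: ge_ereal_sup => _ [X [finX XI] <-].
rewrite fsbig_finite// sumEFin -(@fineK _ (N2 f)) ?lee_fin.
  apply: bessel_seq => //.
  by move=> j; rewrite in_fset_set// inE => /XI.
by rewrite ge0_fin_numE ?N2_ge0// ff.2.
Qed.

(** By [N2_sub_comb], a combination with arbitrary coefficients leaves a residue of at least [N2 f]
    minus the sum of |<f, e_i>|^2 over its indices, since the completed squares only add to it. *)
Lemma parseval f : fin2 f -> inspan f ->
  (N2 f <= \esum_(i in I) (sqn (L2dot f (e i)))%:E)%E.
Proof.
move=> ff /inspanP sf.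
have Nf : N2 f = (fine (N2 f))%:E by rewrite fineK// ge0_fin_numE ?N2_ge0// ff.2.
apply/lee_addgt0Pr => eps eps0.
have [l [lI lf]] := sf _ eps0.
have [s [c [us sI E]]] := lcomb_comb lI.
rewrite E in lf.
have := N2_sub_comb fe on c ff us sI.
set S1 := \sum_(i <- s) _; set S2 := \sum_(i <- s) _ => h.
have S20 : 0 <= S2 by apply: sumr_ge0 => i _; exact: sqn_ge0.
have lf' : fine (N2 (fun x => f x - comb e s c x)) < eps.
  rewrite -lte_fin fineK// ge0_fin_numE ?N2_ge0//.
  exact: (fin2_sub_comb fe s c ff).2.
apply: (@le_trans _ _ (S1 + eps)%:E); first by rewrite Nf lee_fin; lra.
rewrite EFinD leeD2r// -sumEFin; apply: esum_ge.
exists [set` s]; first by split => //; exact: sI.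
by rewrite -fsbig_seq.
Qed.

(** With the Fourier coefficients as coefficients the completed squares vanish, and the residue is
    exactly [N2 f] minus a finite partial sum, which can be made small. *)
Lemma inspan_parseval f : fin2 f ->
  (N2 f <= \esum_(i in I) (sqn (L2dot f (e i)))%:E)%E -> inspan f.
Proof.
move=> ff Nf; apply/inspanP => eps eps0.
have NfE : N2 f = (fine (N2 f))%:E by rewrite fineK// ge0_fin_numE ?N2_ge0// ff.2.
have : ((fine (N2 f) - eps)%:E < \esum_(i in I) (sqn (L2dot f (e i)))%:E)%E.
  by apply: (lt_le_trans _ Nf); rewrite NfE lte_fin; lra.
move=> /ereal_sup_gt[_ [X [finX XI] <-]].
rewrite fsbig_finite// sumEFin lte_fin => h.
pose c i := L2dot f (e i).
pose s : seq T := finmap.enum_fset (fset_set X).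
have us : uniq s by exact: finmap.fset_uniq.
have sI j : j \in s -> I j.
  by move=> js; apply: XI; apply: set_mem; rewrite -(in_fset_set finX).
exists [seq (i, c i) | i <- s]; split.
  by move=> i; rewrite /unzip1 -map_comp map_id_in// => /sI.
have -> : lcomb [seq (i, c i) | i <- s] = comb e s c.
  by apply/funext => x; rewrite /lcomb big_map.
have := N2_sub_comb fe on c ff us sI.
rewrite [X in _ + X]big1 ?addr0; last by move=> i _; rewrite subrr sqn0.
move=> h2; rewrite -[X in (X < _)%E]fineK.
  by rewrite h2 lte_fin; lra.
rewrite ge0_fin_numE ?N2_ge0//; exact: (fin2_sub_comb fe _ c ff).2.
Qed.

End Span.

(** * Totality of the indicators of open sets of finite measure *)

Section Density.
Import HBNNSimple.
Local Open Scope complex_scope.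
Context {R : realType} (T : choiceType) (I : set T) (e : T -> R -> R[i]).
Hypothesis fe : forall i, fin2 (e i).
Local Notation mu := (@lebesgue_measure R).
Local Notation inspan := (inspan I e).

Definition cfun (a : R -> R) : R -> R[i] := fun x => (a x)%:C.
Definition ind (A : set R) : R -> R[i] := cfun \1_A.

Lemma cmeas_cfun a : measurable_fun setT a -> cmeas (cfun a).
Proof. by move=> ma; split => //; exact: measurable_cst. Qed.

Lemma sqn_cfun a x : sqn (cfun a x) = a x ^+ 2.
Proof. by rewrite /sqn /= expr0n addr0. Qed.

Lemma cmeas_ind A : measurable A -> cmeas (ind A).
Proof. by move=> mA; apply: cmeas_cfun; exact: measurable_indic. Qed.

Lemma indic_sqr (A : set R) x : (\1_A x : R) ^+ 2 = \1_A x.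
Proof. by rewrite indicE; case: (x \in A); rewrite ?expr1n// expr0n. Qed.

Lemma N2_ind A : measurable A -> N2 (ind A) = mu A.
Proof.
move=> mA; rewrite /N2; under eq_integral do rewrite sqn_cfun indic_sqr.
by rewrite integral_indic// setIT.
Qed.

Lemma N2_indB A U : measurable A -> measurable U -> A `<=` U ->
  N2 (fun x => ind A x - ind U x) = mu (U `\` A).
Proof.
move=> mA mU AU; rewrite -N2_ind; last exact: measurableD.
apply: eq_integral => x _; rewrite /ind /cfun -rmorphB.
rewrite -[LHS]/((sqn (cfun (\1_A \- \1_U) x))%:E) !sqn_cfun /= !indicE in_setD.
have [xA|xA] := boolP (x \in A).
  by rewrite (_ : x \in U)//=; [rewrite subrr|move: xA; rewrite !inE => /AU].
by rewrite sub0r sqrrN andbT.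
Qed.

Lemma inspan0 : inspan (fun=> 0).
Proof.
apply/inspanP => eps eps0; exists [::]; split => //.
rewrite /N2 /lcomb; under eq_integral do rewrite big_nil subr0 sqn0.
by rewrite integral0.
Qed.

Hypothesis span_open : forall U, open U -> (mu U < +oo)%E -> inspan (ind U).

(** Outer regularity gives an open U containing A with U minus A of measure below eps, and that
    measure is the squared distance of the indicators. *)
Lemma inspan_ind A : measurable A -> (mu A < +oo)%E -> inspan (ind A).
Proof.
move=> mA finA; apply: (inspan_lim fe); first exact: cmeas_ind.
move=> eps eps0; have [U [oU AU UA]] := lebesgue_regularity_outer mA finA eps0.
have mU : measurable U by exact: open_measurable.
exists (ind U); split; [exact: cmeas_ind| |by rewrite N2_indB].
apply: span_open => //; rewrite -(setDUK AU) measureU//; last 2 first.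
- exact: measurableD.
- by rewrite setDIK.
by rewrite lte_add_pinfty// (lt_trans UA)// ltry.
Qed.

Lemma inspan_simple (f : R -> R) : measurable_fun setT f -> finite_set (range f) ->
  (\int[mu]_x ((f x) ^+ 2)%:E < +oo)%E -> inspan (cfun f).
Proof.
move=> mf /finite_seqP[r fr] finf.
have level (y : R) : inspan (fun x => y%:C * ind (f @^-1` [set y]) x) /\
    measurable (f @^-1` [set y]).
  have mA : measurable (f @^-1` [set y]) by rewrite -[X in measurable X]setTI; exact: mf.
  (* The level 0 may have infinite measure but contributes the zero function; for y nonzero, y^2
     times the measure of the level set is at most the finite integral of f^2. *)
  split => //; have [->|y0] := eqVneq y 0.
    have -> : (fun x => 0%:C * ind (f @^-1` [set 0]) x) = (fun=> 0).
      by apply/funext => x; rewrite mul0r.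
    exact: inspan0.
  apply: (inspanZ fe); first exact: cmeas_ind.
  apply: inspan_ind => //.
  have y20 : (0 < (y ^+ 2)%:E)%E by rewrite lte_fin exprn_even_gt0.
  have : ((y ^+ 2)%:E * mu (f @^-1` [set y]) < +oo)%E.
    apply: le_lt_trans finf.
    rewrite -[X in mu X]setIT -integral_indic// -ge0_integralZl//; last 2 first.
    - by apply/measurable_EFinP; exact: measurable_indic.
    - exact: ltW.
    apply: ge0_le_integral => //.
    - by move=> x _; rewrite -EFinM lee_fin mulr_ge0// sqr_ge0.
    - by apply: measurable_funeM; apply/measurable_EFinP; exact: measurable_indic.
    - by apply/measurable_EFinP; exact: (measurable_funX 2 mf).
    - move=> x _; rewrite -EFinM lee_fin indicE.
      have [|] := boolP (x \in f @^-1` [set y]); last by rewrite mulr0 sqr_ge0.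
      by rewrite inE /= => ->; rewrite mulr1.
  by rewrite !ltey; apply: contra_neq => ->; rewrite gt0_muley.
(* Without repetitions the value f x occurs once, so exactly one level set contributes at x. *)
pose s := undup r.
have -> : cfun f = (fun x => \sum_(y <- s) y%:C * ind (f @^-1` [set y]) x).
  apply/funext => x.
  have xs : f x \in s by rewrite mem_undup; have : range f (f x) by []; rewrite fr.
  rewrite (bigD1_seq (f x))//= ?undup_uniq// big1.
    by rewrite addr0 /ind /cfun indicE mem_set// mulr1.
  move=> y yf; rewrite /ind /cfun indicE memNset ?mulr0// => /= yx.
  by rewrite yx eqxx in yf.
elim: s => [|y s ih].
  have -> : (fun x => \sum_(y <- [::]) y%:C * ind (f @^-1` [set y]) x) = (fun=> 0).
    by apply/funext => x; rewrite big_nil.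
  exact: inspan0.
have -> : (fun x => \sum_(z <- y :: s) z%:C * ind (f @^-1` [set z]) x) =
  (fun x => y%:C * ind (f @^-1` [set y]) x + \sum_(z <- s) z%:C * ind (f @^-1` [set z]) x).
  by apply/funext => x; rewrite big_cons.
have mZ z : cmeas (fun x => z%:C * ind (f @^-1` [set z]) x).
  by apply: cmeasM; [exact: cmeas_cst|apply: cmeas_ind; have [] := level z].
apply: (inspanD fe) => //; first exact: cmeas_sum.
by have [] := level y.
Qed.

(** Increasing simple functions below [a] converge to it in L^2 by dominated convergence, with a^2
    dominating the squared error. *)
Lemma inspan_ge0 (a : R -> R) : measurable_fun setT a -> (forall x, 0 <= a x) ->
  (\int[mu]_x ((a x) ^+ 2)%:E < +oo)%E -> inspan (cfun a).
Proof.
move=> ma a0 fina; apply: (inspan_lim fe); first exact: cmeas_cfun.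
move=> eps eps0.
have mea : measurable_fun setT (EFin \o a) by exact/measurable_EFinP.
pose ph n : R -> R := nnsfun_approx measurableT mea n.
have phcvg x : (ph n x)%:E @[n --> \oo] --> (a x)%:E.
  by apply: (cvg_nnsfun_approx measurableT mea) => // y _; rewrite lee_fin.
have ph0 n x : 0 <= ph n x by [].
have mph n : measurable_fun setT (ph n) by [].
have phle n x : ph n x <= a x.
  rewrite -lee_fin -(cvg_lim (@ereal_hausdorff R) (phcvg x)).
  apply: lime_ge; first by apply/cvg_ex; eexists; exact: phcvg.
  exists n => // m /= nm; rewrite lee_fin.
  exact/lefP/(nd_nnsfun_approx measurableT mea).
have ia2 : mu.-integrable setT (fun x => (a x ^+ 2)%:E).
  apply/integrableP; split; first by apply/measurable_EFinP; exact: (measurable_funX 2 ma).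
  by under eq_integral do rewrite gee0_abs ?lee_fin ?sqr_ge0//.
have dle n x : (a x - ph n x) ^+ 2 <= a x ^+ 2.
  rewrite ler_sqr ?nnegrE//; first by rewrite lerBlDr lerDl.
  by rewrite subr_ge0.
have : (\int[mu]_x ((a x - ph n x) ^+ 2)%:E @[n --> \oo] --> \int[mu]_x 0)%E.
  apply: (@dominated_cvg _ _ R mu setT measurableT _ _ (fun x => (a x ^+ 2)%:E)) => //.
  - by move=> n; apply/measurable_EFinP; exact: (measurable_funX 2 (measurable_funB ma (mph n))).
  - move=> x _; apply: cvg_EFin; first exact: nearW.
    have h : a x - ph n x @[n --> \oo] --> a x - a x.
      apply: cvgB; first exact: cvg_cst.
      exact: (fine_cvg (phcvg x)).
    rewrite [X in _ --> X](_ : _ = (a x - a x) ^+ 2); last by rewrite subrr expr0n.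
    exact: (cvg_comp _ _ h (@exprn_continuous R 2 _)).
  - by move=> n x _; rewrite gee0_abs lee_fin ?sqr_ge0.
rewrite integral0 => cv.
have [N _ hN] : \forall n \near \oo, (\int[mu]_x ((a x - ph n x) ^+ 2)%:E < eps%:E)%E.
  have /fine_cvgP[fin cv'] : (\int[mu]_x ((a x - ph n x) ^+ 2)%:E @[n --> \oo] --> 0%:E)%E by [].
  have cv2 := cvgr_lt _ cv' _ eps0.
  by apply: filterS2 fin (cv2 _) => n fn /=; rewrite -lte_fin fineK.
exists (cfun (ph N)); split.
- exact: cmeas_cfun.
- apply: inspan_simple => //.
  apply: le_lt_trans fina; apply: ge0_le_integral => //.
  + by move=> x _; rewrite lee_fin sqr_ge0.
  + by apply/measurable_EFinP; exact: (measurable_funX 2 (mph N)).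
  + by apply/measurable_EFinP; exact: (measurable_funX 2 ma).
  + by move=> x _; rewrite lee_fin ler_sqr ?nnegrE.
apply: le_lt_trans (hN N (leqnn N)).
rewrite le_eqVlt; apply/orP; left; apply/eqP; apply: eq_integral => x _.
by rewrite /cfun -rmorphB -[LHS]/((sqn (cfun (a \- ph N) x))%:E) sqn_cfun.
Qed.

(** [f] is a combination of four nonnegative functions: the positive and negative parts of its real
    and imaginary parts. *)
Lemma inspan_L2 (f : R -> R[i]) : fin2 f -> inspan f.
Proof.
move=> [[mr mi] nf].
pose p (a : R -> R) x := Num.max (a x) 0.
have mp a : measurable_fun setT a -> measurable_fun setT (p a).
  by move=> ma; apply: measurable_maxr => //; exact: measurable_cst.
have p0 a x : 0 <= p a x by rewrite /p le_max lexx orbT.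
have psq (a : R -> R) : measurable_fun setT a -> (forall x, a x ^+ 2 <= sqn (f x)) ->
    inspan (cfun (p a)).
  move=> ma af; apply: inspan_ge0 => //; first exact: mp.
  apply: le_lt_trans nf; apply: ge0_le_integral => //.
  - by move=> x _; rewrite lee_fin sqr_ge0.
  - by apply/measurable_EFinP; exact: (measurable_funX 2 (mp _ ma)).
  - exact: cmeas_sqn.
  - move=> x _; rewrite lee_fin; apply: le_trans (af x); rewrite /p.
    by case: (leP (a x) 0) => // _; rewrite expr0n sqr_ge0.
pose fr (x : R) := complex.Re (f x); pose fi (x : R) := complex.Im (f x).
have frle x : fr x ^+ 2 <= sqn (f x) by rewrite /sqn lerDl sqr_ge0.
have file x : fi x ^+ 2 <= sqn (f x) by rewrite /sqn lerDr sqr_ge0.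
have mNr : measurable_fun setT (fun x => - fr x) by exact: measurable_funN.
have mNi : measurable_fun setT (fun x => - fi x) by exact: measurable_funN.
have s1 := psq fr mr frle.
have s2 : inspan (cfun (p (fun x => - fr x))) by apply: psq => // x; rewrite sqrrN.
have s3 := psq fi mi file.
have s4 : inspan (cfun (p (fun x => - fi x))) by apply: psq => // x; rewrite sqrrN.
have m1 := cmeas_cfun (mp _ mr); have m2 := cmeas_cfun (mp _ mNr).
have m3 := cmeas_cfun (mp _ mi); have m4 := cmeas_cfun (mp _ mNi).
have mZ (c : R[i]) (h : R -> R[i]) : cmeas h -> cmeas (fun x => c * h x).
  by move=> mh; apply: cmeasM => //; exact: cmeas_cst.
have pE (a : R) : Num.max a 0 - Num.max (- a) 0 = a by case: (leP a 0) => a0; case: (leP (-a) 0) => a1; lra.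
have -> : f = (fun x => (cfun (p fr) x + (-1) * cfun (p (fun x => - fr x)) x) +
    (0 +i* 1) * (cfun (p fi) x + (-1) * cfun (p (fun x => - fi x)) x)).
  apply/funext => x; apply: complex_ext.
    rewrite -[LHS](pE (fr x)) !(cReD, cReM, cImM, cImD, cReN, cImN) /cfun /= /p.
    by ring.
  rewrite -[LHS](pE (fi x)) !(cReD, cReM, cImM, cImD, cReN, cImN) /cfun /= /p.
  by ring.
have m5 := cmeasD m1 (mZ (-1) _ m2).
have m6 := cmeasD m3 (mZ (-1) _ m4).
have s5 := inspanD fe m1 (mZ (-1) _ m2) s1 (inspanZ fe (-1) m2 s2).
have s6 := inspanD fe m3 (mZ (-1) _ m4) s3 (inspanZ fe (-1) m4 s4).
exact: (inspanD fe m5 (mZ _ _ m6) s5 (inspanZ fe _ m6 s6)).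
Qed.

End Density.

(** * Time-frequency shifts of indicator functions *)

Section Shift.
Local Open Scope complex_scope.
Context {R : realType}.
Local Notation mu := (@lebesgue_measure R).
Local Notation mu2 := (@plane_measure R).
Implicit Types (A B H K U V : set R) (z l : R * R).

Definition trset (a : R) A : set R := [set x | A (x - a)].

Definition overlap H K (t : R) : set R := [set x | K x /\ H (x - t)].

(* The squared modulus of the short time Fourier transform of 1_K with window
   1_H (see sqn_L2dot_tf). *)
Definition ambig H K z : R := pwr (overlap H K z.1) z.2.

Lemma measurable_shift a A : measurable A -> measurable (trset a A).
Proof.
move=> mA; rewrite -[X in measurable X]setTI.
exact: (measurable_addr (- a)).
Qed.

Lemma indic_shift a A x : \1_(trset a A) x = \1_A (x - a) :> R.
Proof. by rewrite !indicE. Qed.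

Lemma lebesgue_shift a A : measurable A -> mu (trset a A) = mu A.
Proof. by move=> mA; exact: (lebesgue_measure_addr (- a) mA). Qed.

Lemma measurable_overlap H K t : measurable H -> measurable K -> measurable (overlap H K t).
Proof. by move=> mH mK; apply: measurableI => //; exact: measurable_shift. Qed.

Lemma overlapE H K t : overlap H K t = K `&` trset t H.
Proof. by []. Qed.

Lemma overlap_lty H K t : measurable H -> measurable K -> (mu K < +oo)%E ->
  (mu (overlap H K t) < +oo)%E.
Proof.
move=> mH mK; apply: le_lt_trans; apply: le_measure; rewrite ?inE//.
- exact: measurable_overlap.
- exact: subIsetl.
Qed.

Lemma Rintegral_addr a (f : R -> R) : measurable_fun setT f ->
  \int[mu]_x f (x + a) = \int[mu]_x f x.
Proof. by move=> mf; congr fine; apply: (@integral_addr R a (EFin \o f)); exact/measurable_EFinP. Qed.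

Lemma measurable_indic_cos A nu : measurable A ->
  measurable_fun setT (fun x : R => \1_A x * cos (2 * pi * x * nu)).
Proof. by move=> mA; apply: measurable_funM; [exact: measurable_indicR|exact: measurable_cosM]. Qed.

Lemma measurable_indic_sin A nu : measurable A ->
  measurable_fun setT (fun x : R => \1_A x * sin (2 * pi * x * nu)).
Proof. by move=> mA; apply: measurable_funM; [exact: measurable_indicR|exact: measurable_sinM]. Qed.

Lemma cosint_shift a A nu : measurable A -> (mu A < +oo)%E ->
  cosint (trset a A) nu = cos (2 * pi * a * nu) * cosint A nu - sin (2 * pi * a * nu) * sinint A nu.
Proof.
move=> mA fA; rewrite -RintegralZl//; last exact: integrable_cosint.
rewrite -[X in _ - X]RintegralZl//; last exact: integrable_sinint.
rewrite -RintegralB//; last 2 first.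
- by apply: integrableZlR; exact: integrable_cosint.
- by apply: integrableZlR; exact: integrable_sinint.
rewrite /cosint -(Rintegral_addr a); last by apply: measurable_indic_cos; exact: measurable_shift.
apply: eq_Rintegral => x _; rewrite indic_shift addrK.
rewrite (_ : 2 * pi * (x + a) * nu = 2 * pi * x * nu + 2 * pi * a * nu); last by ring.
by rewrite cosD; ring.
Qed.

Lemma sinint_shift a A nu : measurable A -> (mu A < +oo)%E ->
  sinint (trset a A) nu = cos (2 * pi * a * nu) * sinint A nu + sin (2 * pi * a * nu) * cosint A nu.
Proof.
move=> mA fA; rewrite -RintegralZl//; last exact: integrable_sinint.
rewrite -[X in _ + X]RintegralZl//; last exact: integrable_cosint.
rewrite -RintegralD//; last 2 first.
- by apply: integrableZlR; exact: integrable_sinint.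
- by apply: integrableZlR; exact: integrable_cosint.
rewrite /sinint -(Rintegral_addr a); last by apply: measurable_indic_sin; exact: measurable_shift.
apply: eq_Rintegral => x _; rewrite indic_shift addrK.
rewrite (_ : 2 * pi * (x + a) * nu = 2 * pi * x * nu + 2 * pi * a * nu); last by ring.
by rewrite sinD; ring.
Qed.

(** Translation by a rotates the vector ([cosint], [sinint]) by the angle 2 pi a nu. *)
Lemma pwr_shift a A nu : measurable A -> (mu A < +oo)%E -> pwr (trset a A) nu = pwr A nu.
Proof.
move=> mA fA; rewrite /pwr cosint_shift// sinint_shift//.
rewrite [LHS](_ : _ = (cos (2 * pi * a * nu) ^+ 2 + sin (2 * pi * a * nu) ^+ 2) *
  (cosint A nu ^+ 2 + sinint A nu ^+ 2)); last by ring.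
by rewrite cos2Dsin2 mul1r.
Qed.

Lemma cosintN A nu : cosint A (- nu) = cosint A nu.
Proof. by apply: eq_Rintegral => x _; rewrite mulrN cosN. Qed.

Lemma sinintN A nu : measurable A -> (mu A < +oo)%E -> sinint A (- nu) = - sinint A nu.
Proof.
move=> mA fA; rewrite -[RHS]mulN1r -RintegralZl//; last exact: integrable_sinint.
by apply: eq_Rintegral => x _; rewrite mulrN sinN; ring.
Qed.

(** The overlap at - t is a translate of the overlap at t with the roles of the sets exchanged, and
    reversing the frequency only flips the sign of [sinint]. *)
Lemma ambigN H K z : measurable H -> measurable K -> (mu H < +oo)%E -> (mu K < +oo)%E ->
  ambig H K (- z) = ambig K H z.
Proof.
move=> mH mK fH fK; rewrite /ambig /=.
have -> : overlap H K (- z.1) = trset (- z.1) (overlap K H z.1).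
  apply/seteqP; split => x /=; rewrite /overlap /trset /= opprK addrK; tauto.
rewrite pwr_shift; [|exact: measurable_overlap|exact: overlap_lty].
rewrite /pwr cosintN sinintN ?sqrrN//; [exact: measurable_overlap|exact: overlap_lty].
Qed.

Lemma sqn_cis (theta : R) : sqn (cis theta) = 1.
Proof. by rewrite /sqn /= cos2Dsin2. Qed.

Lemma cisD (a b : R) : cis (a + b) = cis a * cis b.
Proof. by apply: complex_ext; rewrite /= ?cosD ?sinD//; ring. Qed.

Lemma cisJ (a : R) : (cis a)^* = cis (- a).
Proof. by apply: complex_ext; rewrite /= ?cosN ?sinN. Qed.

Lemma cmeas_cis nu : cmeas (fun x : R => cis (2 * pi * x * nu)).
Proof. by split; [exact: measurable_cosM|exact: measurable_sinM]. Qed.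

Lemma cmeas_tf H z : measurable H -> cmeas (tfshift (ind H) z).
Proof.
move=> mH; apply: cmeasM; last exact: cmeas_cis.
rewrite [X in cmeas X](_ : _ = ind (trset z.1 H)); first by apply: cmeas_ind; exact: measurable_shift.
by apply/funext => x; rewrite /ind /cfun indic_shift.
Qed.

Lemma N2_tf H z : measurable H -> N2 (tfshift (ind H) z) = mu H.
Proof.
move=> mH; rewrite -(lebesgue_shift z.1 mH) -N2_ind; last exact: measurable_shift.
by apply: eq_integral => x _; rewrite sqnM sqn_cis mulr1 /ind /cfun indic_shift.
Qed.

Lemma fin2_tf H z : measurable H -> (mu H < +oo)%E -> fin2 (tfshift (ind H) z).
Proof. by move=> mH fH; split; [exact: cmeas_tf|rewrite N2_tf]. Qed.

(** The product of the two functions is the indicator of an intersection times a single exponential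
    of frequency z.2 - l.2, and the intersection is an overlap translated by l.1. The translation
    contributes a phase, discarded in [sqn_L2dot_tf]. *)
Lemma L2dot_tf H K z l : L2dot (tfshift (ind H) z) (tfshift (ind K) l) =
  cosint (trset l.1 (overlap H K (z.1 - l.1))) (z.2 - l.2) +i*
  sinint (trset l.1 (overlap H K (z.1 - l.1))) (z.2 - l.2).
Proof.
have indE x : \1_(trset l.1 (overlap H K (z.1 - l.1))) x = \1_H (x - z.1) * \1_K (x - l.1) :> R.
  have -> : trset l.1 (overlap H K (z.1 - l.1)) = trset z.1 H `&` trset l.1 K.
    apply/seteqP; split => x' /=; rewrite /trset /overlap /= (_ : x' - l.1 - (z.1 - l.1) = x' - z.1); try tauto; ring.
  by rewrite indicI /= !indic_shift.
have prodE x : tfshift (ind H) z x * (tfshift (ind K) l x)^* =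
    (\1_(trset l.1 (overlap H K (z.1 - l.1))) x)%:C * cis (2 * pi * x * (z.2 - l.2)).
  rewrite /tfshift indE /ind /cfun.
  rewrite (_ : 2 * pi * x * (z.2 - l.2) = 2 * pi * x * z.2 + - (2 * pi * x * l.2)); last by ring.
  by rewrite cisD -cisJ; apply: complex_ext; rewrite !(cReM, cImM, cReJ, cImJ) /=; ring.
rewrite /L2dot /cintegral; congr (_ +i* _).
  by apply: eq_Rintegral => x _; rewrite prodE cReM /=; ring.
by apply: eq_Rintegral => x _; rewrite prodE cImM /=; ring.
Qed.

Lemma sqn_L2dot_tf H K z l : measurable H -> measurable K -> (mu K < +oo)%E ->
  sqn (L2dot (tfshift (ind H) z) (tfshift (ind K) l)) = ambig H K (z - l).
Proof.
move=> mH mK fK; rewrite L2dot_tf /ambig -(pwr_shift l.1) //.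
  exact: measurable_overlap.
exact: overlap_lty.
Qed.

(** Replaces the complex zero condition of the statement by one on the real function [ambig]: the
    transform is [cosint] - i [sinint] of the overlap. *)
Lemma stft_eq0 H l : measurable H -> (mu H < +oo)%E ->
  (stft (ind H) (ind H) l == 0) = (ambig H H l == 0).
Proof.
move=> mH fH.
have -> : stft (ind H) (ind H) l =
    cosint (overlap H H l.1) l.2 +i* (- sinint (overlap H H l.1) l.2).
  have mo := measurable_overlap l.1 mH mH; have fo := overlap_lty l.1 mH mH fH.
  have indE x : \1_(overlap H H l.1) x = \1_H x * \1_H (x - l.1) :> R.
    by rewrite overlapE indicI /= indic_shift.
  rewrite -sinintN//.
  rewrite /stft /cintegral; congr (_ +i* _).
    apply: eq_Rintegral => x _; rewrite indE /ind /cfun !(cReM, cImM) /= cosN; ring.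
  by apply: eq_Rintegral => x _; rewrite indE /ind /cfun !(cReM, cImM) /= (mulrN _ l.2); ring.
rewrite eq_complex /= oppr_eq0 /ambig /pwr.
by rewrite paddr_eq0 ?sqr_ge0// !sqrf_eq0.
Qed.

Lemma measurable_indic_overlap H K : measurable H -> measurable K ->
  measurable_fun setT (fun w : (R * R) * R => \1_(overlap H K w.1.1) w.2 : R).
Proof.
move=> mH mK.
rewrite [X in measurable_fun _ X](_ : _ = fun w => \1_K w.2 * \1_H (w.2 - w.1.1)); last first.
  by apply/funext => w; rewrite overlapE indicI /= indic_shift.
apply: measurable_funM.
  by apply: (measurableT_comp (f := \1_K : R -> R)) => //; exact: measurable_indicR.
apply: (measurableT_comp (f := \1_H : R -> R)); first exact: measurable_indicR.
apply: measurable_funB; first exact: measurable_snd.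
by apply: (measurableT_comp measurable_fst); exact: measurable_fst.
Qed.

Lemma measurable_ambig H K : measurable H -> measurable K -> measurable_fun setT (ambig H K).
Proof.
move=> mH mK.
have mphase : measurable_fun setT (fun w : (R * R) * R => 2 * pi * w.2 * w.1.2).
  apply: measurable_funM.
    by apply: measurable_funM; [exact: measurable_cst|exact: measurable_snd].
  by apply: (measurableT_comp measurable_snd); exact: measurable_fst.
apply: measurable_funD; apply: measurable_funX.
- refine (@measurable_Rint R _ [the measurableType _ of (R * R)%type] (fun w : (R * R) * R => \1_(overlap H K w.1.1) w.2 * cos (2 * pi * w.2 * w.1.2)) _).
  apply: measurable_funM; first exact: measurable_indic_overlap.
  apply: (measurableT_comp (f := @cos R)) => //.
  by apply: continuous_measurable_fun => x; exact: continuous_cos.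
- refine (@measurable_Rint R _ [the measurableType _ of (R * R)%type] (fun w : (R * R) * R => \1_(overlap H K w.1.1) w.2 * sin (2 * pi * w.2 * w.1.2)) _).
  apply: measurable_funM; first exact: measurable_indic_overlap.
  apply: (measurableT_comp (f := @sin R)) => //.
  by apply: continuous_measurable_fun => x; exact: continuous_sin.
Qed.

Lemma ambig_ge0 H K z : 0 <= ambig H K z.
Proof. exact: pwr_ge0. Qed.

(** By Tonelli: for fixed x, the t with x - t in H form a reflected translate of H. *)
Lemma integral_overlap H K : measurable H -> measurable K ->
  (\int[mu]_t mu (overlap H K t) = mu K * mu H)%E.
Proof.
move=> mH mK.
transitivity (\int[mu]_t \int[mu]_x (\1_K x * \1_H (x - t))%:E)%E.
  apply: eq_integral => t _; rewrite -[X in mu X]setIT -integral_indic//; last exact: measurable_overlap.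
  by apply: eq_integral => x _; rewrite overlapE indicI /= indic_shift.
rewrite (@fubini_tonelli _ _ _ _ R mu mu (fun w : R * R => (\1_K w.2 * \1_H (w.2 - w.1))%:E)); last 2 first.
- apply/measurable_EFinP; apply: measurable_funM.
    by apply: (measurableT_comp (f := \1_K : R -> R)) => //; exact: measurable_indicR.
  apply: (measurableT_comp (f := \1_H : R -> R)); first exact: measurable_indicR.
  by apply: measurable_funB; [exact: measurable_snd|exact: measurable_fst].
- by move=> w; rewrite lee_fin mulr_ge0.
transitivity (\int[mu]_x ((\1_K x)%:E * mu H))%E.
  apply: eq_integral => x _ /=.
  under eq_integral do rewrite EFinM.
  rewrite ge0_integralZl//.
  - have -> : (\int[mu]_t (\1_H (x - t))%:E = \int[mu]_t (\1_H t)%:E)%E.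
      apply: (@ge0_integral_subl R x (EFin \o \1_H)).
        by apply/measurable_EFinP; exact: measurable_indicR.
      by move=> y; rewrite lee_fin.
    by rewrite integral_indic// setIT.
  - apply/measurable_EFinP; apply: (measurableT_comp (f := \1_H : R -> R)); first exact: measurable_indicR.
    exact: measurable_subl.
rewrite ge0_integralZr//.
- by rewrite integral_indic// setIT.
- by apply/measurable_EFinP; exact: measurable_indicR.
Qed.

Lemma measurable_EAmbig H K : measurable H -> measurable K ->
  measurable_fun setT (EFin \o ambig H K).
Proof. by move=> mH mK; apply/measurable_EFinP; exact: measurable_ambig. Qed.

Lemma EAmbig_ge0 H K z : (0 <= (EFin \o ambig H K) z)%E.
Proof. by rewrite lee_fin ambig_ge0. Qed.

Lemma measurable_mu_overlap H K : measurable H -> measurable K ->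
  measurable_fun setT (fun t => mu (overlap H K t)).
Proof.
move=> mH mK.
have -> : (fun t => mu (overlap H K t)) =
    (fun t => \int[mu]_x (EFin \o (fun w : R * R => (\1_K w.2 * \1_H (w.2 - w.1))%R)) (t, x))%E.
  apply/funext => t; rewrite -[X in mu X]setIT -integral_indic//; last exact: measurable_overlap.
  by apply: eq_integral => x _; rewrite overlapE indicI /= indic_shift.
apply: (@measurable_fun_fubini_tonelli_F _ _ _ _ R mu).
  apply/measurable_EFinP; apply: measurable_funM.
    by apply: (measurableT_comp (f := \1_K : R -> R)) => //; exact: measurable_indicR.
  apply: (measurableT_comp (f := \1_H : R -> R)); first exact: measurable_indicR.
  by apply: measurable_funB; [exact: measurable_snd|exact: measurable_fst].
by move=> w /=; rewrite lee_fin mulr_ge0.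
Qed.

(** One half of Moyal's identity: Plancherel in the frequency for each fixed t, then
    [integral_overlap]. *)
Lemma moyal_le H K : measurable H -> measurable K -> (mu K < +oo)%E ->
  (\int[mu2]_z (ambig H K z)%:E <= mu K * mu H)%E.
Proof.
move=> mH mK fK; rewrite /plane_measure fubini_tonelli1//=; last 2 first.
- by apply/measurable_EFinP; exact: measurable_ambig.
- by move=> z; rewrite lee_fin ambig_ge0.
rewrite -(integral_overlap mH mK); apply: ge0_le_integral => //.
- by move=> t _; apply: integral_ge0 => nu _; rewrite lee_fin ambig_ge0.
- exact: (@measurable_fun_fubini_tonelli_F _ _ _ _ R mu (EFin \o ambig H K) (measurable_EAmbig mH mK) (EAmbig_ge0 H K)).
- exact: measurable_mu_overlap.
- move=> t _; rewrite /fubini_F /ambig /=.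
  exact: (plancherel_le (measurable_overlap t mH mK) (overlap_lty t mH mK fK)).
Qed.

Lemma open_shift t A : open A -> open (trset t A).
Proof.
move=> oA; apply: (@open_comp _ _ (fun x : R => x - t)) => // x _.
by apply: continuousB => //; exact: cst_continuous.
Qed.

(** The other half: the overlaps of U and V are open subsets of those of H and K, as [plancherel_ge]
    requires. *)
Lemma moyal_ge H K U V : measurable H -> measurable K -> (mu K < +oo)%E ->
  open U -> open V -> U `<=` H -> V `<=` K ->
  (mu V * mu U <= \int[mu2]_z (ambig H K z)%:E)%E.
Proof.
move=> mH mK fK oU oV UH VK.
have mU := open_measurable oU; have mV := open_measurable oV.
rewrite /plane_measure fubini_tonelli1//=; last 2 first.
- by apply/measurable_EFinP; exact: measurable_ambig.
- by move=> z; rewrite lee_fin ambig_ge0.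
rewrite -(integral_overlap mU mV); apply: ge0_le_integral => //.
- exact: measurable_mu_overlap.
- exact: (@measurable_fun_fubini_tonelli_F _ _ _ _ R mu (EFin \o ambig H K) (measurable_EAmbig mH mK) (EAmbig_ge0 H K)).
- move=> t _; rewrite /fubini_F /ambig /=.
  apply: (plancherel_ge (measurable_overlap t mH mK) (overlap_lty t mH mK fK)).
  + by rewrite overlapE; apply: openI => //; exact: open_shift.
  + by move=> x [Vx Ux]; split; [exact: VK|exact: UH].
Qed.

End Shift.

(** * Continuity of time-frequency shifts at the origin *)

Section Continuity.
Local Open Scope complex_scope.
Context {R : realType}.
Local Notation mu := (@lebesgue_measure R).
Implicit Types (H : set R) (z : R * R).

Lemma sqn_sub_tf H z x : sqn (ind H x - tfshift (ind H) z x) =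
  \1_H x + (\1_(trset z.1 H) x - 2 * (\1_(overlap H H z.1) x * cos (2 * pi * x * z.2))).
Proof.
rewrite overlapE indicI /= indic_shift /sqn /tfshift /ind /cfun !(cReD, cReN, cImD, cImN) /=.
have := indic_sqr H x; have := indic_sqr H (x - z.1); have := cos2Dsin2 (2 * pi * x * z.2).
move: (\1_H x : R) (\1_H (x - z.1) : R) => a b.
move: (cos _) (sin _) => c s cs eb ea.
rewrite [LHS](_ : _ = a ^+ 2 + (b ^+ 2 * (c ^+ 2 + s ^+ 2) - 2 * (a * b * c))); last by ring.
by rewrite cs ea eb mulr1.
Qed.

Lemma N2_sub_tf H z : measurable H -> (mu H < +oo)%E ->
  N2 (fun x => ind H x - tfshift (ind H) z x) =
  (2 * fine (mu H) - 2 * cosint (overlap H H z.1) z.2)%:E.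
Proof.
move=> mH fH.
have mo := measurable_overlap z.1 mH mH; have fo := overlap_lty z.1 mH mH fH.
have ms := measurable_shift z.1 mH.
have iind A : measurable A -> (mu A < +oo)%E -> mu.-integrable setT (EFin \o (\1_A : R -> R)).
  move=> mA fA; rewrite (_ : EFin \o _ = EFin \o (fun x => \1_A x * 1)).
    apply: (integrable_indicM (M := 1)) => //.
    by move=> x; rewrite normr1.
  by apply/funext => x /=; rewrite mulr1.
have iH := iind _ mH fH.
have iS : mu.-integrable setT (EFin \o (\1_(trset z.1 H) : R -> R)).
  by apply: iind => //; rewrite lebesgue_shift.
have iC := integrable_cosint mo fo z.2.
have iC2 := integrableZlR 2 iC.
have iSC := integrableB measurableT iS iC2.
have iA := integrableD measurableT iH iSC.
rewrite /N2.
have -> : (\int[mu]_x (sqn (ind H x - tfshift (ind H) z x))%:E)%E =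
  (\int[mu]_x ((\1_H x + (\1_(trset z.1 H) x - 2 * (\1_(overlap H H z.1) x * cos (2 * pi * x * z.2))))%R)%:E)%E.
  by apply: eq_integral => x _; rewrite sqn_sub_tf.
rewrite -EFin_Rintegral//.
rewrite RintegralD// RintegralB// RintegralZl//.
rewrite !Rintegral_indic// lebesgue_shift// -/(cosint _ _); congr EFin; ring.
Qed.

(** After expansion of the square, only the cosine integral over the overlap has to tend to the
    measure of H. Openness gives pointwise convergence: for x in H the point x - (y n).1 is
    eventually in H, and outside H the overlap is always empty. *)
Lemma N2_sub_tf_cvg H (y : nat -> R * R) : open H -> (mu H < +oo)%E ->
  (y n).1 @[n --> \oo] --> (0 : R) -> (y n).2 @[n --> \oo] --> (0 : R) ->
  N2 (fun x => ind H x - tfshift (ind H) (y n) x) @[n --> \oo] --> (0%E : \bar R).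
Proof.
move=> oH fH y1 y2; have mH := open_measurable oH.
have fmu : mu H \is a fin_num by rewrite ge0_fin_numE.
have -> : (fun n => N2 (fun x => ind H x - tfshift (ind H) (y n) x)) =
    (fun n => (2 * fine (mu H) - 2 * cosint (overlap H H (y n).1) (y n).2)%:E).
  by apply/funext => n; rewrite N2_sub_tf.
have <- : (2 * fine (mu H) - 2 * fine (mu H))%:E = 0%E :> \bar R by rewrite subrr.
apply: cvg_EFin; first exact: nearW.
apply: cvgB; first exact: cvg_cst.
apply: cvgMl_tmp.
have mo n : measurable (overlap H H (y n).1) by exact: measurable_overlap.
have fo n : (mu (overlap H H (y n).1) < +oo)%E by exact: overlap_lty.
have iH : mu.-integrable setT (EFin \o (\1_H : R -> R)).
  apply/integrableP; split; first by apply/measurable_EFinP; exact: measurable_indicR.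
  under eq_integral do rewrite gee0_abs ?lee_fin//.
  by rewrite integral_indic// setIT.
apply: fine_cvg; rewrite fineK// (_ : mu H = \int[mu]_x (\1_H x)%:E)%E; last first.
  by rewrite integral_indic// setIT.
apply: (@dominated_cvg _ _ R mu setT measurableT (fun n x => (\1_(overlap H H (y n).1) x * cos (2 * pi * x * (y n).2))%:E)
   (fun x => (\1_H x)%:E) (fun x => (\1_H x)%:E)) => //.
- by move=> n; have /integrableP[] := integrable_cosint (mo n) (fo n) (y n).2.
- move=> x _; apply: cvg_EFin; first exact: nearW.
  have [Hx|nHx] := pselect (H x); last first.
    rewrite [X in X @ _ --> _](_ : _ = fun=> 0); last first.
      apply/funext => n /=; rewrite overlapE indicI /= [\1_H x]indicE memNset// !mul0r.
      by [].
    rewrite indicE memNset//; exact: cvg_cst.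
  have shx : x - (y n).1 @[n --> \oo] --> x.
    rewrite -[X in _ --> X]subr0; apply: cvgB => //; exact: cvg_cst.
  have nH : \forall n \near \oo, H (x - (y n).1).
    by apply: shx; exact: open_nbhs_nbhs.
  rewrite indicE mem_set//.
  have cn : cos (2 * pi * x * (y n).2) @[n --> \oo] --> cos (2 * pi * x * 0).
    have h : 2 * pi * x * (y n).2 @[n --> \oo] --> 2 * pi * x * 0 by exact: cvgMl_tmp.
    exact: (cvg_comp _ _ h (@continuous_cos R _)).
  move: cn; rewrite mulr0 cos0 => cn.
  apply: cvg_trans cn; apply: near_eq_cvg.
  near=> n; rewrite /= overlapE indicI /= indicE mem_set// mul1r.
  rewrite /trset indicE mem_set ?mul1r//=; near: n; exact: nH.
- move=> n x _; rewrite /= lee_fin normrM overlapE indicI /= normrM -mulrA.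
  rewrite ger0_norm// ler_piMr// mulr_ile1// ?ler_norml ?cos_geN1 ?cos_le1//.
  by rewrite !indicE; case: (_ \in _) => /=; lra.
Unshelve. all: by end_near.
Qed.

End Continuity.

(** * Zeros of the ambiguity function of the window *)

Section IntervalFourier.
Context {R : realType}.
Local Notation mu := (@lebesgue_measure R).
Implicit Types (A B S : set R) (a b nu : R).

Lemma is_derive_lin (w x : R) : is_derive x 1 (fun t : R => w * t) w.
Proof.
have -> : (fun t : R => w * t) = w \*: (id : R -> R) by [].
by apply: is_derive_eq; exact: mulr1.
Qed.

Lemma is_derive_sin_lin (w x : R) : w != 0 ->
  is_derive x 1 (fun t : R => w^-1 * sin (w * t)) (cos (w * x)).
Proof.
move=> w0; have d := @is_derive1_comp _ sin _ _ _ _ (is_derive_sin _) (is_derive_lin w x).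
have -> : (fun t : R => w^-1 * sin (w * t)) = w^-1 \*: (sin \o (fun t : R => w * t)) by [].
apply: is_derive_eq; rewrite /GRing.scale /=; move: (cos _) => c; field.
exact: w0.
Qed.

Lemma is_derive_cos_lin (w x : R) : w != 0 ->
  is_derive x 1 (fun t : R => - w^-1 * cos (w * t)) (sin (w * x)).
Proof.
move=> w0; have d := @is_derive1_comp _ cos _ _ _ _ (is_derive_cos _) (is_derive_lin w x).
have -> : (fun t : R => - w^-1 * cos (w * t)) = (- w^-1) \*: (cos \o (fun t : R => w * t)) by [].
apply: is_derive_eq; rewrite /GRing.scale /=; move: (sin _) => c; field.
exact: w0.
Qed.

Lemma Rintegral_FTC (f F : R -> R) a b : a < b -> continuous f ->
  (forall x : R, is_derive x 1 F (f x)) -> \int[mu]_x (\1_(`[a, b[%classic) x * f x) = F b - F a.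
Proof.
move=> ab cf dF.
have cF : continuous F.
  move=> y; apply: differentiable_continuous.
  by apply/derivable1_diffP; have [] := dF y.
rewrite /Rintegral.
transitivity (fine (\int[mu]_(x in `[a, b[) (f x)%:E)).
  rewrite [in RHS]integral_mkcond; congr fine; apply: eq_integral => x _.
  by rewrite restrict_EFin /= patchE indicE; case: (_ \in _); rewrite ?mul1r ?mul0r.
rewrite integral_itv_bndo_bndc; last first.
  by apply/measurable_EFinP; apply: measurable_funTS; exact: continuous_measurable_fun.
rewrite (@continuous_FTC2 R f F)//.
- exact: continuous_subspaceT.
- split.
  + by move=> y _; have [] := dF y.
  + by apply: cvg_at_right_filter; exact: cF.
  + by apply: cvg_at_left_filter; exact: cF.
- by move=> y _; rewrite derive1E; apply: derive_val; exact: dF.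
Qed.

(** Sum-to-product around the midpoint (a + b) / 2: a factor depending on the length alone, times
    the phase of the centre. The factor pi nu stays on the left to avoid division. *)
Lemma cosint_itv a b nu : a < b -> nu != 0 ->
  pi * nu * cosint `[a, b[%classic nu = sin (pi * (b - a) * nu) * cos (pi * (a + b) * nu).
Proof.
move=> ab nu0; pose w := 2 * pi * nu.
have pi0 : (pi : R) != 0 by rewrite gt_eqF// pi_gt0.
have w0 : w != 0 by rewrite !mulf_neq0// pnatr_eq0.
have -> : cosint `[a, b[%classic nu = w^-1 * sin (w * b) - w^-1 * sin (w * a).
  have cf : continuous (fun x : R => cos (w * x)).
    move=> x; apply: (continuous_comp (g := cos)); last exact: continuous_cos.
    by apply: cvgMl_tmp; exact: cvg_id.
  rewrite -[RHS](Rintegral_FTC ab cf (fun x => is_derive_sin_lin x w0)).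
  by apply: eq_Rintegral => x _; rewrite /w; congr (_ * cos _); ring.
rewrite (_ : w * b = pi * (a + b) * nu + pi * (b - a) * nu); last by rewrite /w; ring.
rewrite (_ : w * a = pi * (a + b) * nu - pi * (b - a) * nu); last by rewrite /w; ring.
rewrite sinD sinB /w; move: (sin _) (cos _) (sin _) (cos _) => s c s' c'.
by move: (pi : R) pi0 => p p0; field; rewrite p0 nu0.
Qed.

Lemma sinint_itv a b nu : a < b -> nu != 0 ->
  pi * nu * sinint `[a, b[%classic nu = sin (pi * (b - a) * nu) * sin (pi * (a + b) * nu).
Proof.
move=> ab nu0; pose w := 2 * pi * nu.
have pi0 : (pi : R) != 0 by rewrite gt_eqF// pi_gt0.
have w0 : w != 0 by rewrite !mulf_neq0// pnatr_eq0.
have -> : sinint `[a, b[%classic nu = - w^-1 * cos (w * b) - - w^-1 * cos (w * a).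
  have cf : continuous (fun x : R => sin (w * x)).
    move=> x; apply: (continuous_comp (g := sin)); last exact: continuous_sin.
    by apply: cvgMl_tmp; exact: cvg_id.
  rewrite -[RHS](Rintegral_FTC ab cf (fun x => is_derive_cos_lin x w0)).
  by apply: eq_Rintegral => x _; rewrite /w; congr (_ * sin _); ring.
rewrite (_ : w * b = pi * (a + b) * nu + pi * (b - a) * nu); last by rewrite /w; ring.
rewrite (_ : w * a = pi * (a + b) * nu - pi * (b - a) * nu); last by rewrite /w; ring.
rewrite cosD cosB /w; move: (sin _) (cos _) (sin _) (cos _) => s c s' c'.
by move: (pi : R) pi0 => p p0; field; rewrite p0 nu0.
Qed.

Lemma indicU_disj A B x : [disjoint A & B] -> \1_(A `|` B) x = \1_A x + \1_B x :> R.
Proof.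
move=> /disj_setPS AB; rewrite !indicE in_setU.
have [xA|_] := boolP (x \in A); have [xB|_] := boolP (x \in B) => //=.
- by have := AB x (conj (set_mem xA) (set_mem xB)).
- by rewrite addr0.
- by rewrite add0r.
- by rewrite add0r.
Qed.

Lemma cosintU A B nu : measurable A -> measurable B -> (mu A < +oo)%E -> (mu B < +oo)%E ->
  [disjoint A & B] -> cosint (A `|` B) nu = cosint A nu + cosint B nu.
Proof.
move=> mA mB fA fB AB.
rewrite -RintegralD//; [|exact: integrable_cosint|exact: integrable_cosint].
by apply: eq_Rintegral => x _; rewrite indicU_disj// mulrDl.
Qed.

Lemma sinintU A B nu : measurable A -> measurable B -> (mu A < +oo)%E -> (mu B < +oo)%E ->
  [disjoint A & B] -> sinint (A `|` B) nu = sinint A nu + sinint B nu.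
Proof.
move=> mA mB fA fB AB.
rewrite -RintegralD//; [|exact: integrable_sinint|exact: integrable_sinint].
by apply: eq_Rintegral => x _; rewrite indicU_disj// mulrDl.
Qed.

Lemma itv_lty a b : (mu `[a, b[%classic < +oo)%E.
Proof. by rewrite lebesgue_measure_itv/=; case: ifP => _; rewrite -?EFinB ltry. Qed.

Lemma pwr_at0 S : measurable S -> (mu S < +oo)%E -> pwr S 0 = fine (mu S) ^+ 2.
Proof.
move=> mS fS; rewrite /pwr.
have -> : sinint S 0 = 0.
  rewrite /sinint (_ : (fun x : R => _) = fun=> 0); last first.
    by apply/funext => x; rewrite mulr0 sin0 mulr0.
  by rewrite /Rintegral integral0.
have -> : cosint S 0 = fine (mu S).
  by rewrite -(Rintegral_indic mS); apply: eq_Rintegral => x _; rewrite mulr0 cos0 mulr1.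
by rewrite expr0n addr0.
Qed.

(** The interval formulas degenerate at frequency 0, where the power is the squared measure. *)
Lemma pwr_at0_neq0 S a b : measurable S -> (mu S < +oo)%E -> a < b -> `[a, b[ `<=` S -> pwr S 0 != 0.
Proof.
move=> mS fS ab abS; rewrite pwr_at0// sqrf_eq0 gt_eqF// fine_gt0// fS andbT.
have : (mu `[a, b[%classic <= mu S)%E by apply: le_measure; rewrite ?inE.
by apply: lt_le_trans; rewrite lebesgue_measure_itv/= lte_fin ab -EFinB lte_fin subr_gt0.
Qed.

Lemma sin_pi_neq0 (x : R) : x != 0 -> `|x| < 1 -> sin (pi * x) != 0.
Proof.
wlog x0 : x / 0 < x => [h xn xl|_].
  have [x0|x0] := ltP 0 x; first exact: h.
  rewrite -oppr_eq0 -sinN -mulrN; apply: h; rewrite ?oppr_eq0 ?normrN//.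
  by rewrite oppr_gt0 lt_neqAle xn.
rewrite gtr0_norm// => x1; rewrite gt_eqF// sin_gt0_pi// mulr_gt0 ?pi_gt0//=.
by rewrite gtr_pMr// pi_gt0.
Qed.

Lemma cos_pi_neq0 (x : R) : `|x| < 2^-1 -> cos (pi * x) != 0.
Proof.
rewrite ltr_norml => /andP[x0 x1]; rewrite gt_eqF// cos_gt0_pihalf//.
have p0 := pi_gt0 R; move: (pi : R) p0 => p p0.
by apply/andP; split; [rewrite -mulrN|]; rewrite ltr_pM2l.
Qed.

End IntervalFourier.

Section IntervalPower.
Context {R : realType}.
Local Notation mu := (@lebesgue_measure R).
Implicit Types (A B S : set R) (a b c d nu : R).

Lemma pwr_eq0 S nu : pwr S nu = 0 -> cosint S nu = 0 /\ sinint S nu = 0.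
Proof.
move/eqP; rewrite /pwr paddr_eq0 ?sqr_ge0// !sqrf_eq0.
by move=> /andP[/eqP -> /eqP ->].
Qed.

Lemma itv_disj a b c d : b <= c -> [disjoint `[a, b[%classic & `[c, d[%classic].
Proof.
move=> bc; apply/disj_setPS => x [] /=; rewrite !in_itv /= => /andP[_ xb] /andP[cx _].
by have := lt_le_trans xb (le_trans bc cx); rewrite ltxx.
Qed.

Lemma itvU_lty a b c d : (mu (`[a, b[%classic `|` `[c, d[%classic) < +oo)%E.
Proof.
have := measureU2 mu (measurable_itv `[a, b[) (measurable_itv `[c, d[).
by move=> /le_lt_trans; apply; apply: lte_add_pinfty; exact: itv_lty.
Qed.

Lemma cosint_itv2 a b c d nu : a < b -> b <= c -> c < d -> nu != 0 ->
  pi * nu * cosint (`[a, b[%classic `|` `[c, d[%classic) nu =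
  sin (pi * (b - a) * nu) * cos (pi * (a + b) * nu) +
  sin (pi * (d - c) * nu) * cos (pi * (c + d) * nu).
Proof.
move=> ab bc cd nu0; rewrite cosintU//; [|exact: itv_lty|exact: itv_lty|exact: itv_disj].
by rewrite mulrDr !cosint_itv.
Qed.

Lemma sinint_itv2 a b c d nu : a < b -> b <= c -> c < d -> nu != 0 ->
  pi * nu * sinint (`[a, b[%classic `|` `[c, d[%classic) nu =
  sin (pi * (b - a) * nu) * sin (pi * (a + b) * nu) +
  sin (pi * (d - c) * nu) * sin (pi * (c + d) * nu).
Proof.
move=> ab bc cd nu0; rewrite sinintU//; [|exact: itv_lty|exact: itv_lty|exact: itv_disj].
by rewrite mulrDr !sinint_itv.
Qed.

(** Up to a unit phase and the factor pi nu the transform of an interval is sin(pi (b - a) nu),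
    whose first zeros are at |nu| (b - a) = 1. *)
Lemma pwr_itv_neq0 a b nu : a < b -> `|nu| * (b - a) < 1 -> pwr `[a, b[%classic nu != 0.
Proof.
move=> ab small; have [->|nu0] := eqVneq nu 0.
  by apply: (pwr_at0_neq0 _ (itv_lty a b) ab).
apply/eqP => /pwr_eq0[c0 s0].
have := cosint_itv ab nu0; have := sinint_itv ab nu0; rewrite c0 s0 mulr0 => es ec.
have : sin (pi * ((b - a) * nu)) != 0.
  apply: sin_pi_neq0; first by rewrite mulf_neq0// subr_eq0 gt_eqF.
  by rewrite normrM (gtr0_norm (_ : 0 < b - a)) ?subr_gt0// mulrC.
rewrite mulrA => /negP; apply; apply/eqP.
have := cos2Dsin2 (pi * (a + b) * nu).
move: es ec; move: (sin _) (cos _) (sin _) => s c s' es ec e1.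
by rewrite -[LHS]mulr1 -e1 mulrDr !expr2 !mulrA -es -ec !mul0r addr0.
Qed.

(* With S1, S2 the two sines and c1 < c2 the centres of the intervals, vanishing
   means S1 e^{2 pi i c1 nu} + S2 e^{2 pi i c2 nu} = 0; multiply by
   e^{- pi i (c1 + c2) nu} and separate real and imaginary parts. *)
Lemma pwr_itv2_eq0 a b c d nu : a < b -> b <= c -> c < d -> nu != 0 ->
  pwr (`[a, b[%classic `|` `[c, d[%classic) nu = 0 ->
  (sin (pi * ((b - a) * nu)) + sin (pi * ((d - c) * nu))) * cos (pi * ((c + d - a - b) / 2 * nu)) = 0 /\
  (sin (pi * ((b - a) * nu)) - sin (pi * ((d - c) * nu))) * sin (pi * ((c + d - a - b) / 2 * nu)) = 0.
Proof.
move=> ab bc cd nu0 /pwr_eq0[c0 s0].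
have := cosint_itv2 ab bc cd nu0; have := sinint_itv2 ab bc cd nu0; rewrite c0 s0 mulr0.
set h := pi * ((c + d - a - b) / 2 * nu); pose m := pi * ((a + b + c + d) / 2 * nu).
rewrite (_ : pi * (a + b) * nu = m - h); last by rewrite /m /h; field.
rewrite (_ : pi * (c + d) * nu = m + h); last by rewrite /m /h; field.
rewrite !mulrA cosB cosD sinB sinD.
have := cos2Dsin2 m.
move: (sin (pi * (b - a) * nu)) (sin (pi * (d - c) * nu)) (cos m) (sin m) (cos h) (sin h) => s1 s2 cm sm ch sh e1 es ec.
split; apply/eqP.
- rewrite -[X in X == _]mulr1 -e1.
  rewrite [X in X == _](_ : _ = cm * (s1 * (cm * ch + sm * sh) + s2 * (cm * ch - sm * sh)) +
    sm * (s1 * (sm * ch - cm * sh) + s2 * (sm * ch + cm * sh))); last by ring.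
  by rewrite -es -ec !mulr0 addr0.
- rewrite -[X in X == _]mulr1 -e1.
  rewrite [X in X == _](_ : _ = sm * (s1 * (cm * ch + sm * sh) + s2 * (cm * ch - sm * sh)) -
    cm * (s1 * (sm * ch - cm * sh) + s2 * (sm * ch + cm * sh))); last by ring.
  by rewrite -es -ec !mulr0 subr0.
Qed.

Lemma sinD_half (x y : R) :
  sin (pi * x) + sin (pi * y) = 2 * (sin (pi * ((x + y) / 2)) * cos (pi * ((x - y) / 2))).
Proof.
have {1}-> : pi * x = pi * ((x + y) / 2) + pi * ((x - y) / 2) by field.
have {1}-> : pi * y = pi * ((x + y) / 2) - pi * ((x - y) / 2) by field.
by rewrite sinD sinB; ring.
Qed.

Lemma sinB_half (x y : R) :
  sin (pi * x) - sin (pi * y) = 2 * (cos (pi * ((x + y) / 2)) * sin (pi * ((x - y) / 2))).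
Proof.
have {1}-> : pi * x = pi * ((x + y) / 2) + pi * ((x - y) / 2) by field.
have {1}-> : pi * y = pi * ((x + y) / 2) - pi * ((x - y) / 2) by field.
by rewrite sinD sinB; ring.
Qed.

Lemma norm_small (x y : R) : 0 < y -> `|x| * y < 1 -> - 1 < x * y < 1.
Proof. by move=> y0 xy; rewrite -ltr_norml normrM (gtr0_norm y0). Qed.

(** The numbers l1 nu and l2 nu have the same sign and modulus below 1, so half their sum is a
    nonzero number of modulus below 1 and half their difference has modulus below 1/2. *)
Lemma sinD_pi_neq0 (l1 l2 nu : R) : 0 < l1 -> 0 < l2 -> nu != 0 ->
  `|nu| * l1 < 1 -> `|nu| * l2 < 1 -> sin (pi * (l1 * nu)) + sin (pi * (l2 * nu)) != 0.
Proof.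
move=> l10 l20 nu0 h1 h2; rewrite sinD_half !mulf_neq0 ?pnatr_eq0//.
- apply: sin_pi_neq0.
    by rewrite mulf_neq0// -mulrDl mulf_neq0// gt_eqF// addr_gt0.
  have /andP[a1 a2] := norm_small l10 h1; have /andP[b1 b2] := norm_small l20 h2.
  rewrite ltr_norml; lra.
- apply: cos_pi_neq0.
  have /andP[a1 a2] := norm_small l10 h1; have /andP[b1 b2] := norm_small l20 h2.
  rewrite ltr_norml; have [p|n] := ltP 0 nu.
  + have := mulr_gt0 l10 p; have := mulr_gt0 l20 p; lra.
  + have p : 0 < - nu by rewrite oppr_gt0 lt_neqAle nu0.
    have := mulr_gt0 l10 p; have := mulr_gt0 l20 p; lra.
Qed.

(** The sum of the two sines cannot vanish here, so a zero would require phase opposition of the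
    centres, whose distance is (c + d - a - b) / 2. *)
Lemma pwr_itv2_neq0 a b c d nu : a < b -> b <= c -> c < d ->
  `|nu| * (b - a) < 1 -> `|nu| * (d - c) < 1 ->
  cos (pi * ((c + d - a - b) / 2 * nu)) != 0 ->
  pwr (`[a, b[%classic `|` `[c, d[%classic) nu != 0.
Proof.
move=> ab bc cd h1 h2 ch; have [->|nu0] := eqVneq nu 0.
  by apply: (pwr_at0_neq0 _ (itvU_lty a b c d) ab); [exact: measurableU|exact: subsetUl].
apply/eqP => /(pwr_itv2_eq0 ab bc cd nu0)[/eqP]; rewrite mulf_eq0 (negbTE ch) orbF => + _.
by apply/negP; apply: sinD_pi_neq0; rewrite ?subr_gt0.
Qed.

(** Cancellation needs opposite phases and equal sines. With total length below 1 / |nu|, equal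
    sines force equal lengths. *)
Lemma pwr_itv2_neq0_len a b c d nu : a < b -> b <= c -> c < d ->
  `|nu| * ((b - a) + (d - c)) < 1 -> b - a != d - c ->
  pwr (`[a, b[%classic `|` `[c, d[%classic) nu != 0.
Proof.
move=> ab bc cd h ne; have [->|nu0] := eqVneq nu 0.
  by apply: (pwr_at0_neq0 _ (itvU_lty a b c d) ab); [exact: measurableU|exact: subsetUl].
have ab0 : 0 < b - a by rewrite subr_gt0.
have cd0 : 0 < d - c by rewrite subr_gt0.
have n0 := normr_ge0 nu.
have h1 : `|nu| * (b - a) < 1 by nra.
have h2 : `|nu| * (d - c) < 1 by nra.
apply/eqP => /(pwr_itv2_eq0 ab bc cd nu0)[/eqP + /eqP].
rewrite mulf_eq0 (negbTE (sinD_pi_neq0 ab0 cd0 nu0 h1 h2)) /= => /eqP ch.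
rewrite mulf_eq0 orbC => /orP[/eqP sh|].
  by have /eqP := cos2Dsin2 (pi * ((c + d - a - b) / 2 * nu)); rewrite ch sh expr0n addr0 eq_sym oner_eq0.
apply/negP; rewrite sinB_half !mulf_neq0 ?pnatr_eq0//.
- apply: cos_pi_neq0; have /andP[a1 a2] := norm_small (addr_gt0 ab0 cd0) h.
  rewrite -mulrDl ltr_norml; lra.
- have /andP[a1 a2] := norm_small ab0 h1; have /andP[b1 b2] := norm_small cd0 h2.
  apply: sin_pi_neq0; last by rewrite ltr_norml; lra.
  by rewrite mulf_neq0// -mulrBl mulf_neq0// subr_eq0.
Qed.

(* The imaginary part after rotating the centre of the middle interval to 0. *)
Lemma pwr_itv3_eq0 a b c d p q nu : a < b -> b <= c -> c < d -> d <= p -> p < q -> nu != 0 ->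
  pwr (`[a, b[%classic `|` `[c, d[%classic `|` `[p, q[%classic) nu = 0 ->
  sin (pi * (b - a) * nu) * sin (pi * (a + b - (c + d)) * nu) +
  sin (pi * (q - p) * nu) * sin (pi * (p + q - (c + d)) * nu) = 0.
Proof.
move=> ab bc cd dp pq nu0 /pwr_eq0[].
have dis : [disjoint (`[a, b[%classic `|` `[c, d[%classic) & `[p, q[%classic].
  apply/disj_setPS => x [/= xabcd xpq].
  have {}xabcd : x \in `[a, d[.
    by case: xabcd; rewrite /= !in_itv /= => /andP[]; lra.
  by have /disj_setPS/(_ x (conj xabcd xpq)) := itv_disj a q dp.
have mU : measurable (`[a, b[%classic `|` `[c, d[%classic) by exact: measurableU.
rewrite (cosintU nu mU (measurable_itv _) (itvU_lty _ _ _ _) (itv_lty _ _) dis).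
rewrite (sinintU nu mU (measurable_itv _) (itvU_lty _ _ _ _) (itv_lty _ _) dis).
move=> c0 s0.
have {c0} := congr1 ( *%R (pi * nu)) c0; rewrite mulr0 mulrDr cosint_itv2// cosint_itv// => ec.
have {s0} := congr1 ( *%R (pi * nu)) s0; rewrite mulr0 mulrDr sinint_itv2// sinint_itv// => es.
move: es ec.
rewrite [pi * (a + b - _) * nu](_ : _ = pi * (a + b) * nu - pi * (c + d) * nu); last by ring.
rewrite [pi * (p + q - _) * nu](_ : _ = pi * (p + q) * nu - pi * (c + d) * nu); last by ring.
rewrite !sinB.
set s1 := sin (pi * (b - a) * nu); set s2 := sin (pi * (d - c) * nu); set s3 := sin (pi * (q - p) * nu).
set sm := sin (pi * (c + d) * nu); set cm := cos (pi * (c + d) * nu) => es ec.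
rewrite (_ : 0 = cm * 0 - sm * 0); last by rewrite !mulr0 subrr.
by rewrite -{1}es -ec; ring.
Qed.

End IntervalPower.

(** * Overlaps of the window with its translates *)

Section WindowOverlap.
Context {R : realType}.
Variables (al be : R).
Local Notation mu := (@lebesgue_measure R).
Hypotheses (al0 : 0 < al) (be0 : 0 < be) (al2 : al <= 2^-1).
Local Notation W := (Omega al be).
Implicit Types t nu x : R.

Lemma itvE (a b x : R) : `[a, b[%classic x <-> a <= x /\ x < b.
Proof. by rewrite /= in_itv /=; split => /andP. Qed.

Lemma setUP (A B : set R) x : (A `|` B) x <-> A x \/ B x.
Proof. by []. Qed.

Lemma OmegaE x : W x <-> (0 <= x /\ x < al) \/ (be + al <= x /\ x < be + 1).
Proof. by rewrite -!itvE. Qed.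

Lemma overlap_OmegaE t x : overlap W W t x <->
  ((0 <= x /\ x < al) \/ (be + al <= x /\ x < be + 1)) /\
  ((0 <= x - t /\ x - t < al) \/ (be + al <= x - t /\ x - t < be + 1)).
Proof. by rewrite -!OmegaE. Qed.

Ltac split_hyps := repeat match goal with
  | H : _ \/ _ |- _ => destruct H
  | H : _ /\ _ |- _ => destruct H
  end.

Ltac itv_lra := first [by exfalso; lra | by split; lra | by left; itv_lra | by right; itv_lra | by split; itv_lra].

(** Start of the case analysis for t >= 0, by the position of t relative to [al], [be] and 1 - [al].
    As long as t <= [be] no interval reaches the other one, and each meets only its own
    translate. *)
Lemma overlap_first t : 0 <= t -> t < al -> t <= be ->
  overlap W W t = `[t, al[%classic `|` `[be + al + t, be + 1[%classic.
Proof.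
move: (al0) (be0) (al2) => a0 b0 a2.
move=> t0 ta tb; apply/seteqP; split => x; rewrite overlap_OmegaE ?setUP !itvE;
  move=> h; split_hyps; itv_lra.
Qed.

Lemma overlap_second t : al <= t -> t <= be ->
  overlap W W t = `[be + al + t, be + 1[%classic.
Proof.
move: (al0) (be0) (al2) => a0 b0 a2.
move=> ta tb; apply/seteqP; split => x; rewrite overlap_OmegaE !itvE;
  move=> h; split_hyps; itv_lra.
Qed.

(** The second interval has moved off itself, and only the translate of the first, of length [al],
    meets it. *)
Lemma overlap_cross t : be < t -> 1 - al <= t -> t < be + 1 ->
  exists a b, [/\ overlap W W t = `[a, b[%classic, a < b & b - a <= al].
Proof.
move: (al0) (be0) (al2) => a0 b0 a2 tb ta t1.
exists (Num.max (be + al) t), (Num.min (be + 1) (t + al)).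
case: (leP (be + al) t) => ?; case: (leP (be + 1) (t + al)) => ?; (split; [|lra|lra]);
  (apply/seteqP; split => x; rewrite overlap_OmegaE !itvE; move=> h; split_hyps; itv_lra).
Qed.

Lemma overlap_cross_second t a : be < t -> al <= t -> t < 1 - al -> a = Num.max (be + al) t ->
  overlap W W t = `[a, t + al[%classic `|` `[be + al + t, be + 1[%classic.
Proof.
move: (al0) (be0) (al2) => a0 b0 a2.
move=> tb ta ta' ->; apply/seteqP; split => x; rewrite overlap_OmegaE ?setUP !itvE;
case: (leP (be + al) t) => ?; move=> h; split_hyps; itv_lra.
Qed.

Lemma overlap_three t : be < t -> t < al ->
  overlap W W t = `[t, al[%classic `|` `[be + al, t + al[%classic `|` `[be + al + t, be + 1[%classic.
Proof.
move: (al0) (be0) (al2) => a0 b0 a2.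
move=> tb ta; apply/seteqP; split => x; rewrite overlap_OmegaE ?setUP !itvE;
  move=> h; split_hyps; itv_lra.
Qed.

(** In [pwr_itv3_eq0] the products of sines expand into four cosines, two of which cancel. What
    remains is sin(pi (be + 1 - t) nu) sin(pi (1 - 2 al) nu), with both factors of nu in (0, 1]. *)
Lemma pwr_three_neq0 t nu : be < t -> t < al -> al < 2^-1 -> nu != 0 -> `|nu| < 1 ->
  pwr (overlap W W t) nu != 0.
Proof.
move: (al0) (be0) (al2) => a0 b0 a2.
move=> tb ta al12 nu0 nu1; rewrite overlap_three//; apply/eqP => /pwr_itv3_eq0.
have h1 : be + al < t + al by lra.
have h2 : al <= be + al by lra.
have h3 : t + al <= be + al + t by lra.
have h4 : be + al + t < be + 1 by lra.
move=> /(_ ta h2 h1 h3 h4 nu0).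
have prod (u v : R) : sin u * sin v = (cos (u - v) - cos (u + v)) / 2 by rewrite cosB cosD; field.
rewrite !prod.
rewrite [pi * (al - t) * nu - _](_ : _ = pi * (be + 2 * al - t) * nu); last by ring.
rewrite [pi * (al - t) * nu + _](_ : _ = pi * (- t - be) * nu); last by ring.
rewrite [pi * (be + 1 - (be + al + t)) * nu - _](_ : _ = pi * (- t - be) * nu); last by ring.
rewrite [pi * (be + 1 - (be + al + t)) * nu + _](_ : _ = pi * (be + 2 - 2 * al - t) * nu); last by ring.
have : sin (pi * ((be + 1 - t) * nu)) * sin (pi * ((1 - 2 * al) * nu)) != 0.
  have n0 := normr_ge0 nu.
  have key c : 0 < c -> c <= 1 -> sin (pi * (c * nu)) != 0.
    move=> c0 c1; apply: sin_pi_neq0; first by rewrite mulf_neq0// gt_eqF.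
    rewrite normrM gtr0_norm//; nra.
  by apply: mulf_neq0; apply: key; lra.
rewrite prod.
rewrite [_ - pi * _](_ : _ = pi * (be + 2 * al - t) * nu); last by ring.
rewrite [_ + pi * _](_ : _ = pi * (be + 2 - 2 * al - t) * nu); last by ring.
by move=> /eqP h1' h2'; apply: h1'; lra.
Qed.

(** The bound with 1 + [be] - [al] matters for be < t < 1 - al: there a piece crossing the gap may
    be as long as the remaining piece of the second interval. The excluded range of t is where the
    overlap is empty. *)
Lemma pwr_Omega_neq0 t nu : al < 2^-1 -> 0 <= t -> t < be + 1 -> `|nu| < 1 ->
  (be < 1 - al -> `|nu| * (1 + be - al) < 1) -> ~ (1 - al <= t /\ t <= be) ->
  pwr (overlap W W t) nu != 0.
Proof.
move: (al0) (be0) (al2) => a0 b0 a2.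
move=> al12 t0 tb1 nu1 nube ne; have n0 := normr_ge0 nu.
have [tb|tb] := leP t be.
  have ta1 : t < 1 - al by rewrite ltNge; apply/negP => h; exact: ne.
  have [ta|ta] := ltP t al.
    rewrite overlap_first//; apply: pwr_itv2_neq0_len; [lra|lra|lra|nra|].
    by rewrite lt_eqF//; lra.
  by rewrite overlap_second//; apply: pwr_itv_neq0; [lra|nra].
have [ta|ta] := leP (1 - al) t.
  have [a [b [-> ab bal]]] := overlap_cross tb ta tb1.
  by apply: pwr_itv_neq0 => //; nra.
have {}nube : `|nu| * (1 + be - al) < 1 by apply: nube; lra.
have [ta'|ta'] := ltP t al.
  have [->|nu0] := eqVneq nu 0; last exact: pwr_three_neq0.
  rewrite overlap_three//; apply: (@pwr_at0_neq0 _ _ t al) => //.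
  - by apply: measurableU => //; exact: measurableU.
  - have mU : measurable (`[t, al[%classic `|` `[be + al, t + al[%classic) by exact: measurableU.
    have := measureU2 mu mU (measurable_itv `[be + al + t, be + 1[).
    by move=> /le_lt_trans; apply; apply: lte_add_pinfty; [exact: itvU_lty|exact: itv_lty].
  - by move=> x h; left; left.
rewrite (overlap_cross_second tb ta' ta erefl).
set a := Num.max _ _.
have [ha1 ha2] : a < t + al /\ t + al - a <= t - be by rewrite /a; case: (leP (be + al) t) => ?; split; lra.
(* Unequal lengths exclude cancellation. Equal lengths leave the phases: the centres are at distance
   at most (1 + be - al) / 2, too close for opposition. *)
have [e|e] := eqVneq (t + al - a) (be + 1 - (be + al + t)); last first.
  apply: pwr_itv2_neq0_len => //; [lra|lra|].
  nra.
apply: pwr_itv2_neq0; [lra|lra|lra|nra|nra|].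
apply: cos_pi_neq0; rewrite normrM.
set d := (_ / 2).
have [d0 d1] : 0 < d /\ d <= (1 + be - al) / 2 by rewrite /d; split; lra.
rewrite gtr0_norm//; nra.
Qed.

(** For t < 1/2 both pieces have length 1/2 - t, so unequal lengths are of no help; only opposition
    of centres at distance be + 1/2 can produce a zero. All lengths being at most 1/2, frequencies
    up to 2 are allowed. *)
Lemma pwr_Omega_half_neq0 t nu : al = 2^-1 -> 2^-1 <= be -> 0 <= t -> t < be + 1 ->
  `|nu| < 2 -> cos (pi * ((be + 2^-1) * nu)) != 0 -> ~ (2^-1 <= t /\ t <= be) ->
  pwr (overlap W W t) nu != 0.
Proof.
move: (al0) (be0) (al2) => a0 b0 a2.
move=> ah be12 t0 tb1 nu2 cosn ne; have n0 := normr_ge0 nu.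
have [tb|tb] := leP t be.
  have ta1 : t < 2^-1 by rewrite ltNge; apply/negP => h; exact: ne.
  rewrite overlap_first//; last by lra.
  apply: pwr_itv2_neq0; [lra|lra|lra|nra|nra|].
  by rewrite [X in X * nu](_ : _ = be + 2^-1)//; field.
have ta : 1 - al <= t by lra.
have [a [b [-> ab bal]]] := overlap_cross tb ta tb1.
by apply: pwr_itv_neq0 => //; nra.
Qed.

End WindowOverlap.

Section Packing.
Context {R : realType}.
Local Notation mu := (@lebesgue_measure R).
Local Notation mu2 := (@plane_measure R).

(** If y - l and y - m both lie in D, their difference m - l is a zero by orthogonality unless l =
    m, so at most one term of the sum is 1. *)
Lemma nonvanishing_packing (W : set R) (Lambda D : set (R * R)) :
  (forall l m, Lambda l -> Lambda m -> l != m -> ambig W W (l - m) = 0) ->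
  (forall x y, D x -> D y -> ambig W W (x - y) != 0) ->
  forall y, (\esum_(l in Lambda) (\1_D (y - l) : R)%:E <= 1)%E.
Proof.
move=> L0 D0 y.
have [[l [Ll Dl]]|none] := pselect (exists l, Lambda l /\ D (y - l)); last first.
  rewrite esum1// => l Ll; rewrite indicE memNset// => Dl; apply: none; by exists l.
have uniq m : Lambda m -> D (y - m) -> m = l.
  move=> Lm Dm; apply/eqP; apply/negP => /negP ml.
  have := D0 _ _ Dl Dm; rewrite (_ : y - l - (y - m) = m - l) ?L0 ?eqxx//.
  by rewrite opprB addrC addrA subrK.
rewrite (_ : esum _ _ = (\esum_(m in [set l]) (\1_D (y - m))%:E)%E).
  by rewrite esum_set1 ?lee_fin// indicE; case: (_ \in _).
rewrite esum_mkcond [RHS]esum_mkcond; apply: eq_esum => m _.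
case: ifPn => mL; case: ifPn => ml //.
  rewrite indicE memNset// => Dm; move: ml; rewrite (uniq m) ?in_setE//; first by move/negP; apply; exact/mem_set.
  exact: set_mem.
by move: ml mL => /set_mem -> /negP []; exact/mem_set.
Qed.

Lemma ambig_sub_sym (W : set R) (x y : R * R) : measurable W -> (mu W < +oo)%E ->
  ambig W W (x - y) = ambig W W (y - x).
Proof. by move=> mW fW; rewrite -[y - x]opprB ambigN// . Qed.

(** Restricts attention to time shifts t >= 0, the range treated for the overlaps. *)
Lemma nonvanishing_sym (W : set R) (D : set (R * R)) : measurable W -> (mu W < +oo)%E ->
  (forall x y, D x -> D y -> y.1 <= x.1 -> ambig W W (x - y) != 0) ->
  forall x y, D x -> D y -> ambig W W (x - y) != 0.
Proof.
move=> mW fW h x y Dx Dy; have [/h|/ltW /h] := leP y.1 x.1; first exact.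
by rewrite ambig_sub_sym//; apply.
Qed.

End Packing.

(** * The tiling set *)

Section TilingSets.
Context {R : realType}.
Local Notation mu := (@lebesgue_measure R).
Local Notation mu2 := (@plane_measure R).
Implicit Types al be : R.

Lemma measurable_Omega al be : measurable (Omega al be).
Proof. by apply: measurableU; exact: measurable_itv. Qed.

Lemma mu_setU (A B : set R) : measurable A -> measurable B -> A `&` B = set0 ->
  (mu (A `|` B) = mu A + mu B)%E.
Proof. by move=> mA mB AB; exact: measureU. Qed.

Lemma mu_itv (b1 b2 : bool) (x y : R) : x <= y ->
  mu [set` Interval (BSide b1 x) (BSide b2 y)] = (y - x)%:E.
Proof.
move=> xy; rewrite lebesgue_measure_itv /=; case: ifP => // /negbT.
by rewrite lte_fin -leNgt => yx; rewrite (@le_anti _ _ x y) ?subrr// xy.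
Qed.

Lemma mu_Omega al be : 0 <= al <= 1 -> 0 < be -> mu (Omega al be) = 1%E.
Proof.
move=> /andP[al0 al1] be0.
have disj : `[0, al[%classic `&` `[be + al, be + 1[%classic = set0 :> set R.
  by apply/eqP/itv_disj; lra.
rewrite /Omega (mu_setU (measurable_itv _) (measurable_itv _) disj) !mu_itv; [|lra|lra].
by rewrite -EFinD; congr EFin; ring.
Qed.

(** An open subset of full measure, which [moyal_ge] asks for. *)
Definition Omega_int al be : set R := `]0, al[%classic `|` `]be + al, be + 1[%classic.

Lemma open_Omega_int al be : open (Omega_int al be).
Proof. by apply: openU; exact: interval_open. Qed.

Lemma Omega_int_sub al be : Omega_int al be `<=` Omega al be.
Proof. by apply: setUSS => x /=; rewrite !in_itv /= => /andP[/ltW -> ->]. Qed.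

Lemma mu_Omega_int al be : 0 <= al <= 1 -> 0 < be -> mu (Omega_int al be) = 1%E.
Proof.
move=> /andP[al0 al1] be0.
have disj : `]0, al[%classic `&` `]be + al, be + 1[%classic = set0 :> set R.
  by apply/seteqP; split => x //= -[]; rewrite !in_itv /=; lra.
rewrite /Omega_int (mu_setU (measurable_itv _) (measurable_itv _) disj) !mu_itv; [|lra|lra].
by rewrite -EFinD; congr EFin; ring.
Qed.

Lemma measurable_cell be k : measurable (cell be k).
Proof. exact: measurable_itv. Qed.

Definition cells be (n : nat) : set R := \big[setU/set0]_(k < n) cell be k.

Lemma measurable_cells be n : measurable (cells be n).
Proof. by apply: bigsetU_measurable => k _; exact: measurable_cell. Qed.

Lemma cellsP be n x : cells be n x -> exists k, (k < n)%N /\ cell be k x.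
Proof. by rewrite /cells -bigcup_mkord => -[k /= kn xk]; exists k. Qed.

Lemma cellE be k x : 0 < be -> cell be k x <->
  2 * k%:R <= (2 * be + 1) * x < 2 * k%:R + 1.
Proof.
move=> be0; have b0 : 0 < 2 * be + 1 by lra.
by rewrite /cell /= in_itv /= ler_pdivrMr// ltr_pdivlMr// ![x * _]mulrC.
Qed.

Lemma mu_cells be n : 0 < be -> mu (cells be n) = (n%:R / (2 * be + 1))%:E.
Proof.
move=> be0; have b0 : 0 < 2 * be + 1 by lra.
elim: n => [|n IH]; first by rewrite /cells big_ord0 measure0 mul0r.
rewrite /cells big_ord_recr /= -/(cells be n) mu_setU.
- rewrite IH /cell mu_itv.
    by rewrite -EFinD; congr EFin; rewrite -natr1; field; rewrite gt_eqF.
  by rewrite ler_pM2r ?invr_gt0//; lra.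
- exact: measurable_cells.
- exact: measurable_cell.
- apply/seteqP; split => x //= -[/cellsP[k [kn]]]; rewrite !cellE// => /andP[_ h1] /andP[h2 _].
  have : (k.+1%:R : R) <= n%:R by rewrite ler_nat.
  rewrite -natr1; lra.
Qed.

(* With n = floor(2 beta) and r = frac(2 beta), the half-integer case is the one
   where the last interval is empty. *)
Lemma fibre_half be : 0 < be -> exists (n : nat) (r : R),
  [/\ 0 <= r < 1, 2 * be = n%:R + r &
   fibre 2^-1 be = cells be n.+1 `|`
     `[2 * (n.+1)%:R / (2 * be + 1), (2 * (n.+1)%:R + r) / (2 * be + 1)[%classic].
Proof.
move=> be0; rewrite /fibre ltxx.
case: asboolP => [[n [n0 ->]]|_].
  exists n, 0; split; first by rewrite lexx ltr01.
  - by rewrite addr0; field.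
  - rewrite addr0 [X in _ `|` X](_ : _ = set0) ?setU0.
      rewrite /cells -bigcup_mkord; congr bigcup.
      by apply/seteqP; split => k /=; rewrite (_ : 2 * (n%:R / 2) = n%:R); (try by field); rewrite ler_nat.
    by apply/seteqP; split => x //=; rewrite in_itv /=; case: ltgtP.
have f0 : 0 <= Num.floor (2 * be) by rewrite floor_ge0; lra.
have [n nE] : exists n : nat, Num.floor (2 * be) = n%:Z by exists `|Num.floor (2 * be)|%N; rewrite gez0_abs.
exists n, (frac_part (2 * be)); split.
- rewrite /frac_part subr_ge0 floor_le_tmp/= ltrBlDl.
  by have := floorD1_gt (2 * be); rewrite intrD.
- by rewrite /frac_part nE addrC subrK.
- rewrite /last_cell nE /cells -bigcup_mkord; congr (_ `|` _).
  by rewrite -(natr1 n).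
Qed.

Lemma measurable_fibre_half be : 0 < be -> measurable (fibre 2^-1 be).
Proof.
move=> be0; have [n [r [_ _ ->]]] := fibre_half be0.
by apply: measurableU; [exact: measurable_cells|exact: measurable_itv].
Qed.

Lemma mu_fibre_half be : 0 < be -> mu (fibre 2^-1 be) = 1%E.
Proof.
move=> be0; have [n [r [/andP[r0 r1] ber ->]]] := fibre_half be0.
have b0 : 0 < 2 * be + 1 by lra.
rewrite mu_setU; last first.
- apply/seteqP; split => x //= -[/cellsP[k [kn]]]; rewrite cellE// => /andP[_ h1].
  rewrite in_itv /= ler_pdivrMr// mulrC => /andP[h2 _].
  have : (k.+1%:R : R) <= n.+1%:R by rewrite ler_nat.
  rewrite -natr1; lra.
- exact: measurable_itv.
- exact: measurable_cells.
rewrite mu_cells// mu_itv; last by rewrite ler_pM2r ?invr_gt0//; lra.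
rewrite -EFinD; congr EFin; rewrite -natr1 ber.
by field; rewrite -ber gt_eqF.
Qed.

Lemma fibre_halfP be x : 0 < be -> fibre 2^-1 be x ->
  [/\ 0 <= x, x < 2 & exists k : nat, 2 * k%:R <= (2 * be + 1) * x < 2 * k%:R + 1].
Proof.
move=> be0; have [n [r [/andP[r0 r1] ber ->]]] := fibre_half be0.
have b0 : 0 < 2 * be + 1 by lra.
have n0 := ler0n R n.
(* Treats whole cells (s = 1) and the truncated last one (s = r) together. The bound x < 2 comes
   from 2 n + 2 + r <= 2 (2 be + 1) = 2 n + 2 + 2 r. *)
suff h k (s : R) : (k%:R : R) <= n.+1%:R -> 2 * k%:R + s <= 2 * n%:R + 2 + r -> s <= 1 ->
    2 * k%:R <= (2 * be + 1) * x < 2 * k%:R + s ->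
    [/\ 0 <= x, x < 2 & exists k : nat, 2 * k%:R <= (2 * be + 1) * x < 2 * k%:R + 1].
  case=> [/cellsP[k [kn]]|].
    rewrite cellE//; apply: h => //; first by rewrite ler_nat ltnW.
    have : (k.+1%:R : R) <= n.+1%:R by rewrite ler_nat.
    rewrite -!natr1; lra.
  rewrite /= in_itv /= ler_pdivrMr// ltr_pdivlMr// ![x * _]mulrC.
  by apply: h => //; [rewrite -natr1; lra|exact: ltW].
move=> kn ks s1 /andP[h1 h2]; have k0 := ler0n R k.
split; last by exists k; apply/andP; split; lra.
- by rewrite -(pmulr_rge0 _ b0); lra.
- rewrite -(ltr_pM2l b0); lra.
Qed.

Lemma cosD_natpi_sqr (x : R) (k : nat) : cos (x + k%:R * pi) ^+ 2 = cos x ^+ 2.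
Proof.
elim: k => [|k IH]; first by rewrite mul0r addr0.
by rewrite -natr1 mulrDl mul1r addrA cosDpi sqrrN.
Qed.

(** The cosine vanishes only when (2 be + 1) (x - y) is an odd integer, whereas this number lies at
    distance less than 1 from the even integer 2 (k - m). *)
Lemma fibre_half_cos_neq0 be x y : 0 < be -> fibre 2^-1 be x -> fibre 2^-1 be y ->
  cos (pi * ((be + 2^-1) * (x - y))) != 0.
Proof.
move=> be0 /(fibre_halfP be0)[_ _ [k /andP[k1 k2]]] /(fibre_halfP be0)[_ _ [m /andP[m1 m2]]].
(* Half the distance to the even integer, so |r| < 1/2. The shifts by k pi and m pi are put on
   opposite sides to stay with natural numbers; squaring removes their signs. *)
pose r := ((2 * be + 1) * (x - y) - 2 * k%:R + 2 * m%:R) / 2.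
have : cos (pi * r) != 0.
  apply: cos_pi_neq0; rewrite /r ltr_norml; apply/andP; split; lra.
rewrite -sqrf_eq0 -(cosD_natpi_sqr _ k) => h.
rewrite -sqrf_eq0 -(cosD_natpi_sqr _ m).
by rewrite [X in cos X](_ : _ = pi * r + k%:R * pi)//; rewrite /r; field.
Qed.

Section Window.
Variables al be : R.
Hypotheses (al0 : 0 < al) (be0 : 0 < be).
Local Notation W := (Omega al be).

Let mW : measurable W. Proof. exact: measurable_Omega. Qed.

Lemma Omega_lty : (mu W < +oo)%E.
Proof. by apply: itvU_lty. Qed.

(** Points of the same interval differ by less than 1 - [al], and points on both sides of the gap by
    more than [be]; hence the empty overlaps never occur. *)
Lemma Omega_sub_bounds x y : al <= 2^-1 -> W x -> W y -> y <= x ->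
  [/\ 0 <= x - y, x - y < be + 1 & ~ (1 - al <= x - y /\ x - y <= be)].
Proof.
move: al0 be0 => a0 b0 a2; rewrite !OmegaE => hx hy yx; split; [lra| |].
  by case: hx => -[? ?]; case: hy => -[? ?]; lra.
by case: hx => -[? ?]; case: hy => -[? ?] [? ?]; lra.
Qed.

Lemma nonvanishing_lt x y : al < 2^-1 -> 1 - al <= be ->
  tiling_set al be x -> tiling_set al be y -> ambig W W (x - y) != 0.
Proof.
move=> a2 ab; apply: nonvanishing_sym => //; first exact: Omega_lty.
move=> {x y} [x1 x2] [y1 y2] [/= Wx Fx] [/= Wy Fy] yx.
have [h1 h2 h3] := Omega_sub_bounds (ltW a2) Wx Wy yx.
move: Fx Fy; rewrite /fibre a2 /= !in_itv /= => /andP[? ?] /andP[? ?].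
apply: pwr_Omega_neq0 => //=.
- exact: ltW.
- by rewrite ltr_norml; lra.
- by rewrite ltNge ab.
Qed.

Lemma nonvanishing_half x y : al = 2^-1 -> 2^-1 <= be ->
  tiling_set al be x -> tiling_set al be y -> ambig W W (x - y) != 0.
Proof.
move=> a2 ab; apply: nonvanishing_sym => //; first exact: Omega_lty.
move=> {x y} [x1 x2] [y1 y2] [/= Wx Fx] [/= Wy Fy] yx.
have a2' : al <= 2^-1 by rewrite a2.
have [h1 h2 h3] := Omega_sub_bounds a2' Wx Wy yx.
move: Fx Fy; rewrite a2 => Fx Fy.
have [? ? _] := fibre_halfP be0 Fx; have [? ? _] := fibre_halfP be0 Fy.
rewrite -a2; apply: pwr_Omega_half_neq0 => //=.
- by rewrite ltr_norml; lra.
- exact: fibre_half_cos_neq0.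
- by rewrite (_ : 2^-1 = 1 - al)//; rewrite a2; field.
Qed.

(* When beta < 1 - alpha the ambiguity function may vanish on D - D.  It does not
   vanish on wide_set - wide_set, and wide_set has area larger than 1, so in that
   case there is no orthonormal basis at all. *)
Definition wide_set : set (R * R) :=
  `[0, 1 + be[%classic `*` `[0, Num.min 1 (1 + be - al)^-1[%classic.

Lemma nonvanishing_wide x y : al < 2^-1 -> be < 1 - al ->
  wide_set x -> wide_set y -> ambig W W (x - y) != 0.
Proof.
move=> a2 ab; apply: nonvanishing_sym => //; first exact: Omega_lty.
move=> {x y} [x1 x2] [y1 y2] [/=]; rewrite !in_itv /= => /andP[? ?] /andP[? hx] [/=].
rewrite !in_itv /= => /andP[? ?] /andP[? hy] yx.
move: hx hy; rewrite !lt_min => /andP[? hx] /andP[? hy].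
move: al0 be0 => a0 b0; have c0 : 0 < 1 + be - al by lra.
apply: pwr_Omega_neq0 => //=.
- exact: ltW.
- lra.
- lra.
- by rewrite ltr_norml; lra.
- move=> _; rewrite -ltr_pdivlMr// div1r ltr_norml; lra.
- by move=> [? ?]; lra.
Qed.

(** The area is 1 + be or (1 + be) / (1 + be - al), and both exceed 1. *)
Lemma wide_set_gt1 : al < 1 -> (1 < mu2 wide_set)%E.
Proof.
move=> a1; move: al0 be0 => a0 b0; have c0 : 0 < 1 + be - al by lra.
have m0 : 0 < Num.min 1 (1 + be - al)^-1 by rewrite lt_min ltr01 invr_gt0.
rewrite /wide_set /plane_measure product_measure1E//.
rewrite [X in (X * _)%E](mu_itv _ _ (_ : 0 <= 1 + be)); last by lra.
rewrite [X in (_ * X)%E](mu_itv _ _ (ltW m0)) -EFinM lte_fin !subr0.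
case: (leP 1 (1 + be - al)^-1) => h; first lra.
rewrite ltr_pdivlMr// mul1r; lra.
Qed.

Lemma measurable_wide_set : measurable wide_set.
Proof. by apply: measurableX; exact: measurable_itv. Qed.

End Window.

Lemma measurable_tiling_set al be : 0 < be -> al <= 2^-1 -> measurable (tiling_set al be).
Proof.
move=> be0 al2; apply: measurableX; first exact: measurable_Omega.
have [h|h] := ltP al 2^-1; first by rewrite /fibre h; exact: measurable_itv.
have -> : al = 2^-1 by apply/le_anti; rewrite al2.
exact: measurable_fibre_half.
Qed.

Lemma mu_tiling_set al be : 0 < al -> 0 < be -> al <= 2^-1 -> mu2 (tiling_set al be) = 1%E.
Proof.
move=> al0 be0 al2.
have F1 : measurable (fibre al be) /\ mu (fibre al be) = 1%E.
  have [h|h] := ltP al 2^-1.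
    rewrite /fibre h; split; first exact: measurable_itv.
    by rewrite mu_itv ?ler01// subr0.
  have -> : al = 2^-1 by apply/le_anti; rewrite al2.
  by split; [exact: measurable_fibre_half|exact: mu_fibre_half].
have [mF F1'] := F1.
rewrite /plane_measure product_measure1E//; last exact: measurable_Omega.
rewrite [X in (X * _)%E]mu_Omega//; last by lra.
by rewrite [X in (_ * X)%E]F1' mule1.
Qed.

End TilingSets.

(** * Bases versus tilings *)

Section Assembly.
Local Open Scope complex_scope.
Context {R : realType}.
Local Notation mu := (@lebesgue_measure R).
Local Notation mu2 := (@plane_measure R).
Variables (W V : set R) (Lambda : set (R * R)).
Hypotheses (mW : measurable W) (W1 : mu W = 1%E).
Local Notation e := (tfshift (ind W)).

Let fW : (mu W < +oo)%E. Proof. by rewrite W1 ltry. Qed.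

Let fe l : fin2 (e l). Proof. exact: fin2_tf. Qed.

Lemma L2dot_tf_self l : L2dot (e l) (e l) = 1.
Proof. by rewrite L2dot_self N2_tf// W1. Qed.

Lemma sub_zero_setP : ([set l - m | l in Lambda & m in Lambda]
    `<=` zero_set (stft (ind W) (ind W)) `|` [set 0]) <->
  (forall l m, Lambda l -> Lambda m -> l != m -> ambig W W (l - m) = 0).
Proof.
split => [h l m Ll Lm lm|h _ [l Ll [m Lm] <-]].
  have [|/eqP] : (zero_set (stft (ind W) (ind W)) `|` [set 0]) (l - m).
  - by apply: h; exists l => //; exists m.
  - by rewrite /zero_set /= => /eqP; rewrite stft_eq0// => /eqP.
  - by rewrite subr_eq0 (negbTE lm).
have [->|lm] := eqVneq l m; first by right; rewrite subrr.
by left; rewrite /zero_set /=; apply/eqP; rewrite stft_eq0// h.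
Qed.

Lemma orthonormal_tfP :
  (forall l m, Lambda l -> Lambda m -> L2dot (e l) (e m) = (l == m)%:R) <->
  (forall l m, Lambda l -> Lambda m -> l != m -> ambig W W (l - m) = 0).
Proof.
split => h l m Ll Lm.
  by move=> lm; rewrite -sqn_L2dot_tf// h// (negbTE lm) sqn0.
have [->|lm] := eqVneq l m; first exact: L2dot_tf_self.
by apply: sqn_eq0; rewrite sqn_L2dot_tf// h.
Qed.

Lemma basis_inspan : orthonormal_basis Lambda e ->
  forall f, fin2 f -> inspan Lambda e f.
Proof.
move=> [_ _ dense] f ff eps eps0.
have s0 : 0 < Num.sqrt eps by rewrite sqrtr_gt0.
have /dense/(_ _ s0)[n [s [c [sL h]]]] : L2 f by apply/L2P.
by exists n, s, c; split => //; move: h; rewrite L2norm_lt// sqr_sqrtr// ltW.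
Qed.

Lemma inspan_basis :
  (forall l m, Lambda l -> Lambda m -> L2dot (e l) (e m) = (l == m)%:R) ->
  (forall f, fin2 f -> inspan Lambda e f) -> orthonormal_basis Lambda e.
Proof.
move=> on sp; split => //.
- by move=> l _; apply/L2P; exact: fe.
- move=> f /L2P ff eps eps0.
  have [n [s [c [sL h]]]] := sp _ ff _ (exprn_gt0 2 eps0).
  by exists n, s, c; split => //; rewrite L2norm_lt.
Qed.

Hypothesis cL : countable Lambda.

(** Parseval for the shift of the window by z, which has norm 1. It holds at every z, not just
    almost everywhere. *)
Lemma basis_esum : orthonormal_basis Lambda e -> forall z,
  (\esum_(l in Lambda) (ambig W W (z - l))%:E = 1)%E.
Proof.
move=> B z; have sp := basis_inspan B; have [_ on _] := B.
under eq_esum do rewrite -sqn_L2dot_tf//.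
rewrite -W1 -(N2_tf z mW); apply/eqP; rewrite eq_le; apply/andP; split.
- exact: bessel.
- by apply: parseval => //; exact: sp.
Qed.

Lemma basis_ae : orthonormal_basis Lambda e ->
  {ae mu2, forall z, (\esum_(l in Lambda) (ambig W W (z - l))%:E = 1)%E}.
Proof. by move=> B; apply: aeW => z; exact: basis_esum. Qed.

(** The spectrogram of the window has integral at most 1 and tiles, so [integral_packing_le] limits
    the area of any packing set. This refutes a basis when [wide_set] packs. *)
Lemma basis_packing_le (D : set (R * R)) : measurable D -> orthonormal_basis Lambda e ->
  (forall y, (\esum_(l in Lambda) (\1_D (y - l) : R)%:E <= 1)%E) -> (mu2 D <= 1)%E.
Proof.
move=> mD B packD.
have := @integral_packing_le R Lambda cL (ambig W W) (\1_D : R * R -> R)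
  (measurable_ambig mW mW) (measurable_indic mD) (ambig_ge0 W W) (fun _ => ler0n _ _).
move=> /(_ (basis_ae B) 1 ler01 packD).
rewrite integral_indic// setIT => /le_trans; apply.
by rewrite mul1e (le_trans (moyal_le mW mW fW))// W1 mule1.
Qed.

Lemma basis_tiles (D : set (R * R)) : measurable D -> (1 <= mu2 D)%E ->
  orthonormal_basis Lambda e ->
  (forall y, (\esum_(l in Lambda) (\1_D (y - l) : R)%:E <= 1)%E) -> tiles Lambda D.
Proof.
move=> mD D1 B packD.
apply: (@packing_tile R Lambda cL (ambig W W) (\1_D : R * R -> R)
  (measurable_ambig mW mW) (measurable_indic mD) (ambig_ge0 W W) (fun _ => ler0n _ _)
  (basis_ae B) 1 ler01 packD).
- by rewrite (le_trans (moyal_le mW mW fW))// W1 mule1.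
- by rewrite integral_indic// setIT.
Qed.

(** A null set cannot contain an open square of side 1 / (n + 1). *)
Lemma ae_small (P : R * R -> Prop) (n : nat) : {ae mu2, forall y, P y} ->
  exists y, [/\ P y, 0 < y.1 < n.+1%:R^-1 & 0 < y.2 < n.+1%:R^-1].
Proof.
move=> [N [mN N0 PN]]; apply: contrapT => nP.
pose I : set R := `]0, n.+1%:R^-1[%classic.
have mI : measurable I by exact: measurable_itv.
have : (mu2 (I `*` I) <= mu2 N)%E.
  apply: le_measure; rewrite ?inE//; first exact: measurableX.
  move=> y [] /=; rewrite /I /= !in_itv /= => y1 y2.
  by apply: PN => Py; apply: nP; exists y.
have muI : mu I = (n.+1%:R^-1)%:E.
  by rewrite lebesgue_measure_itv/= lte_fin invr_gt0 ltr0n oppr0 adde0.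
rewrite N0 /plane_measure product_measure1E// [X in (X * _)%E]muI [X in (_ * X)%E]muI.
by rewrite -EFinM lee_fin leNgt mulr_gt0// invr_gt0 ltr0n.
Qed.

Hypotheses (oV : open V) (VW : V `<=` W) (V1 : mu V = 1%E).

(* For H open of finite measure, Bessel bounds the sum over Lambda of the
   spectrogram of 1_H by the constant mu H and the tiling forces equality almost
   everywhere: almost every time-frequency shift of 1_H lies in the closed span,
   and letting the shift tend to 0 so does 1_H. *)
Lemma tiles_basis (D : set (R * R)) : measurable D -> (mu2 D <= 1)%E ->
  tiles Lambda D ->
  (forall l m, Lambda l -> Lambda m -> L2dot (e l) (e m) = (l == m)%:R) ->
  orthonormal_basis Lambda e.
Proof.
move=> mD D1 tD on; apply: inspan_basis => //.
apply: inspan_L2 => // H oH fH.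
have mH := open_measurable oH.
have fmu : mu H \is a fin_num by rewrite ge0_fin_numE.
have dotE y l : sqn (L2dot (tfshift (ind H) y) (e l)) = ambig H W (y - l).
  exact: sqn_L2dot_tf.
have aeH : {ae mu2, forall y, (\esum_(l in Lambda) (ambig H W (y - l))%:E = (fine (mu H))%:E)%E}.
  apply: (@packing_tile R Lambda cL (\1_D : R * R -> R) (ambig H W)
    (measurable_indic mD) (measurable_ambig mH mW) (fun _ => ler0n _ _) (ambig_ge0 H W) tD).
  - exact: fine_ge0.
  - move=> y; rewrite fineK// -(N2_tf y mH).
    under eq_esum do rewrite -dotE.
    by apply: bessel => //; exact: fin2_tf.
  - by rewrite integral_indic// setIT.
  - by rewrite fineK// -[leLHS]mul1e -V1; exact: moyal_ge.
(* Equality in Bessel holds only off a null set, which might contain the origin; the shifts are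
   therefore taken from small squares next to it. *)
have good n : exists y, [/\ inspan Lambda e (tfshift (ind H) y),
    0 < y.1 < n.+1%:R^-1 & 0 < y.2 < n.+1%:R^-1].
  have [y [Py y1 y2]] := ae_small n aeH; exists y; split => //.
  apply: inspan_parseval => //; first exact: fin2_tf.
  by under eq_esum do rewrite dotE; rewrite Py fineK// N2_tf.
have [y yP] := choice good.
have small (f : nat -> R) : (forall n, 0 < f n < n.+1%:R^-1) -> f n @[n --> \oo] --> (0 : R).
  move=> h; apply: (@squeeze_cvgr _ _ _ _ (fun=> 0) (fun n => n.+1%:R^-1)).
  - by apply: nearW => n; have /andP[/ltW -> /ltW ->] := h n.
  - exact: cvg_cst.
  - exact: cvg_harmonic.
have lim := N2_sub_tf_cvg oH fH (small _ (fun n => let: And3 _ h _ := yP n in h))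
  (small _ (fun n => let: And3 _ _ h := yP n in h)).
apply: inspan_lim => //; first exact: cmeas_ind.
move=> eps eps0.
have nb : nbhs (0%E : \bar R) [set x | (x < eps%:E)%E].
  by apply: open_nbhs_nbhs; split; [exact: open_ereal_lt_ereal|rewrite /= lte_fin].
have : \forall n \near \oo, (N2 (fun x => ind H x - tfshift (ind H) (y n) x)%R < eps%:E)%E.
  exact: (lim _ nb).
move=> [N _ /(_ N (leqnn N)) hN]; exists (tfshift (ind H) (y N)); split => //.
- exact: cmeas_tf.
- by have [] := yP N.
Qed.

End Assembly.

Theorem theorem4p3 (R : realType) (alpha beta : R) (Lambda : set (R * R))
    (beta_gt0 : 0 < beta)
    (alphaP : 0 < alpha < 2^-1 \/ (alpha = 2^-1 /\ 2^-1 <= beta))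
    (Lambda_countable : countable Lambda)
    (Lambda_discrete : Lambda `<=` isolated Lambda) :
  let g := window alpha beta in
  orthonormal_basis Lambda (tfshift g) <->
  ([set l - m | l in Lambda & m in Lambda]
     `<=` zero_set (stft g g) `|` [set 0]) /\
  tiles Lambda (tiling_set alpha beta).
Proof.
move=> g; rewrite {}/g -[window alpha beta]/(ind (Omega alpha beta)).
have al0 : 0 < alpha by case: alphaP => [/andP[]//|[-> _]]; rewrite invr_gt0.
have al2 : alpha <= 2^-1 by case: alphaP => [/andP[_ /ltW]//|[-> _]].
have al01 : 0 <= alpha <= 1 by apply/andP; split; lra.
have mW := measurable_Omega alpha beta.
have W1 := mu_Omega al01 beta_gt0.
have mD := measurable_tiling_set beta_gt0 al2.
have D1 := mu_tiling_set al0 beta_gt0 al2.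
split => [B|[Lzero tD]]; last first.
  apply: (tiles_basis mW W1 Lambda_countable (@open_Omega_int R alpha beta)
    (@Omega_int_sub R alpha beta) (mu_Omega_int al01 beta_gt0) mD _ tD).
  - by rewrite D1.
  - by apply/orthonormal_tfP => //; apply/sub_zero_setP.
have [_ on _] := B.
have L0 : forall l m, Lambda l -> Lambda m -> l != m ->
    ambig (Omega alpha beta) (Omega alpha beta) (l - m) = 0 by apply/orthonormal_tfP.
split; first exact/sub_zero_setP.
apply: (basis_tiles mW W1 Lambda_countable mD _ B); first by rewrite D1.
apply: (nonvanishing_packing L0) => x y Dx Dy.
(* D packs in two of the three cases. When beta < 1 - alpha, the goal follows instead from a
   contradiction with the basis hypothesis. *)
case: alphaP => [/andP[_ al12]|[alE be12]]; last exact: nonvanishing_half.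
have [ab|ab] := leP (1 - alpha) beta; first exact: nonvanishing_lt.
have al1 : alpha < 1 by lra.
have := wide_set_gt1 al0 beta_gt0 al1; rewrite ltNge => /negP[].
apply: (basis_packing_le mW W1 Lambda_countable (measurable_wide_set alpha beta) B).
apply: (nonvanishing_packing L0) => u v; exact: nonvanishing_wide.
Qed.
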